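(* Fix a prime $p$ and a finite group $G$. Let $\mu$ be a homological (resp. cohomological) coefficient system for $G$. Let $D$ be a subgroup of $G$, and let $\mathcal D$ denote the set of conjugates of $D$ in $G$. Let $\mathcal C$ be a collection of $p$-subgroups of $G$ for which $D$ is a minimal element, and such that $\mathcal C$ contains all $p$-supergroups of $D$ (i.e. all $p$-subgroups of $G$ containing $D$). Let $W=W_G(D)$. Then the map $( * )_{\mathcal C\setminus\mathcal D}\to( * )_{\mathcal C}$ gives isomorphisms on Bredon homology (resp. cohomology) with coefficients in $\mu$ if and only if $\mathcal S_p(W)$ is homologically (resp. cohomologically) $\mu(G/D)$-ample.
   Context: A $G$-space is a simplicial set with $G$-action. A collection of subgroups of $G$ is a set of subgroups closed under conjugation. Coefficient systems. A homological (resp. cohomological) coefficient system for $G$ is a covariant (resp. contravariant) functor $\mu$ from finite $G$-sets to abelian groups taking coproducts to sums (resp. products); it is extended to all $G$-sets by colimits (resp. limits) over finite $G$-subsets. Bredon homology $H^G_*(X;\mu)$ (resp. cohomology $H_G^*(X;\mu)$) is the (co)homology of the normalized (co)chain complex obtained by applying $\mu$ degreewise to $X$. Weyl groups. $W_G(D)=N_G(D)/D$; it acts on $G/D$ by $G$-maps and hence on $\mu(G/D)$, making it a $W_G(D)$-module. Ampleness. $\mathcal S_p(W)$ is the poset of non-identity $p$-subgroups of a finite group $W$, with conjugation action of $W$, and $|\mathcal S_p(W)|$ its nerve. For a $W$-module $A$, $\mathcal S_p(W)$ is homologically (resp. cohomologically) $A$-ample if the map $|\mathcal S_p(W)|_{hW}\to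 *_{hW}=BW$ of Borel constructions ($X_{hW}=(EW\times X)/W$) induces an isomorphism on ordinary twisted homology (resp. cohomology) with coefficients in $A$. Approximations. For a collection $\mathcal C$ and a $G$-space $X$, a $\mathcal C$-approximation is a $G$-map $X_{\mathcal C}\to X$ such that all isotropy groups of $X_{\mathcal C}$ lie in $\mathcal C$ and $(X_{\mathcal C})^K\to X^K$ is a weak equivalence for every $K\in\mathcal C$. A functorial one is the homotopy coend over the orbit category $\mathcal O_{\mathcal C}$ (transitive $G$-sets with isotropy in $\mathcal C$) of the inclusion of $\mathcal O_{\mathcal C}$ in $G$-spaces with $S\mapsto\mathrm{map}_G(S,X)$. For $\mathcal C'\subseteq\mathcal C$ there is a natural map $X_{\mathcal C'}\to X_{\mathcal C}$ over $X$. $*$ denotes the one-point $G$-space. *)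

(* Defs.v *)
From HB Require Import structures.
From mathcomp Require Import all_boot all_order all_algebra all_fingroup.
From mathcomp Require Import pgroup generic_quotient ring_quotient.
From mathcomp Require Import boolp classical_sets functions cardinality fsbigop.
From mathcomp Require Import zify.

Set Implicit Arguments.
Unset Strict Implicit.
Unset Printing Implicit Defensive.

Import GRing.Theory.
Local Open Scope ring_scope.

Definition kerp (U V : zmodType) (f : {additive U -> V}) : {pred U} :=
  [pred x | f x == 0].

Lemma kerp_zmod (U V : zmodType) (f : {additive U -> V}) :
  zmod_closed (kerp f).
Proof.
split=> [|x y]; rewrite !inE ?raddf0 // => /eqP fx /eqP fy.
by rewrite raddfB fx fy subrr.
Qed.
HB.instance Definition _ (U V : zmodType) (f : {additive U -> V}) :=
  GRing.isZmodClosed.Build U (kerp f) (kerp_zmod f).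

Definition zspan (V : zmodType) (P : V -> Prop) : {pred V} :=
  [pred x | `[< forall H : zmodClosed V, (forall y, P y -> y \in H) -> x \in H >]].

Lemma zspan_zmod (V : zmodType) (P : V -> Prop) : zmod_closed (zspan P).
Proof.
split=> [|x y /asboolP Px /asboolP Py]; apply/asboolP => H PH; first exact: rpred0.
by apply: rpredB; [exact: Px | exact: Py].
Qed.
HB.instance Definition _ (V : zmodType) (P : V -> Prop) :=
  GRing.isZmodClosed.Build V (zspan P) (zspan_zmod P).

Lemma mem_zspan (V : zmodType) (P : V -> Prop) x : P x -> x \in zspan P.
Proof. by move=> Px; apply/asboolP => H; apply. Qed.

Lemma zspan_min (V : zmodType) (P : V -> Prop) (H : zmodClosed V) x :
  (forall y, P y -> y \in H) -> x \in zspan P -> x \in H.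
Proof. by move=> PH /asboolP; apply. Qed.

Definition preimp (U V : zmodType) (f : {additive U -> V}) (T : zmodClosed V) :
  {pred U} := [pred x | f x \in T].
Lemma preimp_zmod (U V : zmodType) (f : {additive U -> V}) (T : zmodClosed V) :
  zmod_closed (preimp f T).
Proof.
split=> [|x y]; rewrite !inE ?raddf0 ?rpred0 // raddfB; exact: rpredB.
Qed.
HB.instance Definition _ (U V : zmodType) (f : {additive U -> V})
    (T : zmodClosed V) :=
  GRing.isZmodClosed.Build U (preimp f T) (preimp_zmod f T).

Lemma zspan_map (U V : zmodType) (f : {additive U -> V}) (P : U -> Prop)
    (T : zmodClosed V) :
  (forall x, P x -> f x \in T) -> forall x, x \in zspan P -> f x \in T.
Proof. by move=> PT x /(zspan_min (H := preimp f T)); apply=> y /PT. Qed.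

Record subz (V : zmodType) (S : zmodClosed V) :=
  SubZ { subz_val :> V; _ : subz_val \in S }.
HB.instance Definition _ (V : zmodType) (S : zmodClosed V) :=
  [isSub for @subz_val V S].
HB.instance Definition _ (V : zmodType) (S : zmodClosed V) :=
  [Choice of subz S by <:].
HB.instance Definition _ (V : zmodType) (S : zmodClosed V) :=
  [SubChoice_isSubZmodule of subz S by <:].

Section SubMap.
Variables (U V : zmodType) (S : zmodClosed U) (T : zmodClosed V).
Variables (f : {additive U -> V}) (fST : forall x, x \in S -> f x \in T).

Definition subz_map (x : subz S) : subz T := SubZ (fST (valP x)).
Lemma subz_map_additive : zmod_morphism subz_map.
Proof. by move=> x y; apply: val_inj; rewrite /= !raddfB. Qed.
HB.instance Definition _ :=
  GRing.isZmodMorphism.Build (subz S) (subz T) subz_map subz_map_additive.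
End SubMap.
Arguments subz_map {U V S T} f fST.

Section QuotMap.
Variables (U V : zmodType) (S : zmodClosed U) (T : zmodClosed V).

(* The inclusion is not used by the function itself, but it is what makes it
   well defined on classes, and additive. *)
Definition quot_map (f : {additive U -> V})
    (fST : forall x, x \in S -> f x \in T) (x : {ideal_quot S}) :
  {ideal_quot T} := (\pi_({ideal_quot T}) (f (repr x)))%qT.

Variables (f : {additive U -> V}) (fST : forall x, x \in S -> f x \in T).

Lemma quot_map_pi x :
  quot_map fST (\pi_({ideal_quot S}) x)%qT = (\pi_({ideal_quot T}) (f x))%qT.
Proof.
rewrite /quot_map; apply/eqP; rewrite -Quotient.idealrBE -raddfB; apply: fST.
by rewrite Quotient.idealrBE reprK.
Qed.

Lemma quot_map_additive : zmod_morphism (quot_map fST).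
Proof.
move=> x y; rewrite -[x]reprK -[y]reprK -raddfB !quot_map_pi.
by rewrite !raddfB.
Qed.
HB.instance Definition _ :=
  GRing.isZmodMorphism.Build {ideal_quot S} {ideal_quot T} (quot_map fST)
    quot_map_additive.
End QuotMap.
Arguments quot_map {U V S T} f fST _ : simpl never.

Section HomologyAtASpot.
Variables (U V W : zmodType) (f : {additive U -> V}) (g : {additive V -> W}).

Definition boundaries : {pred subz (kerp g)} :=
  [pred z | `[< exists y, val z = f y >]].
Lemma boundaries_zmod : zmod_closed boundaries.
Proof.
split=> [|u v /asboolP[x ux] /asboolP[y vy]]; apply/asboolP.
  by exists 0; rewrite !raddf0.
by exists (x - y); rewrite !raddfB /= ux vy.
Qed.
HB.instance Definition _ :=
  GRing.isZmodClosed.Build (subz (kerp g)) boundaries boundaries_zmod.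

Definition hgroup : zmodType := {ideal_quot boundaries}.
End HomologyAtASpot.

Section HomologyAtASpotMap.
Variables (U V W U' V' W' : zmodType).
Variables (f : {additive U -> V}) (g : {additive V -> W}).
Variables (f' : {additive U' -> V'}) (g' : {additive V' -> W'}).
Variables (a : {additive U -> U'}) (b : {additive V -> V'}).
Variables (c : {additive W -> W'}).
Hypotheses (abf : forall x, b (f x) = f' (a x)).
Hypotheses (bcg : forall x, c (g x) = g' (b x)).

Lemma hgroup_map_ker x : x \in kerp g -> b x \in kerp g'.
Proof. by rewrite !inE -bcg => /eqP ->; rewrite raddf0. Qed.

Lemma hgroup_map_im z : z \in @boundaries _ _ _ f g ->
  subz_map b hgroup_map_ker z \in @boundaries _ _ _ f' g'.
Proof.
move=> /asboolP[x zx]; apply/asboolP; exists (a x).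
by rewrite /= -abf; congr (b _).
Qed.

Definition hgroup_map : {additive hgroup f g -> hgroup f' g'} :=
  quot_map (subz_map b hgroup_map_ker) hgroup_map_im.
End HomologyAtASpotMap.

Definition zmap (U V : zmodType) (_ : U) : V := 0.
Lemma zmap_additive (U V : zmodType) : zmod_morphism (@zmap U V).
Proof. by move=> x y; rewrite /zmap subrr. Qed.
HB.instance Definition _ (U V : zmodType) :=
  GRing.isZmodMorphism.Build U V (@zmap U V) (@zmap_additive U V).

Record chain_complex := ChainComplex {
  chain :> nat -> zmodType;
  bd : forall n, {additive chain n.+1 -> chain n};
  bd_bd : forall n x, bd n (bd n.+1 x) = 0 }.

Record cochain_complex := CochainComplex {
  cochain :> nat -> zmodType;
  cobd : forall n, {additive cochain n -> cochain n.+1};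
  cobd_cobd : forall n x, cobd n.+1 (cobd n x) = 0 }.

Record chain_map (C C' : chain_complex) := ChainMap {
  chain_fun :> forall n, {additive C n -> C' n};
  chain_funP : forall n x, chain_fun n (bd C n x) = bd C' n (chain_fun n.+1 x) }.

Record cochain_map (C C' : cochain_complex) := CochainMap {
  cochain_fun :> forall n, {additive C n -> C' n};
  cochain_funP : forall n x,
    cochain_fun n.+1 (cobd C n x) = cobd C' n (cochain_fun n x) }.

Definition bd_from (C : chain_complex) n : {additive C n -> C n.-1} :=
  match n with 0 => @zmap (C 0%N) (C 0%N) | n'.+1 => bd C n' end.

Definition cobd_into (C : cochain_complex) n : {additive C n.-1 -> C n} :=
  match n with 0 => @zmap (C 0%N) (C 0%N) | n'.+1 => cobd C n' end.

Definition homology (C : chain_complex) n : zmodType :=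
  hgroup (bd C n) (bd_from C n).

Definition cohomology (C : cochain_complex) n : zmodType :=
  hgroup (cobd_into C n) (cobd C n).

Lemma bd_fromP (C C' : chain_complex) (f : chain_map C C') n x :
  f n.-1 (bd_from C n x) = bd_from C' n (f n x).
Proof. by case: n x => [|n] x /=; [rewrite raddf0 | rewrite chain_funP]. Qed.

Lemma cobd_intoP (C C' : cochain_complex) (f : cochain_map C C') n x :
  f n (cobd_into C n x) = cobd_into C' n (f n.-1 x).
Proof. by case: n x => [|n] x /=; [rewrite raddf0 | rewrite cochain_funP]. Qed.

Definition homology_map (C C' : chain_complex) (f : chain_map C C') n :
    {additive homology C n -> homology C' n} :=
  hgroup_map (fun x => chain_funP f x) (fun x => bd_fromP f x).

Definition cohomology_map (C C' : cochain_complex) (f : cochain_map C C') n :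
    {additive cohomology C n -> cohomology C' n} :=
  hgroup_map (fun x => cobd_intoP f x) (fun x => cochain_funP f x).

(* The simplicial category: the object [n] is {0, ..., n}. *)
Record mono (m n : nat) := Mono {
  mono_fun :> 'I_m.+1 -> 'I_n.+1;
  mono_le : forall i j : 'I_m.+1, (i <= j)%N -> (mono_fun i <= mono_fun j)%N }.

Lemma mono_eq m n (f g : mono m n) : f =1 g -> f = g.
Proof.
case: f g => [f Hf] [g Hg] /= /funext fg; rewrite -{}fg in Hg *.
by congr Mono; exact: Prop_irrelevance.
Qed.

Definition mono_id n : mono n n := @Mono n n id (fun _ _ ij => ij).

Definition mono_comp l m n (f : mono m n) (g : mono l m) : mono l n :=
  @Mono l n (fun i => f (g i)) (fun _ _ ij => mono_le f (mono_le g ij)).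

(* [coface n i] is the injection whose image misses [i]; [codegen n j] is the
   surjection hitting [j] twice. *)
Lemma coface_subproof n i (k : 'I_n.+1) : (bump i k < n.+2)%N.
Proof. by have := ltn_ord k; rewrite /bump; lia. Qed.
Lemma coface_le n i (k l : 'I_n.+1) : (k <= l)%N ->
  (Ordinal (coface_subproof i k) <= Ordinal (coface_subproof i l))%N.
Proof. by rewrite /= /bump; lia. Qed.
Definition coface n (i : nat) : mono n n.+1 := Mono (@coface_le n i).

Lemma codegen_subproof n (j : 'I_n.+1) (k : 'I_n.+2) : (unbump j k < n.+1)%N.
Proof. by have := ltn_ord k; have := ltn_ord j; rewrite /unbump; lia. Qed.
Lemma codegen_le n (j : 'I_n.+1) (k l : 'I_n.+2) : (k <= l)%N ->
  (Ordinal (codegen_subproof j k) <= Ordinal (codegen_subproof j l))%N.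
Proof. by rewrite /= /unbump; lia. Qed.
Definition codegen n (j : 'I_n.+1) : mono n.+1 n := Mono (@codegen_le n j).

Lemma coface_coface n i j : (i < j)%N ->
  mono_comp (coface n.+1 j) (coface n i) =
  mono_comp (coface n.+1 i) (coface n j.-1).
Proof.
by move=> ij; apply: mono_eq => k; apply: val_inj; rewrite /= /bump; lia.
Qed.

Lemma codegen_coface_id n (j : 'I_n.+1) (i : nat) : i = j \/ i = j.+1 ->
  mono_comp (codegen j) (coface n i) = mono_id n.
Proof.
by move=> ij; apply: mono_eq => k; apply: val_inj; rewrite /= /bump /unbump; lia.
Qed.

Lemma codegen_coface n (j : 'I_n.+2) (i : nat) :
    (i < n.+3)%N -> i <> j -> i <> j.+1 ->
  exists i' (j' : 'I_n.+1),
    mono_comp (codegen j) (coface n.+1 i) =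
    mono_comp (coface n i') (codegen j').
Proof.
move=> ilt ij ij1; have jlt := ltn_ord j.
have [lt_ij | le_ji] := ltnP i j.
  have Hj : (j.-1 < n.+1)%N by lia.
  exists i, (Ordinal Hj); apply: mono_eq => k; apply: val_inj.
  by rewrite /= /bump /unbump; lia.
have Hj : (j < n.+1)%N by lia.
exists i.-1, (Ordinal Hj); apply: mono_eq => k; apply: val_inj.
by rewrite /= /bump /unbump; lia.
Qed.

Lemma alt_sum_cancel (V : zmodType) n (T : nat -> nat -> V) :
    (forall i j, (i < j < n.+1)%N -> T i j = T j.-1 i) ->
  \sum_(i < n) \sum_(j < n.+1) (T i j *~ (-1) ^+ (i + j)) = 0.
Proof.
move=> TE; rewrite pair_big /=.
rewrite (bigID (fun u : 'I_n * 'I_n.+1 => (u.1 < u.2)%N)) /=.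
set A := (X in X + _ = 0); set B := (X in _ + X = 0).
suff -> : A = - B by rewrite addNr.
rewrite {}/A {}/B.
case: n TE => [|n] TE.
  by rewrite !big1 ?oppr0 // => -[[]].
rewrite (reindex_onto
  (fun u : 'I_n.+1 * 'I_n.+2 => (inord u.2, inord u.1.+1) : 'I_n.+1 * 'I_n.+2)
  (fun u : 'I_n.+1 * 'I_n.+2 => (inord u.2.-1, inord u.1))) /=; last first.
  move=> [i j] /= ij; have := ltn_ord i; have := ltn_ord j => *.
  by congr pair; apply: val_inj; rewrite /= !inordK; lia.
rewrite -sumrN (eq_bigl (fun u : 'I_n.+1 * 'I_n.+2 => ~~ (u.1 < u.2)%N)) /=.
  apply: eq_bigr => -[i j] /=; rewrite -leqNgt => ji; have := ltn_ord i => iN.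
  have jK : nat_of_ord (inord j : 'I_n.+1) = j by rewrite inordK; lia.
  have iK : nat_of_ord (inord i.+1 : 'I_n.+2) = i.+1 by rewrite inordK; lia.
  by rewrite jK iK TE /= ?addnS ?exprS ?mulN1r ?mulrNz ?[(j + i)%N]addnC //; lia.
move=> [i j] /=; have := ltn_ord i => iN; have := ltn_ord j => jN.
have iK : nat_of_ord (inord i.+1 : 'I_n.+2) = i.+1 by rewrite inordK; lia.
rewrite iK /= -leqNgt ltnS; have [ji|ij] := leqP j i.
  have jK : nat_of_ord (inord j : 'I_n.+1) = j by rewrite inordK; lia.
  by rewrite jK ji !inord_val eqxx.
have [jn|jn] := leqP j n; first by rewrite inordK ?ltnS // leqNgt ij.
have j0 : nat_of_ord (inord j : 'I_n.+1) = 0%N.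
  by rewrite /inord val_insubd; case: ifP => //; lia.
by apply/negP => /andP[_ /eqP[_ /(congr1 val)]] /=; rewrite j0 inordK //; lia.
Qed.

Record szmod := SZmod {
  szob :> nat -> zmodType;
  szmor : forall m n, mono m n -> {additive szob n -> szob m};
  szmor_id : forall n x, szmor (mono_id n) x = x;
  szmor_comp : forall l m n (f : mono m n) (g : mono l m) x,
    szmor (mono_comp f g) x = szmor g (szmor f x) }.

Record czmod := CZmod {
  czob :> nat -> zmodType;
  czmor : forall m n, mono m n -> {additive czob m -> czob n};
  czmor_id : forall n x, czmor (mono_id n) x = x;
  czmor_comp : forall l m n (f : mono m n) (g : mono l m) x,
    czmor (mono_comp f g) x = czmor f (czmor g x) }.

Record szmap (M N : szmod) := SZMap {
  szmap_fun :> forall n, {additive M n -> N n};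
  szmapP : forall m n (f : mono m n) x,
    szmap_fun m (szmor M f x) = szmor N f (szmap_fun n x) }.

Record czmap (M N : czmod) := CZMap {
  czmap_fun :> forall n, {additive M n -> N n};
  czmapP : forall m n (f : mono m n) x,
    czmap_fun n (czmor M f x) = czmor N f (czmap_fun m x) }.

Section NormalizedChains.
Variable M : szmod.

Definition alt_face n (x : M n.+1) : M n :=
  \sum_(i < n.+2) (szmor M (coface n i) x *~ (-1) ^+ i).

Lemma alt_face_additive n : zmod_morphism (@alt_face n).
Proof.
move=> x y; rewrite /alt_face -sumrB; apply: eq_bigr => i _.
by rewrite raddfB mulrzBl.
Qed.
HB.instance Definition _ n :=
  GRing.isZmodMorphism.Build _ _ (@alt_face n) (@alt_face_additive n).

Lemma alt_face_face n (x : M n.+2) : alt_face (alt_face x) = 0.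
Proof.
rewrite /alt_face -[RHS](@alt_sum_cancel _ n.+2
  (fun i j => szmor M (coface n i) (szmor M (coface n.+1 j) x))).
  apply: eq_bigr => i _; rewrite raddf_sum mulrz_suml; apply: eq_bigr => j _.
  by rewrite raddfMz -mulrzA -exprD addnC.
by move=> i j /andP[ij _]; rewrite -!szmor_comp coface_coface.
Qed.

Definition is_degen n : M n -> Prop :=
  match n with
  | 0 => fun=> False
  | m.+1 => fun x => exists (j : 'I_m.+1) (y : M m), x = szmor M (codegen j) y
  end.

Lemma alt_face_degen n (x : M n.+1) :
  x \in zspan (@is_degen n.+1) -> alt_face x \in zspan (@is_degen n).
Proof.
apply: zspan_map x => x [j [z ->{x}]]; rewrite /= /alt_face.
have jn := ltn_ord j.
have j1 : (j < n.+2)%N by lia.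
have j2 : (j.+1 < n.+2)%N by lia.
rewrite (bigD1 (Ordinal j1)) // (bigD1 (Ordinal j2)) /=; last first.
  by rewrite -val_eqE /=; lia.
rewrite -!szmor_comp !codegen_coface_id; [|by right|by left].
rewrite szmor_id addrA exprS mulN1r mulrNz subrr add0r.
apply: rpred_sum => i /andP[]; rewrite -!val_eqE /= => /eqP ij /eqP ij1.
apply: rpredMz; rewrite -szmor_comp.
case: n j z jn j1 j2 i ij ij1 => [|n] j z jn _ _ i ij ij1.
  by have := ltn_ord i; lia.
have [i' [j' ->]] := codegen_coface (ltn_ord i) ij ij1.
by rewrite szmor_comp; apply: mem_zspan; exists j', (szmor M (coface n i') z).
Qed.

Definition normalized n : zmodType := {ideal_quot (zspan (@is_degen n))}.

Definition normalized_bd n : {additive normalized n.+1 -> normalized n} :=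
  quot_map (@alt_face n) (@alt_face_degen n).

Lemma normalized_bd_bd n x : normalized_bd n (normalized_bd n.+1 x) = 0.
Proof.
elim/quotW: x => x; rewrite /normalized_bd /= !quot_map_pi /=.
by rewrite alt_face_face raddf0.
Qed.

Definition normalized_chains := ChainComplex normalized_bd_bd.
End NormalizedChains.

Section NormalizedChainMap.
Variables (M N : szmod) (f : szmap M N).

Lemma szmap_degen n x : x \in zspan (@is_degen M n) ->
  f n x \in zspan (@is_degen N n).
Proof.
case: n x => [|n] x; apply: zspan_map x => // x [j [z ->]].
by apply: mem_zspan; exists j, (f n z); rewrite szmapP.
Qed.

Definition normalized_fun n : {additive normalized M n -> normalized N n} :=
  quot_map (f n) (@szmap_degen n).

Lemma normalized_funP n x :
  normalized_fun n (bd (normalized_chains M) n x) =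
  bd (normalized_chains N) n (normalized_fun n.+1 x).
Proof.
elim/quotW: x => x; rewrite /= !quot_map_pi; congr (\pi)%qT.
rewrite /= /alt_face raddf_sum; apply: eq_bigr => i _.
by rewrite raddfMz szmapP.
Qed.

Definition normalized_chain_map :
    chain_map (normalized_chains M) (normalized_chains N) :=
  @ChainMap (normalized_chains M) (normalized_chains N)
    normalized_fun normalized_funP.
End NormalizedChainMap.

Section NormalizedCochains.
Variable M : czmod.

Definition alt_coface n (x : M n) : M n.+1 :=
  \sum_(i < n.+2) (czmor M (coface n i) x *~ (-1) ^+ i).

Lemma alt_coface_additive n : zmod_morphism (@alt_coface n).
Proof.
move=> x y; rewrite /alt_coface -sumrB; apply: eq_bigr => i _.
by rewrite raddfB mulrzBl.
Qed.
HB.instance Definition _ n :=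
  GRing.isZmodMorphism.Build _ _ (@alt_coface n) (@alt_coface_additive n).

Lemma alt_coface_coface n (x : M n) : alt_coface (alt_coface x) = 0.
Proof.
rewrite /alt_coface -[RHS](@alt_sum_cancel _ n.+2
  (fun i j => czmor M (coface n.+1 j) (czmor M (coface n i) x))).
  rewrite exchange_big /=.
  apply: eq_bigr => j _; rewrite raddf_sum mulrz_suml; apply: eq_bigr => i _.
  by rewrite raddfMz -mulrzA -exprD.
by move=> i j /andP[ij _]; rewrite -!czmor_comp coface_coface.
Qed.

Definition codegen_kernel n : {pred M n} :=
  match n return {pred M n} with
  | 0 => fun=> true
  | m.+1 => fun x => [forall j : 'I_m.+1, czmor M (codegen j) x == 0]
  end.

Lemma codegen_kernel_zmod n : zmod_closed (@codegen_kernel n).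
Proof.
case: n => [|n] //; split=> [|x y]; rewrite !unfold_in /=.
  by apply/forallP => j; rewrite raddf0.
move=> /forallP xP /forallP yP; apply/forallP => j.
by rewrite raddfB (eqP (xP j)) (eqP (yP j)) subrr.
Qed.
HB.instance Definition _ n :=
  GRing.isZmodClosed.Build (M n) (@codegen_kernel n) (codegen_kernel_zmod n).

Lemma alt_coface_kernel n (x : M n) :
  x \in @codegen_kernel n -> alt_coface x \in @codegen_kernel n.+1.
Proof.
rewrite !unfold_in => xK; apply/forallP => j /=.
have jn := ltn_ord j.
have j1 : (j < n.+2)%N by lia.
have j2 : (j.+1 < n.+2)%N by lia.
rewrite /alt_coface (bigD1 (Ordinal j1)) // (bigD1 (Ordinal j2)) /=; last first.
  by rewrite -val_eqE /=; lia.
rewrite !raddfD /= !raddfMz -!czmor_comp !codegen_coface_id; [|by right|by left].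
rewrite czmor_id addrA exprS mulN1r mulrNz subrr add0r.
rewrite raddf_sum big1 // => i /andP[]; rewrite -!val_eqE /= => /eqP ij /eqP ij1.
rewrite raddfMz -czmor_comp.
case: n x xK j jn j1 j2 i ij ij1 => [|n] x xK j jn _ _ i ij ij1.
  by have := ltn_ord i; lia.
have [i' [j' ->]] := codegen_coface (ltn_ord i) ij ij1.
by rewrite czmor_comp (eqP (forallP xK j')) raddf0 mul0rz.
Qed.

Definition conormalized n : zmodType := subz (@codegen_kernel n).

Definition conormalized_cobd n :
    {additive conormalized n -> conormalized n.+1} :=
  subz_map (@alt_coface n) (@alt_coface_kernel n).

Lemma conormalized_cobd_cobd n x :
  conormalized_cobd n.+1 (conormalized_cobd n x) = 0.
Proof. by apply: val_inj; rewrite /= alt_coface_coface. Qed.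

Definition normalized_cochains := CochainComplex conormalized_cobd_cobd.
End NormalizedCochains.

Section NormalizedCochainMap.
Variables (M N : czmod) (f : czmap M N).

Lemma czmap_kernel n x : x \in @codegen_kernel M n ->
  f n x \in @codegen_kernel N n.
Proof.
case: n x => [|n] x; rewrite !unfold_in //= => /forallP xP.
by apply/forallP => j; rewrite -czmapP (eqP (xP j)) raddf0.
Qed.

Definition conormalized_fun n :
    {additive conormalized M n -> conormalized N n} :=
  subz_map (f n) (@czmap_kernel n).

Lemma conormalized_funP n x :
  conormalized_fun n.+1 (cobd (normalized_cochains M) n x) =
  cobd (normalized_cochains N) n (conormalized_fun n x).
Proof.
apply: val_inj; rewrite /= /alt_coface raddf_sum; apply: eq_bigr => i _.
by rewrite raddfMz czmapP.
Qed.

Definition normalized_cochain_map :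
    cochain_map (normalized_cochains M) (normalized_cochains N) :=
  @CochainMap (normalized_cochains M) (normalized_cochains N)
    conormalized_fun conormalized_funP.
End NormalizedCochainMap.

Record gset (gT : finGroupType) := GSet {
  gset_car :> choiceType;
  gset_act : {action gT &-> gset_car} }.

Record gmap (gT : finGroupType) (S T : gset gT) := GMap {
  gmap_fun :> S -> T;
  gmapJ : forall s g, gmap_fun (gset_act S s g) = gset_act T (gmap_fun s) g }.

Lemma gset_act1 (gT : finGroupType) (S : gset gT) (s : S) : gset_act S s 1%g = s.
Proof.
case: (gset_act S) => to [inj_to toM] /=; apply: (inj_to 1%g).
by rewrite /= -toM ?inE // mulg1.
Qed.

Lemma gset_actM (gT : finGroupType) (S : gset gT) (s : S) g h :
  gset_act S s (g * h)%g = gset_act S (gset_act S s g) h.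
Proof. by case: (gset_act S) => to [_ toM] /=; rewrite toM ?inE. Qed.

Section GMaps.
Variable gT : finGroupType.
Implicit Types R S T : gset gT.

Lemma gmap_eq S T (f f' : gmap S T) : f =1 f' -> f = f'.
Proof.
case: f f' => [f Hf] [f' Hf'] /= /funext ff'; rewrite -{}ff' in Hf' *.
by congr GMap; exact: Prop_irrelevance.
Qed.

Definition gmap_id S : gmap S S := @GMap gT S S id (fun _ _ => erefl).

Lemma gmap_comp_subproof R S T (f : gmap S T) (h : gmap R S) r g :
  f (h (gset_act R r g)) = gset_act T (f (h r)) g.
Proof. by rewrite !gmapJ. Qed.
Definition gmap_comp R S T (f : gmap S T) (h : gmap R S) : gmap R T :=
  GMap (gmap_comp_subproof f h).

Section Sum.
Variables S T : gset gT.

Definition gsum_act (u : S + T) g : (S + T)%type :=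
  match u with
  | inl s => inl (gset_act S s g)
  | inr t => inr (gset_act T t g)
  end.
Lemma gsum_act1 : gsum_act^~ 1%g =1 id.
Proof. by case=> u /=; rewrite gset_act1. Qed.
Lemma gsum_actM u : act_morph gsum_act u.
Proof. by case: u => u g h /=; rewrite gset_actM. Qed.
Definition gsum : gset gT := GSet (TotalAction gsum_act1 gsum_actM).

Definition gsum_inl : gmap S gsum := @GMap gT S gsum inl (fun _ _ => erefl).
Definition gsum_inr : gmap T gsum := @GMap gT T gsum inr (fun _ _ => erefl).
End Sum.

Section Prod.
Variables S T : gset gT.

Definition gprod_act (u : S * T) g : (S * T)%type :=
  (gset_act S u.1 g, gset_act T u.2 g).
Lemma gprod_act1 : gprod_act^~ 1%g =1 id.
Proof. by case=> s t; rewrite /gprod_act !gset_act1. Qed.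
Lemma gprod_actM u : act_morph gprod_act u.
Proof. by move=> g h; rewrite /gprod_act !gset_actM. Qed.
Definition gprod : gset gT := GSet (TotalAction gprod_act1 gprod_actM).
End Prod.

Definition gunit_act (u : unit) (_ : gT) : unit := u.
Definition gunit : gset gT :=
  GSet (@TotalAction gT unit gunit_act (fun=> erefl) (fun _ _ _ => erefl)).

Section Orbit.
Variable H : {group gT}.

Definition orbit_car := {S : {set gT} | S \in rcosets H [set: gT]}.

Lemma orbit_act_subproof (S : orbit_car) g :
  (val S :* g)%g \in rcosets H [set: gT].
Proof.
have /rcosetsP[x _ ->] := valP S; rewrite -rcosetM.
by apply/rcosetsP; exists (x * g)%g; rewrite ?inE.
Qed.
Definition orbit_act (S : orbit_car) g : orbit_car :=
  exist _ (val S :* g)%g (orbit_act_subproof S g).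
Lemma orbit_act1 : orbit_act^~ 1%g =1 id.
Proof. by move=> S; apply: val_inj; rewrite /= rcoset1. Qed.
Lemma orbit_actM (S : orbit_car) : act_morph orbit_act S.
Proof. by move=> g h; apply: val_inj; rewrite /= rcosetM. Qed.

(* Groups act on the right, so G/H consists of the right cosets of H. *)
Definition gorbit : gset gT := GSet (TotalAction orbit_act1 orbit_actM).
End Orbit.

Section WeylAction.
Variables (D : {group gT}) (w : coset_of D).

Lemma weyl_subproof (S : gorbit D) :
  ((w : {set gT}) * val S)%g \in rcosets D [set: gT].
Proof.
have [x Nx ->] := cosetP w; have /rcosetsP[y _ ->] := valP S.
rewrite val_coset //; apply/rcosetsP; exists (x * y)%g; rewrite ?inE //.
by rewrite rcoset_mul.
Qed.
Definition weyl_fun (S : gorbit D) : gorbit D :=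
  (exist _ ((w : {set gT}) * val S)%g (weyl_subproof S) : orbit_car D).
Lemma weyl_funJ (S : gorbit D) g :
  weyl_fun (gset_act (gorbit D) S g) = gset_act (gorbit D) (weyl_fun S) g.
Proof. by apply: val_inj; rewrite /= mulgA. Qed.

(* The type [coset_of D] is the group W_G(D) = N_G(D)/D; it acts on G/D on
   the left. *)
Definition weyl_map : gmap (gorbit D) (gorbit D) := GMap weyl_funJ.
End WeylAction.

Lemma weyl_map1 (D : {group gT}) : weyl_map (1%g : coset_of D) = gmap_id _.
Proof.
apply: gmap_eq => S; apply: val_inj; rewrite /=.
have /rcosetsP[y _ ->] := valP S.
by rewrite genGid mulgA mulGid.
Qed.

Lemma weyl_mapM (D : {group gT}) (v w : coset_of D) :
  weyl_map (v * w)%g = gmap_comp (weyl_map v) (weyl_map w).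
Proof. by apply: gmap_eq => S; apply: val_inj; rewrite /= mulgA. Qed.

End GMaps.

(* A G-space is a simplicial object in the category of G-sets. *)
Record gspace (gT : finGroupType) := GSpace {
  gsimp :> nat -> gset gT;
  gspmor : forall m n, mono m n -> gmap (gsimp n) (gsimp m);
  gspmor_id : forall n x, gspmor (mono_id n) x = x;
  gspmor_comp : forall l m n (f : mono m n) (h : mono l m) x,
    gspmor (mono_comp f h) x = gspmor h (gspmor f x) }.

Record gspmap (gT : finGroupType) (X Y : gspace gT) := GSpMap {
  gspmap_fun :> forall n, gmap (X n) (Y n);
  gspmapP : forall m n (f : mono m n) x,
    gspmap_fun m (gspmor X f x) = gspmor Y f (gspmap_fun n x) }.

Section BasicSpaces.
Variable gT : finGroupType.

Definition gpoint : gspace gT :=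
  @GSpace gT (fun=> gunit gT) (fun _ _ _ => gmap_id _)
    (fun _ _ => erefl) (fun _ _ _ _ _ _ => erefl).

Section SpProd.
Variables X Y : gspace gT.

Definition spprod_fun m n (f : mono m n) (u : gprod (X n) (Y n)) :
  gprod (X m) (Y m) := (gspmor X f u.1, gspmor Y f u.2).
Lemma spprod_funJ m n (f : mono m n) u g :
  spprod_fun f (gset_act _ u g) = gset_act _ (spprod_fun f u) g.
Proof. by rewrite /spprod_fun /= /gprod_act /= !gmapJ. Qed.
Lemma spprod_id n u : GMap (spprod_funJ (mono_id n)) u = u.
Proof. by case: u => x y; rewrite /= /spprod_fun /= !gspmor_id. Qed.
Lemma spprod_comp l m n (f : mono m n) (h : mono l m) u :
  GMap (spprod_funJ (mono_comp f h)) u =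
  GMap (spprod_funJ h) (GMap (spprod_funJ f) u).
Proof. by case: u => x y; rewrite /= /spprod_fun /= !gspmor_comp. Qed.
Definition spprod : gspace gT := GSpace spprod_id spprod_comp.
End SpProd.

Section SpProdMap.
Variables (E X Y : gspace gT) (f : gspmap X Y).

Definition spprod_map_fun n (u : spprod E X n) : spprod E Y n := (u.1, f n u.2).
Lemma spprod_map_funJ n u g :
  @spprod_map_fun n (gset_act _ u g) = gset_act _ (spprod_map_fun u) g.
Proof. by rewrite /spprod_map_fun /= /gprod_act /= gmapJ. Qed.
Lemma spprod_mapP m n (h : mono m n) u :
  GMap (@spprod_map_funJ m) (gspmor (spprod E X) h u) =
  gspmor (spprod E Y) h (GMap (@spprod_map_funJ n) u).
Proof. by rewrite /= /spprod_map_fun /= /spprod_fun /= gspmapP. Qed.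
Definition spprod_map : gspmap (spprod E X) (spprod E Y) := GSpMap spprod_mapP.
End SpProdMap.

Definition to_gpoint (X : gspace gT) : gspmap X gpoint :=
  @GSpMap gT X gpoint
    (fun n => @GMap gT (X n) (gpoint n) (fun=> tt) (fun _ _ => erefl))
    (fun _ _ _ _ => erefl).

Section EG.
Definition EG_act n (f : 'I_n.+1 -> gT) g : 'I_n.+1 -> gT :=
  fun i => (f i * g)%g.
Lemma EG_act1 n : (@EG_act n)^~ 1%g =1 id.
Proof. by move=> f; apply: funext => i; rewrite /EG_act mulg1. Qed.
Lemma EG_actM n f : act_morph (@EG_act n) f.
Proof. by move=> g h; apply: funext => i; rewrite /EG_act mulgA. Qed.
Definition EG_simp n : gset gT :=
  GSet (TotalAction (@EG_act1 n) (@EG_actM n)).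
Definition EG_mor m n (f : mono m n) : gmap (EG_simp n) (EG_simp m) :=
  @GMap gT (EG_simp n) (EG_simp m) (fun e i => e (f i)) (fun _ _ => erefl).

(* An n-simplex of EG is a sequence (g_0, ..., g_n) of elements of G. *)
Definition EG : gspace gT :=
  @GSpace gT EG_simp EG_mor (fun _ _ => erefl) (fun _ _ _ _ _ _ => erefl).
End EG.

End BasicSpaces.

Record fingset (gT : finGroupType) := FinGSet {
  fingset_gset :> gset gT;
  fingset_fin : finite_set [set: fingset_gset]%classic }.

Lemma fingsum_subproof (gT : finGroupType) (S T : fingset gT) :
  finite_set [set: gsum S T]%classic.
Proof.
have -> : [set: gsum S T]%classic =
    ((inl : S -> gsum S T) @` [set: S] `|` (inr : T -> gsum S T) @` [set: T])%classic.
  by apply/seteqP; split=> // -[s|t] _; [left; exists s | right; exists t].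
by rewrite finite_setU; split; apply: finite_image; apply: fingset_fin.
Qed.
Definition fingsum (gT : finGroupType) (S T : fingset gT) : fingset gT :=
  FinGSet (fingsum_subproof S T).

(* A homological (resp. cohomological) coefficient system, given by its values
   on finite G-sets. *)
Record hcoef (gT : finGroupType) := HCoef {
  hc_ob :> fingset gT -> zmodType;
  hc_mor : forall S T : fingset gT, gmap S T -> {additive hc_ob S -> hc_ob T};
  hc_id : forall (S : fingset gT) x, @hc_mor S S (gmap_id S) x = x;
  hc_comp : forall (R S T : fingset gT) (f : gmap S T) (h : gmap R S) x,
    @hc_mor R T (gmap_comp f h) x = hc_mor f (hc_mor h x);
  hc_empty : forall S : fingset gT, (S -> False) -> forall x : hc_ob S, x = 0;
  hc_sum : forall S T : fingset gT,
    bijective (fun u : hc_ob S * hc_ob T =>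
      @hc_mor S (fingsum S T) (gsum_inl S T) u.1 +
      @hc_mor T (fingsum S T) (gsum_inr S T) u.2) }.

Record ccoef (gT : finGroupType) := CCoef {
  cc_ob :> fingset gT -> zmodType;
  cc_mor : forall S T : fingset gT, gmap S T -> {additive cc_ob T -> cc_ob S};
  cc_id : forall (S : fingset gT) x, @cc_mor S S (gmap_id S) x = x;
  cc_comp : forall (R S T : fingset gT) (f : gmap S T) (h : gmap R S) x,
    @cc_mor R T (gmap_comp f h) x = cc_mor h (cc_mor f x);
  cc_empty : forall S : fingset gT, (S -> False) -> forall x : cc_ob S, x = 0;
  cc_prod : forall S T : fingset gT,
    bijective (fun x : cc_ob (fingsum S T) =>
      (@cc_mor S (fingsum S T) (gsum_inl S T) x,
       @cc_mor T (fingsum S T) (gsum_inr S T) x)) }.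

Lemma hc_mor_eq (gT : finGroupType) (mu : hcoef gT) (S T : fingset gT)
    (f f' : gmap S T) (x : mu S) :
  f =1 f' -> hc_mor mu f x = hc_mor mu f' x.
Proof. by move/gmap_eq ->. Qed.

Lemma cc_mor_eq (gT : finGroupType) (mu : ccoef gT) (S T : fingset gT)
    (f f' : gmap S T) (x : mu T) :
  f =1 f' -> cc_mor mu f x = cc_mor mu f' x.
Proof. by move/gmap_eq ->. Qed.

(* A G-space with finitely many simplices in each dimension. Evaluating a
   coefficient system on such a space only involves finite G-sets, on which
   the extension of the system to all G-sets takes its original values. *)
Record fingspace (gT : finGroupType) := FinGSpace {
  fingspace_sp :> gspace gT;
  fingspace_fin : forall n, finite_set [set: fingspace_sp n]%classic }.

Definition fin_simp (gT : finGroupType) (X : fingspace gT) n : fingset gT :=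
  FinGSet (@fingspace_fin gT X n).

Section Bredon.
Variable gT : finGroupType.

Section Homology.
Variable mu : hcoef gT.

Section Chains.
Variable X : fingspace gT.
Definition bredon_mor m n (f : mono m n) :
    {additive mu (fin_simp X n) -> mu (fin_simp X m)} :=
  @hc_mor gT mu (fin_simp X n) (fin_simp X m) (gspmor X f).
Lemma bredon_mor_id n x : bredon_mor (mono_id n) x = x.
Proof.
rewrite /bredon_mor -[RHS](@hc_id gT mu (fin_simp X n)); apply: hc_mor_eq => s.
by rewrite gspmor_id.
Qed.
Lemma bredon_mor_comp l m n (f : mono m n) (h : mono l m) x :
  bredon_mor (mono_comp f h) x = bredon_mor h (bredon_mor f x).
Proof.
rewrite /bredon_mor -hc_comp; apply: hc_mor_eq => s.
by rewrite gspmor_comp.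
Qed.
Definition bredon_szmod : szmod := SZmod bredon_mor_id bredon_mor_comp.
End Chains.

Section ChainMap.
Variables (X Y : fingspace gT) (f : gspmap X Y).
Definition bredon_fun n : {additive bredon_szmod X n -> bredon_szmod Y n} :=
  @hc_mor gT mu (fin_simp X n) (fin_simp Y n) (f n).
Lemma bredon_funP m n (h : mono m n) x :
  bredon_fun m (szmor (bredon_szmod X) h x) =
  szmor (bredon_szmod Y) h (bredon_fun n x).
Proof.
rewrite /bredon_fun /= /bredon_mor -!hc_comp; apply: hc_mor_eq => s.
by rewrite /= gspmapP.
Qed.
Definition bredon_szmap : szmap (bredon_szmod X) (bredon_szmod Y) :=
  SZMap bredon_funP.
End ChainMap.

Definition bredon_homology (X : fingspace gT) n : zmodType :=
  homology (normalized_chains (bredon_szmod X)) n.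
Definition bredon_homology_map (X Y : fingspace gT) (f : gspmap X Y) n :
    {additive bredon_homology X n -> bredon_homology Y n} :=
  homology_map (normalized_chain_map (bredon_szmap f)) n.
End Homology.

Section Cohomology.
Variable mu : ccoef gT.

Section Cochains.
Variable X : fingspace gT.
Definition bredon_comor m n (f : mono m n) :
    {additive mu (fin_simp X m) -> mu (fin_simp X n)} :=
  @cc_mor gT mu (fin_simp X n) (fin_simp X m) (gspmor X f).
Lemma bredon_comor_id n x : bredon_comor (mono_id n) x = x.
Proof.
rewrite /bredon_comor -[RHS](@cc_id gT mu (fin_simp X n)); apply: cc_mor_eq => s.
by rewrite gspmor_id.
Qed.
Lemma bredon_comor_comp l m n (f : mono m n) (h : mono l m) x :
  bredon_comor (mono_comp f h) x = bredon_comor f (bredon_comor h x).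
Proof.
rewrite /bredon_comor -cc_comp; apply: cc_mor_eq => s.
by rewrite gspmor_comp.
Qed.
Definition bredon_czmod : czmod := CZmod bredon_comor_id bredon_comor_comp.
End Cochains.

Section CochainMap.
Variables (X Y : fingspace gT) (f : gspmap X Y).
Definition bredon_cofun n : {additive bredon_czmod Y n -> bredon_czmod X n} :=
  @cc_mor gT mu (fin_simp X n) (fin_simp Y n) (f n).
Lemma bredon_cofunP m n (h : mono m n) x :
  bredon_cofun n (czmor (bredon_czmod Y) h x) =
  czmor (bredon_czmod X) h (bredon_cofun m x).
Proof.
rewrite /bredon_cofun /= /bredon_comor -!cc_comp; apply: cc_mor_eq => s.
by rewrite /= gspmapP.
Qed.
Definition bredon_czmap : czmap (bredon_czmod Y) (bredon_czmod X) :=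
  CZMap bredon_cofunP.
End CochainMap.

Definition bredon_cohomology (X : fingspace gT) n : zmodType :=
  cohomology (normalized_cochains (bredon_czmod X)) n.
Definition bredon_cohomology_map (X Y : fingspace gT) (f : gspmap X Y) n :
    {additive bredon_cohomology Y n -> bredon_cohomology X n} :=
  cohomology_map (normalized_cochain_map (bredon_czmap f)) n.
End Cohomology.
End Bredon.

Section Approximation.
Variable gT : finGroupType.
Implicit Type C : {set {group gT}}.

(* A functor from the poset [n] to the orbit category of C, whose objects are
   taken to be the orbits G/H with H in C. *)
Record orb_chain C n := OrbChain {
  oc_ob : 'I_n.+1 -> {group gT};
  oc_in : forall i, oc_ob i \in C;
  oc_mor : forall i j : 'I_n.+1, (i <= j)%N ->
    gmap (gorbit (oc_ob i)) (gorbit (oc_ob j));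
  oc_mor_id : forall (i : 'I_n.+1) (ii : (i <= i)%N) s, oc_mor ii s = s;
  oc_mor_comp : forall (i j k : 'I_n.+1) (ij : (i <= j)%N) (jk : (j <= k)%N)
    (ik : (i <= k)%N) s, oc_mor ik s = oc_mor jk (oc_mor ij s) }.

Definition orb_chain_pull C m n (f : mono m n) (c : orb_chain C n) :
    orb_chain C m :=
  @OrbChain C m (fun i => oc_ob c (f i)) (fun i => oc_in c (f i))
    (fun i j ij => oc_mor c (mono_le f ij))
    (fun i ii => oc_mor_id (mono_le f ii))
    (fun i j k ij jk ik =>
       oc_mor_comp (mono_le f ij) (mono_le f jk) (mono_le f ik)).

(* An n-simplex of the homotopy coend of S |-> S and S |-> map_G(S, X): a chain
   S_0 -> ... -> S_n of orbits, a point of S_0, and an n-simplex of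
   map_G(S_n, X), that is a G-map from the discrete G-space S_n to X_n. *)
Record hcoend_simp C (X : gspace gT) n := HCoend {
  he_chain : orb_chain C n;
  he_pt : gorbit (oc_ob he_chain ord0);
  he_map : gmap (gorbit (oc_ob he_chain ord_max)) (X n) }.
HB.instance Definition _ C X n := gen_eqMixin (hcoend_simp C X n).
HB.instance Definition _ C X n := gen_choiceMixin (hcoend_simp C X n).

Lemma hcoend_eq C (X : gspace gT) n (ob : 'I_n.+1 -> {group gT}) in1 in2
    (mor1 mor2 : forall i j : 'I_n.+1, (i <= j)%N ->
      gmap (gorbit (ob i)) (gorbit (ob j))) id1 id2 comp1 comp2
    (pt1 pt2 : gorbit (ob ord0)) (map1 map2 : gmap (gorbit (ob ord_max)) (X n)) :
    (forall (i j : 'I_n.+1) (ij : (i <= j)%N) s, mor1 i j ij s = mor2 i j ij s) ->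
    pt1 = pt2 -> map1 =1 map2 ->
  @HCoend C X n (@OrbChain C n ob in1 mor1 id1 comp1) pt1 map1 =
  @HCoend C X n (@OrbChain C n ob in2 mor2 id2 comp2) pt2 map2.
Proof.
move=> mor12 pt12 map12.
have {}mor12 : mor1 = mor2.
  apply: functional_extensionality_dep => i.
  apply: functional_extensionality_dep => j.
  by apply: functional_extensionality_dep => ij; apply: gmap_eq => s.
move/gmap_eq in map12; subst mor2 pt2 map2.
by rewrite (Prop_irrelevance in1 in2) (Prop_irrelevance id1 id2)
  (Prop_irrelevance comp1 comp2).
Qed.

Section HCoend.
Variables (C : {set {group gT}}) (X : gspace gT).

Definition hcoend_act n (u : hcoend_simp C X n) g : hcoend_simp C X n :=
  @HCoend C X n (he_chain u) (gset_act _ (he_pt u) g) (he_map u).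
Lemma hcoend_act1 n : (@hcoend_act n)^~ 1%g =1 id.
Proof. by case=> c s h; rewrite /hcoend_act /= orbit_act1. Qed.
Lemma hcoend_actM n u : act_morph (@hcoend_act n) u.
Proof. by case: u => c s h g g'; rewrite /hcoend_act /= orbit_actM. Qed.
Definition hcoend_gset n : gset gT :=
  GSet (TotalAction (@hcoend_act1 n) (@hcoend_actM n)).

Definition hcoend_pull m n (f : mono m n) (u : hcoend_gset n) : hcoend_gset m :=
  @HCoend C X m (orb_chain_pull f (he_chain u))
    (oc_mor (he_chain u) (leq0n (f ord0) : (@ord0 n <= f ord0)%N) (he_pt u))
    (gmap_comp (gspmor X f)
      (gmap_comp (he_map u)
        (oc_mor (he_chain u) (leq_ord (f ord_max) : (f ord_max <= @ord_max n)%N)))).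

Lemma hcoend_pullJ m n (f : mono m n) u g :
  hcoend_pull f (gset_act _ u g) = gset_act _ (hcoend_pull f u) g.
Proof.
case: u => c s h; rewrite /hcoend_pull /= /hcoend_act /=.
by rewrite [oc_mor _ _ _](gmapJ (oc_mor c _)).
Qed.
Definition hcoend_mor m n (f : mono m n) := GMap (hcoend_pullJ f).

Lemma hcoend_mor_id n u : hcoend_mor (mono_id n) u = u.
Proof.
case: u => [[ob obC mor mor_id mor_comp] s h].
rewrite /= /hcoend_pull /=; apply: hcoend_eq => /= [i j ij t||t].
- by congr (mor _ _ _ _); exact: bool_irrelevance.
- by rewrite mor_id.
- by rewrite mor_id gspmor_id.
Qed.

Lemma hcoend_mor_comp l m n (f : mono m n) (k : mono l m) u :
  hcoend_mor (mono_comp f k) u = hcoend_mor k (hcoend_mor f u).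
Proof.
case: u => [[ob obC mor mor_id mor_comp] s h].
rewrite /= /hcoend_pull /=; apply: hcoend_eq => /= [i j ij t||t].
- by congr (mor _ _ _ _); exact: bool_irrelevance.
- exact: mor_comp.
- rewrite gspmor_comp /=; do 2 congr (gspmor _ _ _); congr (h _); exact: mor_comp.
Qed.

Definition approx : gspace gT := GSpace hcoend_mor_id hcoend_mor_comp.
End HCoend.

Section ApproxIncl.
Variables (C' C : {set {group gT}}) (sC : C' \subset C) (X : gspace gT).

Definition orb_chain_incl n (c : orb_chain C' n) : orb_chain C n :=
  OrbChain (fun i => fintype.subsetP sC _ (oc_in c i)) (@oc_mor_id _ _ c)
    (@oc_mor_comp _ _ c).
Definition approx_incl_fun n (u : approx C' X n) : approx C X n :=
  @HCoend C X n (orb_chain_incl (he_chain u)) (he_pt u) (he_map u).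
Definition approx_incl_gmap n : gmap (approx C' X n) (approx C X n) :=
  @GMap gT (approx C' X n) (approx C X n) (@approx_incl_fun n)
    (fun _ _ => erefl).
Lemma approx_inclP m n (f : mono m n) u :
  approx_incl_gmap m (gspmor (approx C' X) f u) =
  gspmor (approx C X) f (approx_incl_gmap n u).
Proof. by case: u => [[ob obC mor mor_id mor_comp] s h]; apply: hcoend_eq. Qed.

Definition approx_incl : gspmap (approx C' X) (approx C X) :=
  GSpMap approx_inclP.
End ApproxIncl.

Section Finiteness.
Variable C : {set {group gT}}.

Definition hcoend_code n (u : approx C (gpoint gT) n) :
  {ffun 'I_n.+1 -> {group gT}} * {set gT} *
  {ffun {q : 'I_n.+1 * 'I_n.+1 | (q.1 <= q.2)%N} -> {ffun {set gT} -> {set gT}}} :=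
  let c := he_chain u in
  ([ffun i => oc_ob c i], val (he_pt u),
   [ffun q => [ffun S : {set gT} =>
     if insub S : option (gorbit (oc_ob c (sval q).1)) is Some s
     then val (oc_mor c (proj2_sig q) s) else finset.set0]]).

Lemma hcoend_code_inj n : injective (@hcoend_code n).
Proof.
move=> [[ob1 in1 mor1 id1 comp1] s1 h1] [[ob2 in2 mor2 id2 comp2] s2 h2].
rewrite /hcoend_code /= => -[/ffunP ob12 s12 /ffunP mor12].
have {}ob12 : ob1 = ob2 by apply: funext => i; have := ob12 i; rewrite !ffunE.
subst ob2; apply: hcoend_eq; last by move=> t; case: (h1 t); case: (h2 t).
  move=> i j ij s; have := mor12 (exist _ (i, j) ij).
  rewrite !ffunE => /ffunP /(_ (val s)); rewrite !ffunE /= valK.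
  by move=> H; apply: val_inj; exact: H.
exact: val_inj.
Qed.

Lemma approx_point_fin n : finite_set [set: approx C (gpoint gT) n]%classic.
Proof.
have -> : [set: approx C (gpoint gT) n]%classic =
    ((@hcoend_code n) @^-1` [set: _])%classic by [].
apply: finite_preimage => //; first by move=> u v _ _; apply: hcoend_code_inj.
Qed.

Definition approx_point : fingspace gT := FinGSpace approx_point_fin.
End Finiteness.

Definition approx_point_incl C' C (sC : C' \subset C) :
  gspmap (approx_point C') (approx_point C) := approx_incl sC (gpoint gT).

Definition is_collection C : Prop :=
  forall (H : {group gT}) g, H \in C -> (H :^ g)%G \in C.

Definition conj_subgroups (D : {group gT}) : {set {group gT}} :=
  [set (D :^ g)%G | g in [set: gT]].

End Approximation.

Record wmod (W : finGroupType) := WMod {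
  wmod_car :> zmodType;
  wact : W -> {additive wmod_car -> wmod_car};
  wact1 : forall a, wact 1%g a = a;
  wactM : forall v w a, wact (v * w)%g a = wact v (wact w a) }.

Section FinitelySupported.
Variables (A : zmodType) (S : choiceType).

Definition finsupp_pred : {pred (S -> A)} :=
  [pred u | `[< finite_set [set s | u s != 0]%classic >]].
Lemma finsupp_zmod : zmod_closed finsupp_pred.
Proof.
split=> [|u v].
  apply/asboolP; apply: (@sub_finite_set _ _ set0) => // s /=.
  by rewrite eqxx.
move=> /asboolP fu /asboolP fv; apply/asboolP.
apply: (@sub_finite_set _ _
  ([set s | u s != 0] `|` [set s | v s != 0])%classic); last first.
  by rewrite finite_setU.
move=> s /=; rewrite -[_ s]/(u s - v s) => uvs.
case: (eqVneq (u s) 0) => [us|]; last by left.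
by right; apply: contra_neq uvs => vs; rewrite us vs subrr.
Qed.
HB.instance Definition _ :=
  GRing.isZmodClosed.Build (S -> A) finsupp_pred finsupp_zmod.

(* The group A[S] of formal sums of elements of S with coefficients in A. *)
Definition formal_sum : zmodType := subz finsupp_pred.

Lemma formal1_subproof (a : A) (s : S) :
  (fun t => if t == s then a else 0) \in finsupp_pred.
Proof.
apply/asboolP; apply: (@sub_finite_set _ _ [set s]%classic) => // t /=.
by case: (eqVneq t s) => // _; rewrite eqxx.
Qed.
Definition formal1 (a : A) (s : S) : formal_sum := SubZ (formal1_subproof a s).
End FinitelySupported.

Lemma formal_supp (A : zmodType) (S : choiceType) (u : formal_sum A S) :
  exists2 r : seq S, uniq r & forall s, val u s != 0 -> s \in r.
Proof.
have /asboolP /finite_seqP[r rE] := valP u.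
exists (undup r) => [|s us]; first exact: undup_uniq.
by rewrite mem_undup; have : [set` r]%classic s by rewrite -rE.
Qed.

Section Push.
Variables (A : zmodType) (S T : choiceType) (f : S -> T).

Definition push_fun (u : formal_sum A S) : T -> A :=
  fun t => \sum_(s \in (f @^-1` [set t])%classic) val u s.

Lemma push_funE (u : formal_sum A S) (r : seq S) t :
    uniq r -> (forall s, val u s != 0 -> s \in r) ->
  push_fun u t = \sum_(s <- r | f s == t) val u s.
Proof.
move=> r_uniq ur; rewrite (bigfs _ r_uniq) => [|s _]; last first.
  by apply: contraNeq => /ur.
by apply: eq_fsbigl; apply/seteqP; split=> s /= /eqP.
Qed.

Lemma push_subproof (u : formal_sum A S) : push_fun u \in @finsupp_pred A T.
Proof.
have [r r_uniq ur] := formal_supp u; apply/asboolP.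
apply: (sub_finite_set _ (finite_seq (map f r))) => t /=.
rewrite (push_funE _ r_uniq ur); apply: contra_neqT => tr.
rewrite big_seq_cond big1 // => s /andP[sr /eqP fs].
by rewrite -fs map_f in tr.
Qed.
Definition push (u : formal_sum A S) : formal_sum A T := SubZ (push_subproof u).

Lemma push_additive : zmod_morphism push.
Proof.
move=> u v; apply: val_inj; apply: funext => t.
have [r r_uniq ur] := formal_supp u; have [r' _ vr] := formal_supp v.
have rr' : uniq (undup (r ++ r')) by exact: undup_uniq.
rewrite /= -[RHS]/(push_fun u t - push_fun v t).
rewrite !(push_funE _ rr'); last 3 first.
- by move=> s /vr; rewrite mem_undup mem_cat orbC => ->.
- by move=> s /ur; rewrite mem_undup mem_cat => ->.
- move=> s; rewrite mem_undup mem_cat -[val _ s]/(val u s - val v s).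
  by case: (eqVneq (val u s) 0) => [->|/ur -> //]; rewrite sub0r oppr_eq0 => /vr ->; rewrite orbT.
by rewrite -sumrB.
Qed.
HB.instance Definition _ :=
  GRing.isZmodMorphism.Build (formal_sum A S) (formal_sum A T) push push_additive.

Lemma push_formal1 a s : push (formal1 a s) = formal1 a (f s).
Proof.
apply: val_inj; apply: funext => t; rewrite /= (@push_funE _ [:: s]) //=.
  by rewrite big_mkcond big_seq1 eqxx eq_sym.
by move=> s'; rewrite inE; case: (eqVneq s' s) => // _; rewrite eqxx.
Qed.
End Push.

Lemma push_id (A : zmodType) (S : choiceType) (u : formal_sum A S) :
  push id u = u.
Proof.
apply: val_inj; apply: funext => t /=; have [r r_uniq ur] := formal_supp u.
rewrite (push_funE _ _ r_uniq ur) big_mkcond /=.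
have [tr|tr] := boolP (t \in r).
  rewrite (bigD1_seq t) //= eqxx big1 ?addr0 // => s.
  by case: (eqVneq s t).
rewrite big_seq big1 => [|s sr]; first by apply/esym/eqP; apply: contraNT tr => /ur.
by case: eqVneq => // st; rewrite -st sr in tr.
Qed.

Lemma push_comp (A : zmodType) (R S T : choiceType) (f : S -> T) (h : R -> S)
    (u : formal_sum A R) :
  push (f \o h) u = push f (push h u).
Proof.
apply: val_inj; apply: funext => t /=; have [r r_uniq ur] := formal_supp u.
rewrite (push_funE _ _ r_uniq ur).
have hr_uniq : uniq (undup (map h r)) by exact: undup_uniq.
rewrite (push_funE _ _ hr_uniq); last first.
  move=> s /=; rewrite (push_funE _ _ r_uniq ur) mem_undup.
  apply: contra_neqT => sr; rewrite big_seq_cond big1 // => x /andP[xr /eqP hx].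
  by rewrite -hx map_f in sr.
under [RHS]eq_bigr do rewrite /= (push_funE _ _ r_uniq ur).
rewrite (exchange_big_dep (fun x => f (h x) == t)) /=; last first.
  by move=> s x /eqP <- /eqP ->.
rewrite big_seq_cond [RHS]big_seq_cond; apply: eq_bigr => x /andP[xr /eqP fhx].
rewrite big_mkcond (bigD1_seq (h x)) //=; last by rewrite mem_undup map_f.
rewrite fhx !eqxx big1 ?addr0 // => s sx.
by rewrite [h x == s]eq_sym (negPf sx) andbF.
Qed.

Section Tensor.
Variables (W : finGroupType) (A : wmod W).

(* For a right W-set S, the abelian group Z[S] tensored with A over Z[W]. *)
Definition balanced (S : gset W) (u : formal_sum A S) : Prop :=
  exists (a : A) (s : S) (w : W),
    u = formal1 a (gset_act S s w) - formal1 (wact A w a) s.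

Definition tensor (S : gset W) : zmodType :=
  {ideal_quot (zspan (@balanced S))}.

Lemma push_balanced (S T : gset W) (f : gmap S T) u :
  u \in zspan (@balanced S) -> push f u \in zspan (@balanced T).
Proof.
apply: zspan_map u => u [a [s [w ->]]]; apply: mem_zspan.
by exists a, (f s), w; rewrite raddfB /= !push_formal1 gmapJ.
Qed.

Definition tensor_map (S T : gset W) (f : gmap S T) :
  {additive tensor S -> tensor T} := quot_map (push f) (push_balanced f).

(* The equivariant functions on a right W-set S, that is the W-linear maps
   from Z[S] to A. *)
Definition equivariant (S : gset W) : {pred (S -> A)} :=
  [pred u | `[< forall s w, u (gset_act S s w) = wact A w^-1%g (u s) >]].
Lemma equivariant_zmod (S : gset W) : zmod_closed (@equivariant S).
Proof.
split=> [|u v /asboolP Hu /asboolP Hv]; apply/asboolP => s w.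
  by rewrite raddf0.
by rewrite -[LHS]/(u _ - v _) Hu Hv -raddfB.
Qed.
HB.instance Definition _ (S : gset W) :=
  GRing.isZmodClosed.Build (S -> A) (@equivariant S) (equivariant_zmod S).

Definition hom (S : gset W) : zmodType := subz (@equivariant S).

Section Pull.
Variables (S T : gset W) (f : gmap S T).

Definition pull (u : T -> A) : S -> A := u \o f.
Lemma pull_additive : zmod_morphism pull. Proof. by []. Qed.
HB.instance Definition _ :=
  GRing.isZmodMorphism.Build (T -> A) (S -> A) pull pull_additive.

Lemma pull_equivariant u : u \in @equivariant T -> pull u \in @equivariant S.
Proof.
by move=> /asboolP Hu; apply/asboolP => s w; rewrite /pull /= gmapJ Hu.
Qed.

Definition hom_map : {additive hom T -> hom S} := subz_map pull pull_equivariant.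
End Pull.

(* When W acts freely on E, this is the homology (resp. cohomology) of the
   quotient E/W, with twisted coefficients in A along the covering E -> E/W. *)
Section Twisted.
Variable E : gspace W.

Lemma tensor_id n x : tensor_map (gspmor E (mono_id n)) x = x.
Proof.
elim/quotW: x => x; rewrite /= quot_map_pi /=; congr (\pi _)%qT.
by rewrite -[RHS]push_id; congr (push _ _); apply: funext => e; rewrite /= gspmor_id.
Qed.
Lemma tensor_comp l m n (f : mono m n) (h : mono l m) x :
  tensor_map (gspmor E (mono_comp f h)) x =
  tensor_map (gspmor E h) (tensor_map (gspmor E f) x).
Proof.
elim/quotW: x => x; rewrite /= !(quot_map_pi _ x) quot_map_pi /= -push_comp.
congr (\pi _)%qT; congr (push _ _).
by apply: funext => e; rewrite /= gspmor_comp.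
Qed.
Definition twisted_szmod : szmod := @SZmod (fun n => tensor (E n))
  (fun m n f => tensor_map (gspmor E f)) tensor_id tensor_comp.

Lemma hom_id n x : hom_map (gspmor E (mono_id n)) x = x.
Proof.
by apply: val_inj; apply: funext => e; rewrite /= /pull /= gspmor_id.
Qed.
Lemma hom_comp l m n (f : mono m n) (h : mono l m) x :
  hom_map (gspmor E (mono_comp f h)) x =
  hom_map (gspmor E f) (hom_map (gspmor E h) x).
Proof.
by apply: val_inj; apply: funext => e; rewrite /= /pull /= gspmor_comp.
Qed.
Definition twisted_czmod : czmod := @CZmod (fun n => hom (E n))
  (fun m n f => hom_map (gspmor E f)) hom_id hom_comp.

Definition twisted_homology n := homology (normalized_chains twisted_szmod) n.
Definition twisted_cohomology n :=
  cohomology (normalized_cochains twisted_czmod) n.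
End Twisted.

Section TwistedMap.
Variables (E F : gspace W) (f : gspmap E F).

Lemma twisted_szmapP m n (h : mono m n) x :
  tensor_map (f m) (szmor (twisted_szmod E) h x) =
  szmor (twisted_szmod F) h (tensor_map (f n) x).
Proof.
elim/quotW: x => x; rewrite /= !(quot_map_pi _ x) !quot_map_pi /= -!push_comp.
congr (\pi _)%qT; congr (push _ _).
by apply: funext => e; rewrite /= gspmapP.
Qed.
Definition twisted_szmap : szmap (twisted_szmod E) (twisted_szmod F) :=
  @SZMap (twisted_szmod E) (twisted_szmod F) (fun n => tensor_map (f n))
    twisted_szmapP.
Definition twisted_homology_map n :
    {additive twisted_homology E n -> twisted_homology F n} :=
  homology_map (normalized_chain_map twisted_szmap) n.

Lemma twisted_czmapP m n (h : mono m n) x :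
  hom_map (f n) (czmor (twisted_czmod F) h x) =
  czmor (twisted_czmod E) h (hom_map (f m) x).
Proof.
by apply: val_inj; apply: funext => e; rewrite /= /pull /= gspmapP.
Qed.
Definition twisted_czmap : czmap (twisted_czmod F) (twisted_czmod E) :=
  @CZMap (twisted_czmod F) (twisted_czmod E) (fun n => hom_map (f n))
    twisted_czmapP.
Definition twisted_cohomology_map n :
    {additive twisted_cohomology F n -> twisted_cohomology E n} :=
  cohomology_map (normalized_cochain_map twisted_czmap) n.
End TwistedMap.
End Tensor.

Section Ampleness.
Variables (p : nat) (W : finGroupType).

Definition psubgroup := {P : {group W} | (p.-group P)%g && (P != 1%G)}.

Lemma psubgroup_conj_subproof (P : psubgroup) w :
  (p.-group (val P :^ w))%g && ((val P :^ w)%G != 1%G).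
Proof.
have /andP[pP] := valP P; rewrite pgroupJ {}pP /=; apply: contraNneq.
by move=> /(congr1 val) /= /eqP; rewrite conjsg_eq1 => /eqP P1; apply/eqP/val_inj.
Qed.
Definition psubgroup_conj (P : psubgroup) w : psubgroup :=
  exist _ (val P :^ w)%G (psubgroup_conj_subproof P w).

(* The n-simplices of the nerve of the poset of non-identity p-subgroups. *)
Record psub_chain n := PsubChain {
  pc_fun :> 'I_n.+1 -> psubgroup;
  pc_le : forall i j : 'I_n.+1, (i <= j)%N -> val (pc_fun i) \subset val (pc_fun j) }.
HB.instance Definition _ n := gen_eqMixin (psub_chain n).
HB.instance Definition _ n := gen_choiceMixin (psub_chain n).

Lemma psub_chain_eq n (c d : psub_chain n) : c =1 d -> c = d.
Proof.
case: c d => [c Hc] [d Hd] /= /funext cd; rewrite -{}cd in Hd *.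
by congr PsubChain; exact: Prop_irrelevance.
Qed.

Lemma psub_act_subproof n (c : psub_chain n) w (i j : 'I_n.+1) : (i <= j)%N ->
  val (psubgroup_conj (c i) w) \subset val (psubgroup_conj (c j) w).
Proof. by move=> ij; rewrite /= conjSg; apply: pc_le. Qed.
Definition psub_act n (c : psub_chain n) w : psub_chain n :=
  PsubChain (@psub_act_subproof n c w).
Lemma psub_act1 n : (@psub_act n)^~ 1%g =1 id.
Proof.
move=> c; apply: psub_chain_eq => i; apply: val_inj; apply: val_inj.
by rewrite /= conjsg1.
Qed.
Lemma psub_actM n (c : psub_chain n) : act_morph (@psub_act n) c.
Proof.
move=> v w; apply: psub_chain_eq => i; apply: val_inj; apply: val_inj.
by rewrite /= conjsgM.
Qed.
Definition psub_gset n : gset W :=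
  GSet (TotalAction (@psub_act1 n) (@psub_actM n)).

Definition psub_pull m n (f : mono m n) (c : psub_gset n) : psub_gset m :=
  @PsubChain m (fun i => c (f i)) (fun i j ij => pc_le c (mono_le f ij)).
Lemma psub_pullJ m n (f : mono m n) c w :
  psub_pull f (gset_act (psub_gset n) c w) = gset_act (psub_gset m) (psub_pull f c) w.
Proof. exact: psub_chain_eq. Qed.
Lemma psub_id n c : GMap (psub_pullJ (mono_id n)) c = c.
Proof. exact: psub_chain_eq. Qed.
Lemma psub_comp l m n (f : mono m n) (h : mono l m) c :
  GMap (psub_pullJ (mono_comp f h)) c =
  GMap (psub_pullJ h) (GMap (psub_pullJ f) c).
Proof. exact: psub_chain_eq. Qed.

Definition psub_nerve : gspace W := GSpace psub_id psub_comp.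

(* The map EW x |S_p(W)| -> EW x *, whose quotient by W is the map of Borel
   constructions. *)
Definition borel_map :
    gspmap (spprod (EG W) psub_nerve) (spprod (EG W) (gpoint W)) :=
  spprod_map (EG W) (to_gpoint psub_nerve).

Definition homologically_ample (A : wmod W) : Prop :=
  forall n, bijective (twisted_homology_map A borel_map n).

Definition cohomologically_ample (A : wmod W) : Prop :=
  forall n, bijective (twisted_cohomology_map A borel_map n).
End Ampleness.

Section WeylModules.
Variables (gT : finGroupType) (D : {group gT}).

Lemma fin_orbit_subproof : finite_set [set: gorbit D]%classic.
Proof. exact: finite_finset. Qed.
Definition fin_orbit : fingset gT := FinGSet fin_orbit_subproof.

Section Covariant.
Variable mu : hcoef gT.
Definition hweyl_act (w : coset_of D) : {additive mu fin_orbit -> mu fin_orbit} :=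
  @hc_mor gT mu fin_orbit fin_orbit (weyl_map w).
Lemma hweyl_act1 x : hweyl_act 1%g x = x.
Proof. by rewrite /hweyl_act weyl_map1 (@hc_id gT mu fin_orbit). Qed.
Lemma hweyl_actM v w x : hweyl_act (v * w)%g x = hweyl_act v (hweyl_act w x).
Proof.
rewrite /hweyl_act weyl_mapM.
exact: (@hc_comp gT mu fin_orbit fin_orbit fin_orbit).
Qed.
Definition hweyl : wmod (coset_of D) := WMod hweyl_act1 hweyl_actM.
End Covariant.

(* Contravariance turns the left action of W_G(D) on G/D into a right action
   on mu(G/D), which is made into a left one by inversion. *)
Section Contravariant.
Variable mu : ccoef gT.
Definition cweyl_act (w : coset_of D) : {additive mu fin_orbit -> mu fin_orbit} :=
  @cc_mor gT mu fin_orbit fin_orbit (weyl_map w^-1%g).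
Lemma cweyl_act1 x : cweyl_act 1%g x = x.
Proof. by rewrite /cweyl_act invg1 weyl_map1 (@cc_id gT mu fin_orbit). Qed.
Lemma cweyl_actM v w x : cweyl_act (v * w)%g x = cweyl_act v (cweyl_act w x).
Proof.
rewrite /cweyl_act invMg weyl_mapM.
exact: (@cc_comp gT mu fin_orbit fin_orbit fin_orbit).
Qed.
Definition cweyl : wmod (coset_of D) := WMod cweyl_act1 cweyl_actM.
End Contravariant.
End WeylModules.

(* Main.v *)
Require Import Defs.
From HB Require Import structures.
From mathcomp Require Import all_boot all_order all_algebra all_fingroup.
From mathcomp Require Import pgroup nilpotent sylow generic_quotient ring_quotient.
From mathcomp Require Import boolp classical_sets functions cardinality.
From mathcomp Require Import zify.

Set Implicit Arguments.
Unset Strict Implicit.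
Unset Printing Implicit Defensive.

Import GRing.Theory.
Local Open Scope ring_scope.

(** The approximation of a point by a collection is the nerve of a preorder: its
    vertices are the cosets Hg with H in the collection, ordered by inclusion of
    stabilizers.  Write X for this nerve when the collection is C, and X' when
    the conjugates of D are removed.  By minimality of D, a simplex of X outside
    X' begins with a coset of a conjugate of D, so its stabilizer is conjugate to
    D; those with stabilizer D form a free set under the Weyl group.  Beyond such
    a vertex lie the p-subgroups P strictly containing D.  Since p-groups grow
    inside their normalizers, P may be replaced by N_P(D), still strictly larger
    than D, and one arrives at the poset S_p of non-identity p-subgroups of the
    Weyl group.  This replacement has an equivariant inverse only after the
    action has been made free, which is the reason why Borel constructions, and
    not just the nerve of S_p, appear.

    The argument takes place in one larger preorder of pairs (S, P) with S a
    right coset and P a subgroup, made of three parts: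
    - X', where S is a coset of a group of C not conjugate to D, and P is the
      stabilizer of S;
    - W, where S = Dg and P = D^g;
    - M, where S = Dg and P is a p-group with D^g < P <= N(D^g).
    Write E for the total space of the universal bundle of the Weyl group.  The
    nerve of W is induced from E, the nerve of M is induced from E x |S_p|, and
    forgetting P induces the map of Borel constructions.  Calling two maps linked
    if one induces isomorphisms exactly when the other one does, the following
    are linked:
    [[
      X' -> X,   X' -> W + X',   X' -> M + W + X',   M + X' -> M + W + X',
      M + X' -> nerve(M + X') u nerve(M + W),   M -> M + W,   M -> W.
    ]]
    The step from the fifth to the sixth map is excision [square_excision,
    square_coexcision].  The others compose with an inclusion of nerves which is
    an equivalence for every coefficient system or, for the last one, with a
    retraction of such an inclusion.

    Those inclusions are treated uniformly by [insertion_contractible].  Into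
    each simplex outside the subspace one more vertex is inserted; on cochains
    this is a contracting homotopy up to terms in which a pivotal vertex has
    disappeared, and counting pivotal vertices makes the error nilpotent.  In
    the decisive case [contract_union], a simplex which contains both a vertex
    Dg of W and a vertex of X' with stabilizer P receives (Dg, N_P(D^g)).

    Only cohomology requires these computations.  For a homological system mu
    and an abelian group B, Hom(mu, B) is a cohomological system, and taking for
    B the quotient that measures the failure of a homological statement reduces
    it to the cohomological one [contractible_rel_acyclic, square_excision,
    tensor_weyl].  Finally, on a space induced from a W-space, mu computes
    homology (resp. cohomology) twisted by mu(G/D) [twisted_homology_compare,
    twisted_cohomology_compare]. *)

(** * Homological algebra *)

Lemma bij_of_inj_surj (S T : Type) (f : S -> T) :
  injective f -> (forall t, exists s, f s = t) -> bijective f.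
Proof.
move=> f_inj /choice [g gK]; exists g => [s|t]; last exact: gK.
by apply: f_inj; rewrite gK.
Qed.

Lemma bij_inj_surj (S T : Type) (f : S -> T) :
  bijective f -> injective f /\ (forall t, exists s, f s = t).
Proof.
by case=> g fK gK; split=> [|t]; [exact: can_inj fK | exists (g t)].
Qed.

Lemma quot_eqP (V : zmodType) (S : zmodClosed V) (x y : V) :
  (\pi_({ideal_quot S}) x = \pi_({ideal_quot S}) y)%qT <-> x - y \in S.
Proof.
by rewrite Quotient.idealrBE; split=> [->|/eqP].
Qed.

Lemma quot_eq0 (V : zmodType) (S : zmodClosed V) (x : V) :
  (\pi_({ideal_quot S}) x = 0)%qT <-> x \in S.
Proof. by rewrite -[X in _ = X](raddf0 (\pi_({ideal_quot S}))%qT) quot_eqP subr0. Qed.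

Section HgroupMap.
Variables (U V W U' V' W' : zmodType).
Variables (f : {additive U -> V}) (g : {additive V -> W}).
Variables (f' : {additive U' -> V'}) (g' : {additive V' -> W'}).
Variables (a : {additive U -> U'}) (b : {additive V -> V'}).
Variables (c : {additive W -> W'}).
Hypotheses (abf : forall x, b (f x) = f' (a x)).
Hypotheses (bcg : forall x, c (g x) = g' (b x)).

Let H := hgroup_map abf bcg.

Definition hclass (U0 V0 W0 : zmodType) (f0 : {additive U0 -> V0})
    (g0 : {additive V0 -> W0}) v (gv : g0 v = 0) : hgroup f0 g0 :=
  (\pi_(hgroup f0 g0) (SubZ (S := kerp g0) (introT eqP gv)))%qT.

Lemma hclassP (U0 V0 W0 : zmodType) (f0 : {additive U0 -> V0})
    (g0 : {additive V0 -> W0}) (h : hgroup f0 g0) :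
  exists v (gv : g0 v = 0), h = hclass f0 gv.
Proof.
elim/quotW: h => -[v gv]; exists v, (elimT eqP gv).
by rewrite /hclass; congr (\pi _)%qT; apply: val_inj.
Qed.

Lemma hclass_eq (U0 V0 W0 : zmodType) (f0 : {additive U0 -> V0})
    (g0 : {additive V0 -> W0}) v1 v2 (gv1 : g0 v1 = 0) (gv2 : g0 v2 = 0) :
  hclass f0 gv1 = hclass f0 gv2 <-> exists u, v1 - v2 = f0 u.
Proof. by rewrite /hclass quot_eqP; split=> /asboolP. Qed.

Lemma hclass_map_subproof v : g v = 0 -> g' (b v) = 0.
Proof. by move=> gv; rewrite -bcg gv raddf0. Qed.

Lemma hclass_map v (gv : g v = 0) :
  H (hclass f gv) = hclass f' (hclass_map_subproof gv).
Proof.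
rewrite /H /hgroup_map /hclass /= quot_map_pi; congr (\pi _)%qT.
exact: val_inj.
Qed.

(** Elementwise form of bijectivity on homology at one spot, used for chains and
    for cochains alike. *)
Lemma hgroup_map_bij : bijective H <->
  (forall v u', g v = 0 -> b v = f' u' -> exists u, v = f u) /\
  (forall v', g' v' = 0 -> exists v u', g v = 0 /\ v' = b v + f' u').
Proof.
split=> [/bij_inj_surj [H_inj H_surj]|[E1 E2]].
  split=> [v u' gv bv|v' gv'].
    have g0 : g 0 = 0 by rewrite raddf0.
    have [|u] := (hclass_eq f gv g0).1; last by rewrite subr0; exists u.
    apply: H_inj; rewrite !hclass_map; apply/hclass_eq; exists u'.
    by rewrite raddf0 subr0.
  have [h] := H_surj (hclass f' gv'); have [v [gv ->]] := hclassP h.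
  rewrite hclass_map => /esym/hclass_eq[u' E]; exists v, u'; split=> //.
  by rewrite -E addrC subrK.
apply: bij_of_inj_surj => [h1 h2|h].
  have [v1 [gv1 ->]] := hclassP h1; have [v2 [gv2 ->]] := hclassP h2.
  rewrite !hclass_map => /hclass_eq[u' E]; apply/hclass_eq.
  by apply: (E1 _ u'); rewrite raddfB ?gv1 ?gv2 ?subrr.
have [v' [gv' ->]] := hclassP h; have [v [u' [gv E]]] := E2 _ gv'.
exists (hclass f gv); rewrite hclass_map; apply/hclass_eq; exists (- u').
by rewrite E opprD addNKr raddfN.
Qed.
End HgroupMap.

Lemma homology_map_comp (C1 C2 C3 : chain_complex) (f : chain_map C1 C2)
    (g : chain_map C2 C3) (h : chain_map C1 C3) :
  (forall n x, h n x = g n (f n x)) ->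
  forall n x, homology_map h n x = homology_map g n (homology_map f n x).
Proof.
move=> hE n x; have [v [gv ->]] := hclassP x; rewrite /homology_map !hclass_map.
by apply/hclass_eq; exists 0; rewrite raddf0 hE subrr.
Qed.

Lemma cohomology_map_comp (C1 C2 C3 : cochain_complex) (f : cochain_map C1 C2)
    (g : cochain_map C2 C3) (h : cochain_map C1 C3) :
  (forall n x, h n x = g n (f n x)) ->
  forall n x, cohomology_map h n x = cohomology_map g n (cohomology_map f n x).
Proof.
move=> hE n x; have [v [gv ->]] := hclassP x; rewrite /cohomology_map !hclass_map.
by apply/hclass_eq; exists 0; rewrite raddf0 hE subrr.
Qed.

Definition qiso (C C' : chain_complex) (f : chain_map C C') :=
  forall n, bijective (homology_map f n).
Definition coqiso (C C' : cochain_complex) (f : cochain_map C C') :=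
  forall n, bijective (cohomology_map f n).

(** For an injective chain map f : C -> C', acyclicity of the quotient C'/C,
    phrased without forming the quotient; dually, acyclicity of the kernel of a
    surjective cochain map. *)
Definition rel_acyclic (C C' : chain_complex) (f : chain_map C C') :=
  forall n (x : C' n) (z : C n.-1), bd_from C' n x = f n.-1 z ->
  exists (y : C' n.+1) (w : C n), x = bd C' n y + f n w.
Definition rel_coacyclic (C C' : cochain_complex) (f : cochain_map C C') :=
  forall n (x : C n), cobd C n x = 0 -> f n x = 0 ->
  exists y : C n.-1, f n.-1 y = 0 /\ x = cobd_into C n y.

Lemma bd_from_bd (C : chain_complex) n x : bd_from C n (bd C n x) = 0.
Proof. by case: n x => [|n] x //; exact: bd_bd. Qed.
Lemma cobd_cobd_into (C : cochain_complex) n x : cobd C n (cobd_into C n x) = 0.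
Proof. by case: n x => [|n] x; [rewrite /= /zmap raddf0 | exact: cobd_cobd]. Qed.

(** The long exact sequence of the quotient, by a direct diagram chase. *)
Lemma qiso_inj (C C' : chain_complex) (f : chain_map C C') :
  (forall n, injective (f n)) -> (qiso f <-> rel_acyclic f).
Proof.
move=> f_inj; split=> [fq n x z xz|fa n].
  have bz : bd_from C n.-1 z = 0.
    apply: (f_inj n.-1.-1); rewrite bd_fromP -xz raddf0.
    by case: (n) x {xz} => [|n'] x //=; exact: bd_from_bd.
  have [w zw] : exists w : C n, z = bd_from C n w.
    case: n x z xz bz => [|n'] x z xz bz /=.
      by exists z; apply: (f_inj 0%N); rewrite -xz raddf0.
    have [E1 _] := (hgroup_map_bij _ _).1 (fq n').
    by have [u ->] := E1 z x bz (esym xz); exists u.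
  have bx : bd_from C' n (x - f n w) = 0.
    by rewrite raddfB xz zw -bd_fromP subrr.
  have [_ E2] := (hgroup_map_bij _ _).1 (fq n).
  have [v [y [_ E]]] := E2 _ bx; exists y, (v + w).
  by rewrite raddfD addrA [bd _ _ _ + _]addrC -E subrK.
apply/hgroup_map_bij; split=> [v u' gv E|v' gv'].
  have [y [w E']] := fa n.+1 u' v (esym E); exists w.
  by apply: (f_inj n); rewrite E E' raddfD bd_bd add0r -chain_funP.
have [|y [w E]] := fa n v' 0; first by rewrite gv' raddf0.
exists w, y; split; last by rewrite addrC.
apply: (f_inj n.-1); rewrite bd_fromP raddf0.
have := congr1 (bd_from C' n) E.
by rewrite raddfD bd_from_bd add0r gv' => <-.
Qed.

Lemma coqiso_surj (C C' : cochain_complex) (f : cochain_map C C') :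
  (forall n y, exists x, f n x = y) -> (coqiso f <-> rel_coacyclic f).
Proof.
move=> f_surj; split=> [fq n x dx fx|fa n].
  have [E1 _] := (hgroup_map_bij _ _).1 (fq n).
  have [|b E] := E1 x 0 dx; first by rewrite fx raddf0.
  case: n x dx fx b E {E1} => [|n] x dx fx b E.
    by exists 0; rewrite raddf0 E /= /zmap.
  have fb : cobd C' n (f n b) = 0 by rewrite -cochain_funP -fx E.
  have [_ E2] := (hgroup_map_bij _ _).1 (fq n).
  have [v [u' [dv E']]] := E2 _ fb.
  have [w fw] := f_surj n.-1 u'; exists (b - v - cobd_into C n w) => /=; split.
    by rewrite !raddfB /= cobd_intoP fw E' addrAC addrK subrr.
  by rewrite !raddfB /= dv cobd_cobd_into !subr0 E.
apply/hgroup_map_bij; split=> [v u' dv E|v' dv'].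
  have [w fw] := f_surj n.-1 u'.
  have [| |y [_ E']] := fa n (v - cobd_into C n w).
  - by rewrite raddfB dv cobd_cobd_into subrr.
  - by rewrite raddfB cobd_intoP fw E subrr.
  by exists (y + w); rewrite raddfD -E' subrK.
have [c fc] := f_surj n v'.
have [| |y [fy E]] := fa n.+1 (cobd C n c).
- exact: cobd_cobd.
- by rewrite cochain_funP fc dv'.
exists (c - y), 0; rewrite raddf0 addr0 !raddfB fc fy subr0; split=> //.
by rewrite E subrr.
Qed.

(** In a square of injections in which L is generated by the images of K and L',
    and these meet only in K', the quotients K/K' and L/L' agree. *)
Section Excision.
Variables (K' K L' L : chain_complex).
Variables (i : chain_map K' K) (j : chain_map L' L).
Variables (a : chain_map K L) (a' : chain_map K' L').
Hypotheses (ai : forall n x, a n (i n x) = j n (a' n x)).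
Hypothesis cover : forall n (l : L n), exists k l', l = a n k + j n l'.
Hypothesis meet : forall n (k : K n) l', a n k = j n l' -> exists k', k = i n k'.

Lemma excision : rel_acyclic i <-> rel_acyclic j.
Proof.
split=> acyc n.
  move=> l z lz; have [k [l' E]] := cover l.
  have [|k' kk'] := @meet n.-1 (bd_from K n k) (z - bd_from L' n l').
    by rewrite bd_fromP raddfB -lz bd_fromP E raddfD addrK.
  have [y [w kE]] := acyc n k k' kk'.
  exists (a n.+1 y), (a' n w + l').
  by rewrite E kE !raddfD chain_funP ai addrA.
move=> k z kz; have [|l [l2 E]] := acyc n (a n k) (a' n.-1 z).
  by rewrite -bd_fromP kz ai.
have [k2 [l3 lE]] := cover l.
have [|k' kk'] := @meet n (k - bd K n k2) (bd L' n l3 + l2).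
  by rewrite raddfB E lE !raddfD !chain_funP addrAC [_ + bd _ _ (j _ _)]addrC addrK.
by exists k2, k'; rewrite -kk' addrC subrK.
Qed.
End Excision.

(** The dual of the previous square: the kernels of K -> K' and L -> L' agree. *)
Section Coexcision.
Variables (K' K L' L : cochain_complex).
Variables (i : cochain_map K K') (j : cochain_map L L').
Variables (a : cochain_map L K) (a' : cochain_map L' K').
Hypotheses (ai : forall n x, i n (a n x) = a' n (j n x)).
Hypothesis cover : forall n (l : L n), a n l = 0 -> j n l = 0 -> l = 0.
Hypothesis meet : forall n (k : K n), i n k = 0 ->
  exists l, j n l = 0 /\ a n l = k.

Lemma coexcision : rel_coacyclic i <-> rel_coacyclic j.
Proof.
split=> acyc n.
  move=> l dl jl; have [| |k [ik E]] := acyc n (a n l).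
  - by rewrite -cochain_funP dl raddf0.
  - by rewrite ai jl raddf0.
  have [y [jy ay]] := meet ik; exists y; split=> //.
  apply/eqP; rewrite -subr_eq0; apply/eqP/cover; rewrite raddfB.
    by rewrite E cobd_intoP ay subrr.
  by rewrite jl cobd_intoP jy raddf0 subrr.
move=> k dk ik; have [l [jl al]] := meet ik.
have [||y [jy E]] := acyc n l => //.
  by apply: cover; rewrite cochain_funP ?al // jl raddf0.
exists (a n.-1 y); split; first by rewrite ai jy raddf0.
by rewrite -al E cobd_intoP.
Qed.
End Coexcision.

(** * G-sets and coefficient systems *)

Section GsetTools.
Variable gT : finGroupType.
Implicit Types S T : gset gT.

Lemma gset_actK S (s : S) g : gset_act S (gset_act S s g) g^-1%g = s.
Proof. by rewrite -gset_actM mulgV gset_act1. Qed.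

Lemma gset_actKV S (s : S) g : gset_act S (gset_act S s g^-1%g) g = s.
Proof. by rewrite -gset_actM mulVg gset_act1. Qed.

Lemma gmap_inv S T (f : gmap S T) : bijective f ->
  exists f' : gmap T S, cancel f f' /\ cancel f' f.
Proof.
case=> h fK hK.
have hJ t g : h (gset_act T t g) = gset_act S (h t) g.
  by apply: (can_inj fK); rewrite hK gmapJ hK.
by exists (GMap hJ).
Qed.

Section Sub.
Variables (S : gset gT) (P : pred S).
Hypothesis PJ : forall s g, P s -> P (gset_act S s g).

Definition gsub_car := {s : S | P s}.
Definition gsub_act (u : gsub_car) g : gsub_car :=
  exist _ (gset_act S (val u) g) (PJ g (valP u)).
Lemma gsub_act1 : gsub_act^~ 1%g =1 id.
Proof. by move=> u; apply: val_inj; rewrite /= gset_act1. Qed.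
Lemma gsub_actM u : act_morph gsub_act u.
Proof. by move=> g h; apply: val_inj; rewrite /= gset_actM. Qed.
Definition gsub : gset gT := GSet (TotalAction gsub_act1 gsub_actM).
Definition gsub_incl : gmap gsub S := @GMap gT gsub S val (fun _ _ => erefl).

Lemma gsub_lift_subproof T (f : gmap T S) (fP : forall t, P (f t)) t g :
  (exist _ (f (gset_act T t g)) (fP _) : gsub) =
  gset_act gsub (exist _ (f t) (fP t) : gsub) g.
Proof. by apply: val_inj; rewrite /= gmapJ. Qed.
Definition gsub_lift T (f : gmap T S) (fP : forall t, P (f t)) : gmap T gsub :=
  @GMap gT T gsub (fun t => exist _ (f t) (fP t)) (gsub_lift_subproof fP).
End Sub.

Lemma inj_finite (S T : choiceType) (f : S -> T) : injective f ->
  finite_set [set: T]%classic -> finite_set [set: S]%classic.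
Proof.
move=> f_inj; rewrite -(preimage_setT f) => /finite_preimage; apply.
by move=> x y _ _; apply: f_inj.
Qed.

Definition fingsub (S : fingset gT) (P : pred S)
    (PJ : forall s g, P s -> P (gset_act S s g)) : fingset gT :=
  @FinGSet gT (gsub PJ) (inj_finite val_inj (fingset_fin S)).

Lemma predJN S (P : pred S) : (forall s g, P s -> P (gset_act S s g)) ->
  forall s g, ~~ P s -> ~~ P (gset_act S s g).
Proof.
move=> PJ s g; apply: contraNN => /(PJ _ g^-1%g).
by rewrite gset_actK.
Qed.

Section Coefficients.
Variable mu : ccoef gT.

Lemma cc_morD (S T : fingset gT) (f : gmap S T) (x : mu T) (R : fingset gT)
  (h : gmap R S) : cc_mor mu h (cc_mor mu f x) = cc_mor mu (gmap_comp f h) x.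
Proof. by rewrite cc_comp. Qed.

(** Additivity for an internal, rather than external, disjoint union. *)
Lemma cc_glue (R1 R2 S : fingset gT) (j1 : gmap R1 S) (j2 : gmap R2 S) :
    injective j1 -> injective j2 -> (forall x y, j1 x <> j2 y) ->
    (forall s, (exists x, s = j1 x) \/ (exists y, s = j2 y)) ->
  bijective (fun c : mu S => (cc_mor mu j1 c, cc_mor mu j2 c)).
Proof.
move=> j1_inj j2_inj j12 jS.
pose f (u : fingsum R1 R2) : S := match u with inl x => j1 x | inr y => j2 y end.
have fJ u g : f (gset_act _ u g) = gset_act S (f u) g.
  by case: u => u /=; rewrite gmapJ.
have [|f' [fK f'K]] := @gmap_inv _ _ (GMap fJ).
  apply: bij_of_inj_surj => /= [[x|x] [y|y] //=|s].
  - by move=> /j1_inj ->.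
  - by move/j12.
  - by move/esym/j12.
  - by move=> /j2_inj ->.
  by case: (jS s) => -[x ->]; [exists (inl x) | exists (inr x)].
have [h hK Kh] := cc_prod mu R1 R2.
exists (fun u => @cc_mor gT mu S (fingsum R1 R2) f' (h u)) => [c|[c1 c2]].
  have -> : (cc_mor mu j1 c, cc_mor mu j2 c) =
     (@cc_mor gT mu R1 (fingsum R1 R2) (gsum_inl R1 R2)
       (@cc_mor gT mu (fingsum R1 R2) S (GMap fJ) c),
      @cc_mor gT mu R2 (fingsum R1 R2) (gsum_inr R1 R2)
       (@cc_mor gT mu (fingsum R1 R2) S (GMap fJ) c)).
    by rewrite !cc_morD; congr pair; apply: cc_mor_eq.
  by rewrite hK cc_morD -[RHS]cc_id; apply: cc_mor_eq => s; apply: f'K.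
have [E1 E2] := Kh (c1, c2).
by congr pair; [apply: etrans E1|apply: etrans E2]; rewrite cc_morD;
  apply: cc_mor_eq => s; apply: (can_inj fK); exact: f'K.
Qed.

Section Split.
Variables (S : fingset gT) (P : pred S).
Hypothesis PJ : forall s g, P s -> P (gset_act S s g).

Lemma cc_split_bij : bijective (fun c : mu S =>
  (@cc_mor gT mu (fingsub PJ) S (gsub_incl PJ) c,
   @cc_mor gT mu (fingsub (predJN PJ)) S (gsub_incl (predJN PJ)) c)).
Proof.
apply: (@cc_glue (fingsub PJ) (fingsub (predJN PJ)) S).
- exact: val_inj.
- exact: val_inj.
- by move=> [x Px] [y Py] /= xy; rewrite -xy Px in Py.
- move=> s; have [Ps|Ps] := boolP (P s).
    by left; exists (exist _ s Ps).
  by right; exists (exist _ s Ps).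
Qed.

Lemma cc_split (c : mu S) :
  @cc_mor gT mu (fingsub PJ) S (gsub_incl PJ) c = 0 ->
  @cc_mor gT mu (fingsub (predJN PJ)) S (gsub_incl (predJN PJ)) c = 0 -> c = 0.
Proof.
move=> c1 c2; have [c_inj _] := bij_inj_surj cc_split_bij.
by apply: c_inj; rewrite c1 c2 !raddf0.
Qed.

(** Multiplication by the indicator function of an invariant subset. *)
Lemma cc_restrict (c : mu S) : exists c' : mu S,
  forall (T : fingset gT) (k : gmap T S),
    ((forall t, P (k t)) -> cc_mor mu k c' = cc_mor mu k c) /\
    ((forall t, ~~ P (k t)) -> cc_mor mu k c' = 0).
Proof.
have [_ /(_ (@cc_mor gT mu (fingsub PJ) S (gsub_incl PJ) c, 0))[c' []]] :=
  bij_inj_surj cc_split_bij.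
move=> E1 E2; exists c' => T k; split=> kP.
  rewrite (cc_mor_eq _ (f' := gmap_comp (gsub_incl PJ) (gsub_lift PJ kP))) //.
  rewrite (@cc_comp gT mu T (fingsub PJ) S) E1.
  by rewrite cc_morD; apply: cc_mor_eq.
rewrite (cc_mor_eq _
  (f' := gmap_comp (gsub_incl (predJN PJ)) (gsub_lift (predJN PJ) kP))) //.
by rewrite (@cc_comp gT mu T (fingsub (predJN PJ)) S) E2 raddf0.
Qed.
End Split.

Lemma gset_img_subproof (S' S : gset gT) (j : gmap S' S) (s : S) g :
  `[< exists s', j s' = s >] -> `[< exists s', j s' = gset_act S s g >].
Proof.
move=> /asboolP[s' <-]; apply/asboolP; exists (gset_act S' s' g).
by rewrite gmapJ.
Qed.

(** Additivity for the decomposition of S into the image of j and its complement. *)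
Lemma cc_extend (S' S : fingset gT) (j : gmap S' S) (c' : mu S') :
  injective j -> exists c : mu S, cc_mor mu j c = c' /\
  forall (T : fingset gT) (k : gmap T S),
    (forall t s', k t <> j s') -> cc_mor mu k c = 0.
Proof.
move=> j_inj.
pose PJ := @gset_img_subproof S' S j.
pose S'' := fingsub (predJN PJ).
have B : bijective (fun c : mu S =>
    (cc_mor mu j c, @cc_mor gT mu S'' S (gsub_incl (predJN PJ)) c)).
  apply: (@cc_glue S' S'' S j (gsub_incl (predJN PJ))) => //.
    by move=> x [y Py] /= xy; case/asboolP: Py; exists x.
  move=> s; have [Ps|Ps] := boolP `[< exists s', j s' = s >].
    by left; have /asboolP[s' <-] := Ps; exists s'.
  by right; exists (exist _ s Ps).
have [_ /(_ (c', 0)) [c [E1 E2]]] := bij_inj_surj B.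
exists c; split=> // T k kj.
have kP t : ~~ `[< exists s', j s' = k t >].
  by apply/asboolP => -[s' E]; exact: (kj t s').
rewrite (cc_mor_eq _
  (f' := gmap_comp (gsub_incl (predJN PJ)) (gsub_lift (predJN PJ) kP))) //.
by rewrite (@cc_comp gT mu T S'' S) E2 raddf0.
Qed.

(** An element is determined by its restrictions to orbits.  A G-map k detects
    the orbit of s as soon as it has a section over it, which is what the equality
    of stabilizers of s and t provides; without it, surjectivity of k onto the
    orbit would not suffice. *)
Lemma cc_detect (S : fingset gT) (c : mu S) :
  (forall s : S, exists (T : fingset gT) (k : gmap T S) (t : T),
     [/\ k t = s, forall g, gset_act S s g = s -> gset_act T t g = t
       & cc_mor mu k c = 0]) -> c = 0.
Proof.
move=> cE.
pose orb (x s : S) := [exists g, s == gset_act S x g].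
pose P (r : seq S) s := has (fun x => orb x s) r.
have PJ r s g : P r s -> P r (gset_act S s g).
  move=> /hasP[x xr /existsP[h /eqP ->]]; apply/hasP; exists x => //.
  by apply/existsP; exists (h * g)%g; rewrite gset_actM.
suff main r : @cc_mor gT mu (fingsub (PJ r)) S (gsub_incl (PJ r)) c = 0.
  have /finite_seqP[r rE] := fingset_fin S.
  have Pr s : P r s.
    apply/hasP; exists s; last by apply/existsP; exists 1%g; rewrite gset_act1.
    by have : [set` r]%classic s by rewrite -rE.
  rewrite -[c](@cc_id gT mu S).
  rewrite (cc_mor_eq _
    (f' := gmap_comp (gsub_incl (PJ r)) (@gsub_lift S (P r) (PJ r) S (gmap_id S) Pr))) //.
  by rewrite (@cc_comp gT mu S (fingsub (PJ r)) S) main raddf0.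
elim: r => [|x r IHr]; first by apply: cc_empty => -[].
pose S1 := fingsub (PJ (x :: r)); pose A (u : S1) := P r (val u).
have AJ u g : A u -> A (gset_act S1 u g) by exact: PJ.
apply: (cc_split (PJ := AJ)).
  rewrite cc_morD.
  pose l := @gsub_lift S (P r) (PJ r) (fingsub AJ)
    (gmap_comp (gsub_incl (PJ (x :: r))) (gsub_incl AJ)) (@proj2_sig _ _).
  rewrite (cc_mor_eq _ (f' := gmap_comp (gsub_incl (PJ r)) l)) //.
  by rewrite (@cc_comp gT mu (fingsub AJ) (fingsub (PJ r)) S) IHr raddf0.
have [T [k [t [kt st kc]]]] := cE x.
have xo (u : fingsub (predJN AJ)) : exists g, val (val u) = gset_act S x g.
  case: u => -[s /= so] Ns; case/orP: (so) => [/existsP[g /eqP ->]|sr].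
    by exists g.
  by case/negP: Ns.
have [h hE] := choice xo.
have hJ u g : gset_act T t (h (gset_act _ u g)) = gset_act T (gset_act T t (h u)) g.
  have := hE (gset_act _ u g); rewrite /= [val _]/= hE.
  move/(congr1 (gset_act S ^~ (h (gset_act _ u g))^-1%g)).
  rewrite gset_actK -!gset_actM => /st.
  by move/(congr1 (gset_act T ^~ (h (gset_act _ u g)))); rewrite !gset_actM gset_actKV => ->.
rewrite cc_morD.
pose l := @GMap gT (fingsub (predJN AJ)) T (fun u => gset_act T t (h u)) hJ.
rewrite (cc_mor_eq _ (f' := gmap_comp k l)); last first.
  by move=> u; rewrite /= gmapJ kt -hE.
by rewrite (@cc_comp gT mu _ T S) kc raddf0.
Qed.

End Coefficients.
End GsetTools.

(** * From cohomology to homology *)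

Section Dual.
Variables (U B : zmodType).

Definition dual_pred : {pred (U -> B)} := [pred f | `[< zmod_morphism f >]].
Lemma dual_pred_zmod : zmod_closed dual_pred.
Proof.
split=> [|f g /asboolP fB /asboolP gB]; apply/asboolP => x y.
  by rewrite -[LHS]/(0 : B) -[RHS]/((0 : B) - 0) subrr.
rewrite -[LHS]/(f (x - y) - g (x - y)) -[RHS]/((f x - g x) - (f y - g y)).
by rewrite fB gB !opprB addrACA [RHS]addrACA; congr (_ + _); rewrite addrC.
Qed.
HB.instance Definition _ := GRing.isZmodClosed.Build (U -> B) dual_pred dual_pred_zmod.

Definition dual : zmodType := subz dual_pred.
Definition dual_fun (f : dual) : U -> B := val f.
Lemma dual_fun_additive (f : dual) : zmod_morphism (dual_fun f).
Proof. exact: asboolW (valP f). Qed.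
HB.instance Definition _ (f : dual) :=
  GRing.isZmodMorphism.Build U B (dual_fun f) (dual_fun_additive f).

Lemma dual_mk_subproof (f : U -> B) : zmod_morphism f -> f \in dual_pred.
Proof. by move=> fB; apply/asboolP. Qed.
Definition dual_mk (f : U -> B) (fB : zmod_morphism f) : dual :=
  SubZ (dual_mk_subproof fB).
Definition dual_of (f : {additive U -> B}) : dual := dual_mk (raddfB f).

Lemma dual_eq (f g : dual) : dual_fun f =1 dual_fun g -> f = g.
Proof. by move=> fg; apply: val_inj; apply: funext. Qed.

Lemma dual_fun_sum I (r : seq I) (P : pred I) (F : I -> dual) x :
  dual_fun (\sum_(i <- r | P i) F i) x = \sum_(i <- r | P i) dual_fun (F i) x.
Proof. by elim/big_rec2: _ => // i y f _ <-. Qed.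

Lemma dual_funMz f (m : int) x : dual_fun (f *~ m) x = dual_fun f x *~ m.
Proof.
have dual_funMn h k : dual_fun (h *+ k) x = dual_fun h x *+ k.
  by elim: k => // k IHk; rewrite !mulrS -IHk.
by case: m => k; rewrite -?pmulrn ?NegzE ?mulrNz -?pmulrn -?dual_funMn.
Qed.
End Dual.

Definition dual_map_fun (U V B : zmodType) (f : {additive U -> V}) (u : dual V B)
  : dual U B := dual_of (dual_fun u \o f).
Lemma dual_map_additive (U V B : zmodType) (f : {additive U -> V}) :
  zmod_morphism (@dual_map_fun U V B f).
Proof. by move=> u v; apply: dual_eq. Qed.
HB.instance Definition _ (U V B : zmodType) (f : {additive U -> V}) :=
  GRing.isZmodMorphism.Build (dual V B) (dual U B) (@dual_map_fun U V B f)
    (@dual_map_additive U V B f).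
Definition dual_map (U V B : zmodType) (f : {additive U -> V}) :
  {additive dual V B -> dual U B} := @dual_map_fun U V B f.

Section DualCoef.
Variables (gT : finGroupType) (mu : hcoef gT) (B : zmodType).

Lemma dual_coef_id (S : fingset gT) (x : dual (mu S) B) :
  dual_map B (@hc_mor gT mu S S (gmap_id S)) x = x.
Proof. by apply: dual_eq => u; rewrite /dual_fun /= hc_id. Qed.
Lemma dual_coef_comp (R S T : fingset gT) (f : gmap S T) (h : gmap R S)
    (x : dual (mu T) B) :
  dual_map B (@hc_mor gT mu R T (gmap_comp f h)) x =
  dual_map B (hc_mor mu h) (dual_map B (hc_mor mu f) x).
Proof. by apply: dual_eq => u; rewrite /dual_fun /= hc_comp. Qed.
Lemma dual_coef_empty (S : fingset gT) : (S -> False) ->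
  forall x : dual (mu S) B, x = 0.
Proof.
by move=> S0 x; apply: dual_eq => u; rewrite [u](hc_empty S0) !raddf0.
Qed.
Lemma dual_coef_prod (S T : fingset gT) :
  bijective (fun x : dual (mu (fingsum S T)) B =>
    (dual_map B (@hc_mor gT mu S (fingsum S T) (gsum_inl S T)) x,
     dual_map B (@hc_mor gT mu T (fingsum S T) (gsum_inr S T)) x)).
Proof.
have [g gK Kg] := hc_sum mu S T.
set inS := @hc_mor gT mu S (fingsum S T) (gsum_inl S T) in g gK Kg *.
set inT := @hc_mor gT mu T (fingsum S T) (gsum_inr S T) in g gK Kg *.
have gB x y : g (x - y) = ((g x).1 - (g y).1, (g x).2 - (g y).2).
  apply: (can_inj gK); rewrite Kg /= !raddfB.
  by rewrite addrACA -opprD (Kg x) (Kg y).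
pose F (u : dual (mu S) B * dual (mu T) B) (x : mu (fingsum S T)) : B :=
  dual_fun u.1 (g x).1 + dual_fun u.2 (g x).2.
have FB u : zmod_morphism (F u).
  by move=> x y; rewrite /F gB /= !raddfB addrACA -opprD.
exists (fun u => dual_mk (FB u)) => [x|[u v]].
  apply: dual_eq => y; rewrite /dual_fun /= /F /dual_fun /= -!/(dual_fun x _).
  by rewrite -raddfD (Kg y).
have g1 x : g (inS x) = (x, 0) by rewrite -[RHS]gK /= raddf0 addr0.
have g2 x : g (inT x) = (0, x) by rewrite -[RHS]gK /= raddf0 add0r.
congr pair; apply: dual_eq => y.
  rewrite -[LHS]/(dual_fun u (g (inS y)).1 + dual_fun v (g (inS y)).2) g1 /=.
  by rewrite raddf0 addr0.
rewrite -[LHS]/(dual_fun u (g (inT y)).1 + dual_fun v (g (inT y)).2) g2 /=.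
by rewrite raddf0 add0r.
Qed.

Definition dual_coef : ccoef gT :=
  @CCoef gT (fun S => dual (mu S) B) (fun S T f => dual_map B (hc_mor mu f))
    dual_coef_id dual_coef_comp dual_coef_empty dual_coef_prod.
End DualCoef.

Section Acyclic.
Variable gT : finGroupType.
Implicit Types X Y Z : fingspace gT.

Section Restriction.
Variables (X Y : fingspace gT) (f : gspmap X Y).
Hypothesis f_inj : forall n, injective (f n).

Variable mu : ccoef gT.

(** Extension by zero preserves normalization because degeneracies preserve both
    the image of f and its complement.  Hence restriction along an injective map
    is surjective on normalized cochains. *)
Lemma conorm_extend n (c' : normalized_cochains (bredon_czmod mu X) n) :
  exists c : normalized_cochains (bredon_czmod mu Y) n,
    normalized_cochain_map (bredon_czmap mu f) n c = c' /\
    forall (T : fingset gT) (k : gmap T (Y n)),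
      (forall t x, k t <> f n x) ->
      @cc_mor gT mu T (fin_simp Y n) k (val c) = 0.
Proof.
have [c [cE c0]] := @cc_extend gT mu (fin_simp X n) (fin_simp Y n) (f n) (val c') (f_inj (n := n)).
suff cN : c \in @codegen_kernel (bredon_czmod mu Y) n.
  by exists (SubZ cN); split=> //; apply: val_inj.
case: n c' c cE c0 => [|n] c' c cE c0; rewrite unfold_in //=.
apply/forallP => j; apply/eqP.
apply: cc_detect => y.
have [[x xy]|yX] := pselect (exists x, f n x = y).
  exists (fin_simp X n), (f n), x; split=> //.
    by move=> g; rewrite -xy -gmapJ => /f_inj.
  have := valP c'; rewrite unfold_in /= => /forallP /(_ j) /eqP.
  rewrite /= -cE /bredon_comor !cc_morD => <-.
  by apply: cc_mor_eq => z; rewrite /= gspmapP.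
pose PJ := @gset_img_subproof gT (X n) (Y n) (f n).
have yP : ~~ `[< exists x, f n x = y >] by apply/asboolP.
exists (@fingsub gT (fin_simp Y n) _ (predJN PJ)), (gsub_incl (predJN PJ)), (exist _ y yP).
split=> // [g yg|]; first exact: val_inj.
rewrite /bredon_comor cc_morD; apply: c0 => -[z zP] x /= E.
case/asboolP: zP; exists (gspmor X (coface n j) x); rewrite gspmapP -E.
by rewrite -gspmor_comp codegen_coface_id ?gspmor_id; last by left.
Qed.
End Restriction.

(** Quantifying over all cohomological systems is what allows this condition to be
    transferred to homology through the systems Hom(mu, B). *)
Definition contractible X Y (f : gspmap X Y) := forall mu : ccoef gT,
  rel_coacyclic (normalized_cochain_map (bredon_czmap mu f)).

Lemma contractible_coqiso X Y (f : gspmap X Y) (mu : ccoef gT) :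
  (forall n, injective (f n)) -> contractible f ->
  forall n, bijective (bredon_cohomology_map mu f n).
Proof.
move=> f_inj fc; apply/coqiso_surj => [n c'|]; last exact: fc.
by have [c [cE _]] := conorm_extend f_inj c'; exists c.
Qed.

Section DualCochains.
Variables (mu : hcoef gT) (B : zmodType) (X : fingspace gT).
Let C := normalized_chains (bredon_szmod mu X).
Let D := normalized_cochains (bredon_czmod (dual_coef mu B) X).

Lemma dual_cochain_subproof n (q : {additive C n -> B}) :
  (dual_of (q \o \pi_(C n)%qT) : bredon_czmod (dual_coef mu B) X n)
    \in @codegen_kernel (bredon_czmod (dual_coef mu B) X) n.
Proof.
case: n q => [|n] q; rewrite unfold_in //=; apply/forallP => j; apply/eqP.
apply: dual_eq => x.
transitivity (q (\pi_(C n.+1) (szmor (bredon_szmod mu X) (codegen j) x))%qT).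
  by [].
rewrite -[RHS](raddf0 q); congr (q _); apply/quot_eq0/mem_zspan.
by exists j, x.
Qed.
Definition dual_cochain n (q : {additive C n -> B}) : D n :=
  SubZ (dual_cochain_subproof q).

Definition cochain_eval n (c : D n) : mu (fin_simp X n) -> B := dual_fun (val c).
HB.instance Definition _ n (c : D n) := GRing.Additive.on (cochain_eval c).

Lemma cochain_eval_degen n (c : D n) x :
  x \in zspan (@is_degen (bredon_szmod mu X) n) -> cochain_eval c x = 0.
Proof.
move=> xD; apply/eqP; rewrite -[_ == 0]/(x \in kerp (cochain_eval c)).
apply: zspan_min xD => y; case: n c y {x} => [|n] c y //= [j [z ->]].
rewrite inE; apply/eqP.
have /eqP cj : czmor (bredon_czmod (dual_coef mu B) X) (codegen j) (val c) == 0.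
  by have := valP c; rewrite unfold_in => /forallP /(_ j).
by rewrite -[LHS]/(dual_fun (czmor (bredon_czmod (dual_coef mu B) X)
  (codegen j) (val c)) z) cj.
Qed.

Lemma cochain_eval_cobd n (c : D n) x :
  cochain_eval (cobd D n c) x =
  cochain_eval c (@alt_face (bredon_szmod mu X) n x).
Proof.
rewrite /cochain_eval /= /alt_coface dual_fun_sum raddf_sum.
by apply: eq_bigr => i _; rewrite dual_funMz raddfMz.
Qed.

Lemma cochain_eq n (c c' : D n) :
  cochain_eval c =1 cochain_eval c' -> c = c'.
Proof. by move=> cc'; apply: val_inj; apply: dual_eq. Qed.
End DualCochains.

Lemma cochain_eval_map (mu : hcoef gT) (B : zmodType) X Y (f : gspmap X Y) n
   (c : normalized_cochains (bredon_czmod (dual_coef mu B) Y) n) x :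
  cochain_eval (normalized_cochain_map (bredon_czmap (dual_coef mu B) f) n c) x =
  cochain_eval c (bredon_fun mu f n x).
Proof. by []. Qed.
End Acyclic.

Section ImageSum.
Variables (U V W : zmodType) (f : {additive U -> V}) (g : {additive W -> V}).
Definition imsum : {pred V} := [pred v | `[< exists y w, v = f y + g w >]].
Lemma imsum_zmod : zmod_closed imsum.
Proof.
split=> [|x y /asboolP[x1 [x2 ->]] /asboolP[y1 [y2 ->]]]; apply/asboolP.
  by exists 0, 0; rewrite !raddf0 addr0.
by exists (x1 - y1), (x2 - y2); rewrite !raddfB opprD addrACA.
Qed.
HB.instance Definition _ := GRing.isZmodClosed.Build V imsum imsum_zmod.

Lemma imsum_l y : f y \in imsum.
Proof. by apply/asboolP; exists y, 0; rewrite raddf0 addr0. Qed.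
Lemma imsum_r w : g w \in imsum.
Proof. by apply/asboolP; exists 0, w; rewrite raddf0 add0r. Qed.
End ImageSum.

Section FromCohomology.
Variable gT : finGroupType.
Implicit Types X Y Z : fingspace gT.

Lemma cochain_eval_dual (mu : hcoef gT) (B : zmodType) X n
    (q : {additive normalized_chains (bredon_szmod mu X) n -> B}) x :
  cochain_eval (dual_cochain q) x =
  q (\pi_(normalized_chains (bredon_szmod mu X) n) x)%qT.
Proof. by []. Qed.

Lemma cochain_eval_pi (mu : hcoef gT) (B : zmodType) X n
    (c : normalized_cochains (bredon_czmod (dual_coef mu B) X) n) x y :
  (\pi_(normalized_chains (bredon_szmod mu X) n) x =
   \pi_(normalized_chains (bredon_szmod mu X) n) y)%qT ->
  cochain_eval c x = cochain_eval c y.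
Proof.
move=> /quot_eqP/cochain_eval_degen-/(_ _ c) E.
by apply/eqP; rewrite -subr_eq0 -(raddfB (cochain_eval c)); apply/eqP.
Qed.

Section Map.
Variables (mu : hcoef gT) (X Y : fingspace gT) (f : gspmap X Y).
Let F := normalized_chain_map (bredon_szmap mu f).
Let pX n := (\pi_(normalized_chains (bredon_szmod mu X) n))%qT.
Let pY n := (\pi_(normalized_chains (bredon_szmod mu Y) n))%qT.

Lemma chain_map_pi n x : F n (@pX n x) = @pY n (bredon_fun mu f n x).
Proof. exact: quot_map_pi. Qed.

Lemma bd_pi n x : bd (normalized_chains (bredon_szmod mu X)) n (@pX n.+1 x) =
  @pX n (@alt_face (bredon_szmod mu X) n x).
Proof. exact: quot_map_pi. Qed.

(** The identity, seen as a cochain with values in the normalized chains of X,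
    extends to Y; the extension is a retraction of normalized chains. *)
Lemma norm_chain_inj : (forall n, injective (f n)) ->
  forall n, injective (F n).
Proof.
move=> f_inj n; apply: raddf_inj => x.
have [c [cE _]] := conorm_extend f_inj (@dual_cochain gT mu _ X n idfun).
elim/quotW: x => x; rewrite chain_map_pi => fx.
rewrite -[LHS]/(cochain_eval (@dual_cochain gT mu _ X n idfun) x) -cE.
rewrite cochain_eval_map -[RHS](raddf0 (cochain_eval c)).
by apply: cochain_eval_pi; rewrite raddf0.
Qed.
End Map.

(** Let B be the n-chains of Y modulo boundaries and chains of X.  The projection
    onto B is a relative cocycle, hence a relative coboundary, so it vanishes on
    the relative cycles: each of them is a boundary up to a chain of X. *)
Lemma contractible_rel_acyclic (mu : hcoef gT) X Y (f : gspmap X Y) :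
  contractible f -> rel_acyclic (normalized_chain_map (bredon_szmap mu f)).
Proof.
move=> fc n x z xz.
set F := normalized_chain_map _ in xz *.
pose S := imsum (bd (normalized_chains (bredon_szmod mu Y)) n) (F n).
suff : x \in S by move/asboolP.
pose q := (\pi_({ideal_quot S}))%qT : {additive _ -> {ideal_quot S}}.
pose c := dual_cochain q.
have [||b [fb E]] := fc (dual_coef mu {ideal_quot S}) n c.
- apply: cochain_eq => u; rewrite cochain_eval_cobd cochain_eval_dual.
  by rewrite -bd_pi; apply/quot_eq0/imsum_l.
- apply: cochain_eq => u; rewrite cochain_eval_map cochain_eval_dual.
  by rewrite -chain_map_pi; apply/quot_eq0/imsum_r.
elim/quotW: x xz => x xz; apply/quot_eq0.
rewrite -[LHS]/(cochain_eval c x) {}E.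
case: n @F @S @q @c x z b fb xz => [|n] F S q c x z b fb xz //=.
rewrite cochain_eval_cobd; elim/quotW: z xz => z.
rewrite /F /= bd_pi (chain_map_pi f z) => /cochain_eval_pi ->.
by rewrite -cochain_eval_map fb.
Qed.

Lemma contractible_qiso X Y (f : gspmap X Y) (mu : hcoef gT) :
  (forall n, injective (f n)) -> contractible f ->
  forall n, bijective (bredon_homology_map mu f n).
Proof.
move=> f_inj fc; apply/qiso_inj => [n|]; first exact: norm_chain_inj.
exact: contractible_rel_acyclic.
Qed.

Section Square.
Variables (X' X Y' Y : fingspace gT).
Variables (i : gspmap X' X) (j : gspmap Y' Y) (a : gspmap X Y) (a' : gspmap X' Y').
Hypotheses (i_inj : forall n, injective (i n)) (j_inj : forall n, injective (j n)).
Hypotheses (a_inj : forall n, injective (a n)).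
Hypothesis ai : forall n x, a n (i n x) = j n (a' n x).
Hypothesis cover : forall n y, (exists x, y = a n x) \/ (exists y', y = j n y').
Hypothesis meet : forall n x y', a n x = j n y' -> exists x', x = i n x'.

Lemma a'_inj n : injective (a' n).
Proof.
by move=> x y xy; apply: (@i_inj n); apply: (@a_inj n); rewrite !ai xy.
Qed.

Section Coefficient.
Variable mu : ccoef gT.
Let I := normalized_cochain_map (bredon_czmap mu i).
Let J := normalized_cochain_map (bredon_czmap mu j).
Let A := normalized_cochain_map (bredon_czmap mu a).
Let A' := normalized_cochain_map (bredon_czmap mu a').

Lemma square_comm n c : I n (A n c) = A' n (J n c).
Proof.
apply: val_inj; rewrite /= /bredon_cofun !cc_morD; apply: cc_mor_eq => x.
by rewrite /= ai.
Qed.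

Lemma square_cover n c : A n c = 0 -> J n c = 0 -> c = 0.
Proof.
move=> /(congr1 val) ac /(congr1 val) jc; apply: val_inj.
apply: (@cc_detect gT mu (fin_simp Y n)) => y; case: (cover y) => -[x ->].
  exists (fin_simp X n), (a n), x; split=> // g.
  by rewrite -gmapJ => /a_inj.
exists (fin_simp Y' n), (j n), x; split=> // g.
by rewrite -gmapJ => /j_inj.
Qed.

Lemma square_meet n k : I n k = 0 -> exists l, J n l = 0 /\ A n l = k.
Proof.
move=> /(congr1 val) ik; have [l [al l0]] := conorm_extend a_inj k.
rewrite -al in ik; exists l; split=> //; apply: val_inj.
apply: (@cc_detect gT mu (fin_simp Y' n)) => y.
pose PJ := @gset_img_subproof gT (X n) (Y n) (a n).
have QJ s g : ~~ `[< exists x, a n x = j n s >] ->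
    ~~ `[< exists x, a n x = j n (gset_act (Y' n) s g) >].
  by rewrite gmapJ; apply: (predJN PJ).
have [[x xy]|yX] := pselect (exists x, a n x = j n y).
  have [x' xx'] := meet xy; exists (fin_simp X' n), (a' n), x'; split.
  - by apply: (@j_inj n); rewrite -ai -xx' xy.
  - move=> g; have <- : a' n x' = y by apply: (@j_inj n); rewrite -ai -xx' xy.
    by rewrite -gmapJ => /a'_inj.
  by have /(congr1 val) := square_comm l; rewrite /= => <-; exact: ik.
have yP : ~~ `[< exists x, a n x = j n y >] by apply/asboolP.
exists (@fingsub gT (fin_simp Y' n) _ QJ), (gsub_incl QJ), (exist _ y yP).
split=> // [g yg|]; first exact: val_inj.
rewrite /= /bredon_cofun cc_morD; apply: l0 => -[z zP] x /= E.
by case/asboolP: zP; exists x.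
Qed.

Lemma square_coexcision : rel_coacyclic I <-> rel_coacyclic J.
Proof.
apply: coexcision square_comm _ _ => n; first exact: square_cover.
exact: square_meet.
Qed.
End Coefficient.

Section HCoefficient.
Variable mu : hcoef gT.
Let I := normalized_chain_map (bredon_szmap mu i).
Let J := normalized_chain_map (bredon_szmap mu j).
Let A := normalized_chain_map (bredon_szmap mu a).
Let A' := normalized_chain_map (bredon_szmap mu a').

(** Both conditions of excision on chains state that some element of a quotient is
    zero; the projections onto these quotients are cochains, to which the
    cohomological conditions apply. *)
Lemma square_excision : rel_acyclic I <-> rel_acyclic J.
Proof.
apply: (@excision _ _ _ _ I J A A') => n.
- move=> x; elim/quotW: x => x; rewrite !chain_map_pi; congr (\pi _)%qT.
  by rewrite /bredon_fun -!hc_comp; apply: hc_mor_eq => s; apply: ai.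
- move=> l; pose S := imsum (A n) (J n); suff : l \in S by move/asboolP.
  pose q := (\pi_({ideal_quot S}))%qT : {additive _ -> {ideal_quot S}}.
  have c0 : dual_cochain q = 0.
    apply: square_cover; apply: cochain_eq => u.
      by rewrite cochain_eval_map cochain_eval_dual -chain_map_pi;
        apply/quot_eq0/imsum_l.
    by rewrite cochain_eval_map cochain_eval_dual -chain_map_pi;
      apply/quot_eq0/imsum_r.
  apply/quot_eq0; elim/quotW: l => l.
  by rewrite -[LHS]/(cochain_eval (dual_cochain q) l) c0.
move=> k l' kl; pose S := imsum (I n) (I n).
suff /asboolP[y [w ->]] : k \in S by exists (y + w); rewrite raddfD.
pose q := (\pi_({ideal_quot S}))%qT : {additive _ -> {ideal_quot S}}.
have [|l [jl al]] := @square_meet _ n (dual_cochain q).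
  apply: cochain_eq => u.
  by rewrite cochain_eval_map cochain_eval_dual -chain_map_pi;
    apply/quot_eq0/imsum_l.
apply/quot_eq0; elim/quotW: k kl => k; elim/quotW: l' => l'.
rewrite !chain_map_pi => kl.
rewrite -[LHS]/(cochain_eval (dual_cochain q) k) -al cochain_eval_map.
by rewrite (cochain_eval_pi _ kl) -cochain_eval_map jl.
Qed.
End HCoefficient.
End Square.
End FromCohomology.

Lemma bij_comp_l (S T U : Type) (f : S -> T) (g : T -> U) (h : S -> U) :
  (forall x, h x = g (f x)) -> bijective f -> (bijective g <-> bijective h).
Proof.
move=> hE f_bij; split=> [g_bij|h_bij].
  by apply: eq_bij (bij_comp g_bij f_bij) _ _ => x; rewrite /= hE.
have [f' fK f'K] := f_bij.
by apply: eq_bij (bij_comp h_bij (Bijective f'K fK)) _ _ => x; rewrite /= hE f'K.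
Qed.

Lemma bij_comp_r (S T U : Type) (f : S -> T) (g : T -> U) (h : S -> U) :
  (forall x, h x = g (f x)) -> bijective g -> (bijective f <-> bijective h).
Proof.
move=> hE g_bij; split=> [f_bij|h_bij].
  by apply: eq_bij (bij_comp g_bij f_bij) _ _ => x; rewrite /= hE.
have [g' gK g'K] := g_bij.
by apply: eq_bij (bij_comp (Bijective g'K gK) h_bij) _ _ => x; rewrite /= hE gK.
Qed.

Lemma bij_contractible (gT : finGroupType) (X Y : fingspace gT)
  (f : gspmap X Y) : (forall n, bijective (f n)) -> contractible f.
Proof.
move=> f_bij mu n c dc fc; exists 0; split; rewrite raddf0 //.
apply: val_inj; apply: cc_detect => y.
have [f_inj /(_ y)[x xy]] := bij_inj_surj (f_bij n).
exists (fin_simp X n), (f n), x; split=> // [g|].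
  by rewrite -xy -gmapJ => /f_inj.
by have /(congr1 val) := fc.
Qed.

Lemma gspmap_compP (gT : finGroupType) (X Y Z : gspace gT) (g : gspmap Y Z)
    (f : gspmap X Y) m n (h : mono m n) x :
  gmap_comp (g m) (f m) (gspmor X h x) = gspmor Z h (gmap_comp (g n) (f n) x).
Proof. by rewrite /= !gspmapP. Qed.
Definition gspmap_comp (gT : finGroupType) (X Y Z : gspace gT)
  (g : gspmap Y Z) (f : gspmap X Y) : gspmap X Z := GSpMap (gspmap_compP g f).

Section WeakEquivalences.
Variable gT : finGroupType.
Implicit Types X Y Z : fingspace gT.

(** The properties of Bredon equivalences through which the combinatorics below
    is carried out simultaneously for homology and for cohomology. *)
Record equivalence_class (E : forall X Y, gspmap X Y -> Prop) : Prop := {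
  equiv_comp_l : forall X Y Z (f : gspmap X Y) (g : gspmap Y Z) (h : gspmap X Z),
    (forall n x, h n x = g n (f n x)) -> E _ _ f -> (E _ _ g <-> E _ _ h);
  equiv_comp_r : forall X Y Z (f : gspmap X Y) (g : gspmap Y Z) (h : gspmap X Z),
    (forall n x, h n x = g n (f n x)) -> E _ _ g -> (E _ _ f <-> E _ _ h);
  equiv_contractible : forall X Y (f : gspmap X Y),
    (forall n, injective (f n)) -> contractible f -> E _ _ f;
  equiv_excision : forall X' X Y' Y
      (i : gspmap X' X) (j : gspmap Y' Y) (a : gspmap X Y) (a' : gspmap X' Y'),
    (forall n, injective (i n)) -> (forall n, injective (j n)) ->
    (forall n, injective (a n)) -> (forall n x, a n (i n x) = j n (a' n x)) ->
    (forall n y, (exists x, y = a n x) \/ (exists y', y = j n y')) ->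
    (forall n x y', a n x = j n y' -> exists x', x = i n x') ->
    (E _ _ i <-> E _ _ j) }.

Lemma homology_class (mu : hcoef gT) : equivalence_class
  (fun X Y (f : gspmap X Y) => forall n, bijective (bredon_homology_map mu f n)).
Proof.
have comp X Y Z (f : gspmap X Y) (g : gspmap Y Z) (h : gspmap X Z) :
    (forall n x, h n x = g n (f n x)) -> forall n x,
    bredon_homology_map mu h n x =
    bredon_homology_map mu g n (bredon_homology_map mu f n x).
  move=> hE; apply: homology_map_comp => n x; elim/quotW: x => x.
  rewrite (chain_map_pi h) (chain_map_pi f) (chain_map_pi g).
  congr (\pi _)%qT; rewrite /bredon_fun -hc_comp.
  by apply: hc_mor_eq => s; apply: hE.
split=> [X Y Z f g h hE fE|X Y Z f g h hE gE|X Y f f_inj fc|].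
- by split=> E n; apply/(bij_comp_l (comp _ _ _ f g h hE n)).
- by split=> E n; apply/(bij_comp_r (comp _ _ _ f g h hE n)).
- exact: contractible_qiso.
move=> X' X Y' Y i j a a' i_inj j_inj a_inj ai cover meet.
have iE := qiso_inj (norm_chain_inj (mu := mu) i_inj).
have jE := qiso_inj (norm_chain_inj (mu := mu) j_inj).
have E := square_excision i_inj j_inj a_inj ai cover meet mu.
by split=> [/iE/E/jE|/jE/E/iE].
Qed.

Lemma cohomology_class (mu : ccoef gT) : equivalence_class
  (fun X Y (f : gspmap X Y) => forall n, bijective (bredon_cohomology_map mu f n)).
Proof.
have comp X Y Z (f : gspmap X Y) (g : gspmap Y Z) (h : gspmap X Z) :
    (forall n x, h n x = g n (f n x)) -> forall n x,
    bredon_cohomology_map mu h n x =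
    bredon_cohomology_map mu f n (bredon_cohomology_map mu g n x).
  move=> hE; apply: cohomology_map_comp => n x; apply: val_inj => /=.
  by rewrite /bredon_cofun cc_morD; apply: cc_mor_eq => s; apply: hE.
have surj X Y (f : gspmap X Y) (f_inj : forall n, injective (f n)) n c' :
    exists c, normalized_cochain_map (bredon_czmap mu f) n c = c'.
  by have [c [cE _]] := conorm_extend f_inj c'; exists c.
split=> [X Y Z f g h hE fE|X Y Z f g h hE gE|X Y f f_inj fc|].
- by split=> E n; apply/(bij_comp_r (comp _ _ _ f g h hE n)).
- by split=> E n; apply/(bij_comp_l (comp _ _ _ f g h hE n)).
- exact: contractible_coqiso.
move=> X' X Y' Y i j a a' i_inj j_inj a_inj ai cover meet.
have iE := coqiso_surj (surj _ _ i i_inj).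
have jE := coqiso_surj (surj _ _ j j_inj).
have E := square_coexcision i_inj j_inj a_inj ai cover meet mu.
by split=> [/iE/E/jE|/jE/E/iE].
Qed.
End WeakEquivalences.

(** * Contraction by insertion of a vertex *)

Section OrbitMaps.
Variable gT : finGroupType.

Section Base.
Variable H : {group gT}.
Lemma gbase_subproof : (H : {set gT}) \in rcosets H [set: gT].
Proof. by apply/rcosetsP; exists 1%g; rewrite ?inE // mulg1. Qed.
Definition gbase : gorbit H := (exist _ (H : {set gT}) gbase_subproof : orbit_car H).

Lemma gbaseP (t : gorbit H) : exists g, t = gset_act _ gbase g.
Proof.
have /rcosetsP[g _ tE] := valP t; exists g; apply: val_inj.
by rewrite /= tE.
Qed.

Lemma gorbit_map_eq (S : gset gT) (k k' : gmap (gorbit H) S) :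
  k gbase = k' gbase -> k =1 k'.
Proof. by move=> kk' t; have [g ->] := gbaseP t; rewrite !gmapJ kk'. Qed.

Lemma gbase_fix g : g \in H -> gset_act _ gbase g = gbase.
Proof. by move=> Hg; apply: val_inj; rewrite /= rcoset_id. Qed.

Lemma gorbit_map_fix (S : gset gT) (k : gmap (gorbit H) S) g :
  g \in H -> gset_act _ (k gbase) g = k gbase.
Proof. by move=> Hg; rewrite -gmapJ gbase_fix. Qed.

Lemma gorbit_map_ex (S : gset gT) (s : S) :
  (forall g, g \in H -> gset_act S s g = s) ->
  exists k : gmap (gorbit H) S, k gbase = s.
Proof.
move=> sH.
have E (t : gorbit H) g : g \in (val t : {set gT}) ->
    gset_act S s (fingroup.repr (val t)) = gset_act S s g.
  have /rcosetsP[x _ ->] := valP t => /rcosetP[h Hh ->].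
  have := mem_repr_rcoset H x => /rcosetP[h' Hh' ->].
  by rewrite !gset_actM (sH _ Hh) (sH _ Hh').
have J (t : gorbit H) g :
    gset_act S s (fingroup.repr (val (gset_act _ t g))) =
    gset_act S (gset_act S s (fingroup.repr (val t))) g.
  rewrite -gset_actM; apply: E; rewrite /= mem_rcoset mulgK.
  have /rcosetsP[x _ ->] := valP t; exact: mem_repr_rcoset.
exists (GMap J) => /=; rewrite (E gbase 1%g) ?gset_act1 //=.
Qed.
End Base.

Lemma stab_group_set (S : gset gT) (s : S) : group_set [set g | gset_act S s g == s].
Proof.
apply/group_setP; split=> [|g h]; rewrite !inE ?gset_act1 //.
by move=> /eqP sg /eqP sh; rewrite gset_actM sg sh.
Qed.
Definition stab_group (S : gset gT) (s : S) := Group (stab_group_set s).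

(** Points of S are replaced by G-maps k : G/H -> S, with point k(H), so that
    values at different points can be compared in one group mu(G/H). *)
Lemma cc_detect_orbits (mu : ccoef gT) (S : fingset gT) (c : mu S) :
  (forall (H : {group gT}) (k : gmap (gorbit H) S),
     @cc_mor gT mu (fin_orbit H) S k c = 0) -> c = 0.
Proof.
move=> cE; apply: cc_detect => s.
have [g|k ks] := @gorbit_map_ex (stab_group s) S s.
  by rewrite inE => /eqP.
exists (fin_orbit (stab_group s)), k, (gbase _); split=> // g sg.
by apply: gbase_fix; rewrite inE sg.
Qed.
End OrbitMaps.

Lemma sign_addnn p : (-1) ^+ (p + p) = 1 :> int.
Proof. by rewrite addnn -signr_odd odd_double. Qed.

(** The operation h inserts a vertex at position pos into each simplex outside X.
    A face of such a simplex either commutes with the insertion, or has smaller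
    rank (or lies in X) both before and after it. *)
Section Insertion.
Variables (gT : finGroupType) (X Y : fingspace gT) (f : gspmap X Y).
Hypothesis f_inj : forall n, injective (f n).

Definition outside n (y : Y n) := ~ exists x, f n x = y.

Variables (h : forall n, gmap (Y n) (Y n.+1)) (pos rk : forall n, Y n -> nat).
Let low r n (y : Y n) := outside y -> (rk y < r)%N.
Let face n j (y : Y n.+1) := gspmor Y (coface n j) y.

Hypothesis posJ : forall n (y : Y n) g, pos (gset_act _ y g) = pos y.
Hypothesis pos_le : forall n (y : Y n), outside y -> (pos y < n.+2)%N.
Hypothesis face_pos : forall n (y : Y n), outside y -> face (pos y) (h n y) = y.
Hypothesis face_vertex : forall (y : Y 0%N), outside y ->
  low (rk y) (face (bump (pos y) 0) (h 0 y)).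
Hypothesis face_other : forall n (y : Y n.+1) j, (j < n.+2)%N -> outside y ->
  [\/ [/\ outside (face j y),
          face (bump (pos y) j) (h n.+1 y) = h n (face j y) &
          pos (face j y) = (pos y - (j < pos y))%N]
    | low (rk y) (face (bump (pos y) j) (h n.+1 y)) /\
      low (rk y) (h n (face j y))].
Hypothesis h_degen : forall n (z : Y n) (i : 'I_n.+1),
  outside (gspmor Y (codegen i) z) ->
  exists (i' : 'I_n.+2) z', h n.+1 (gspmor Y (codegen i) z) =
    gspmor Y (codegen i') z'.
Hypothesis rk_bound : forall n (y : Y n), (rk y <= n.+1)%N.

Lemma outsideJ n (y : Y n) g : outside y -> outside (gset_act _ y g).
Proof.
move=> yo [x xy]; apply: yo; exists (gset_act _ x g^-1%g).
by rewrite gmapJ xy gset_actK.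
Qed.

Section Cochains.
Variable mu : ccoef gT.
Let C := normalized_cochains (bredon_czmod mu Y).
Let F := normalized_cochain_map (bredon_czmap mu f).

Definition coval (H : {group gT}) n (k : gmap (gorbit H) (Y n)) (c : C n) :
  mu (fin_orbit H) := @cc_mor gT mu (fin_orbit H) (fin_simp Y n) k (val c).

Lemma covalB H n (k : gmap (gorbit H) (Y n)) (c c' : C n) :
  coval k (c - c') = coval k c - coval k c'.
Proof. by rewrite /coval !raddfB. Qed.

Lemma coval_eq H n (k k' : gmap (gorbit H) (Y n)) (c : C n) :
  k (gbase H) = k' (gbase H) -> coval k c = coval k' c.
Proof. by move=> kk'; apply: cc_mor_eq; apply: gorbit_map_eq. Qed.

Lemma coval_cobd H n (k : gmap (gorbit H) (Y n.+1)) (c : C n) :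
  coval k (cobd C n c) =
  \sum_(i < n.+2) coval (gmap_comp (gspmor Y (coface n i)) k) c *~ (-1) ^+ i.
Proof.
rewrite /coval /= /alt_coface raddf_sum; apply: eq_bigr => i _.
by rewrite raddfMz /= /bredon_comor cc_morD.
Qed.

Lemma coval_degen H n (k : gmap (gorbit H) (Y n.+1)) (c : C n.+1)
    (i : 'I_n.+1) (z : Y n) :
  k (gbase H) = gspmor Y (codegen i) z -> coval k c = 0.
Proof.
move=> kz.
have /eqP ci : czmor (bredon_czmod mu Y) (codegen i) (val c) == 0.
  by have := valP c; rewrite unfold_in => /forallP /(_ i).
rewrite (@coval_eq _ _ _ (gmap_comp (gspmor Y (codegen i))
    (gmap_comp (gspmor Y (coface n i)) k))); last first.
  rewrite /= kz -(gspmor_comp (codegen i) (coface n i)).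
  by rewrite codegen_coface_id ?gspmor_id; last by left.
rewrite /coval (@cc_comp gT mu (fin_orbit H) (fin_simp Y n) (fin_simp Y n.+1)).
rewrite [X in cc_mor _ _ X](ci : @cc_mor gT mu (fin_simp Y n) (fin_simp Y n.+1)
  _ (val c) = 0).
by rewrite raddf0.
Qed.

Lemma coval_inside H n (k : gmap (gorbit H) (Y n)) (c : C n) :
  F n c = 0 -> ~ outside (k (gbase H)) -> coval k c = 0.
Proof.
move=> fc /contrapT[x xk].
have [g Hg|k' k'x] := @gorbit_map_ex _ H (X n) x.
  by apply: (@f_inj n); rewrite gmapJ xk gorbit_map_fix.
rewrite (@coval_eq _ _ _ (gmap_comp (f n) k')) /= ?k'x //.
rewrite /coval (@cc_comp gT mu (fin_orbit H) (fin_simp X n) (fin_simp Y n)).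
have /(congr1 val) /= := fc; rewrite /bredon_cofun => ->.
by rewrite raddf0.
Qed.

Lemma coval_detect n (c : C n) :
  (forall H (k : gmap (gorbit H) (Y n)), coval k c = 0) -> c = 0.
Proof. by move=> cE; apply: val_inj; apply: cc_detect_orbits. Qed.

Lemma restrict_detect n (c : C n) :
  (forall H (k : gmap (gorbit H) (Y n)), ~ outside (k (gbase H)) ->
     coval k c = 0) -> F n c = 0.
Proof.
move=> cE; apply: val_inj; apply: cc_detect_orbits => H k.
rewrite /= /bredon_cofun cc_morD; apply: cE; apply.
by exists (k (gbase H)).
Qed.

Definition vanishes r n (c : C n) := forall H (k : gmap (gorbit H) (Y n)),
  low r (k (gbase H)) -> coval k c = 0.

(** The homotopy: up to sign, evaluation on the simplex after insertion, extended
    by zero over X. *)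
Lemma coinsert_ex n (c : C n.+1) : exists b : C n,
  forall H (k : gmap (gorbit H) (Y n)),
    (outside (k (gbase H)) ->
       coval k b = coval (gmap_comp (h n) k) c *~ (-1) ^+ pos (k (gbase H))) /\
    (~ outside (k (gbase H)) -> coval k b = 0).
Proof.
pose P e (y : fin_simp Y n) := `[< outside y >] && (odd (pos y) == e).
have PJ e (y : fin_simp Y n) g : P e y -> P e (gset_act _ y g).
  case/andP=> /asboolP yo yp; rewrite /P posJ yp andbT.
  by apply/asboolP/outsideJ.
have PJN e (y : fin_simp Y n) g : ~~ P e y -> ~~ P e (gset_act _ y g).
  exact: (predJN (@PJ e)).
pose c1 := @cc_mor gT mu (fin_simp Y n) (fin_simp Y n.+1) (h n) (val c).
have [c_odd oddE] := cc_restrict (@PJ true) c1.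
have [c_even evenE] := cc_restrict (@PJ false) c1.
have PE H (k : gmap (gorbit H) (fin_simp Y n)) e :
    P e (k (gbase H)) -> forall t, P e (k t).
  by move=> Pk t; have [g ->] := gbaseP t; rewrite gmapJ; apply: PJ.
have PEN H (k : gmap (gorbit H) (fin_simp Y n)) e :
    ~~ P e (k (gbase H)) -> forall t, ~~ P e (k t).
  by move=> Pk t; have [g ->] := gbaseP t; rewrite gmapJ; apply: PJN.
pose b := c_even - c_odd.
have bE H (k : gmap (gorbit H) (Y n)) :
    (outside (k (gbase H)) ->
       @cc_mor gT mu (fin_orbit H) (fin_simp Y n) k b =
       coval (gmap_comp (h n) k) c *~ (-1) ^+ pos (k (gbase H))) /\
    (~ outside (k (gbase H)) ->
       @cc_mor gT mu (fin_orbit H) (fin_simp Y n) k b = 0).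
  have [oE oN] := oddE (fin_orbit H) k; have [eE eN] := evenE (fin_orbit H) k.
  split=> ko; rewrite raddfB.
    have ko' : `[< outside (k (gbase H)) >] by apply/asboolP.
    have := PE H k; have := PEN H k; rewrite /P ko' /= => kN kP.
    rewrite -signr_odd; case kp: (odd _) => /=; rewrite kp in kN kP.
      rewrite oE ?eN; [|exact: (kN false isT)|exact: (kP true isT)].
      by rewrite sub0r expr1 mulrNz mulr1z /c1 cc_morD.
    rewrite eE ?oN; [|exact: (kN true isT)|exact: (kP false isT)].
    by rewrite subr0 expr0 mulr1z /c1 cc_morD.
  have ko' : `[< outside (k (gbase H)) >] = false by apply/asboolP.
  by rewrite eN ?oN ?subrr // => t; apply: PEN; rewrite /P ko'.
suff bN : b \in @codegen_kernel (bredon_czmod mu Y) n.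
  by exists (SubZ bN).
clearbody b; clear -h_degen bE.
case: n b c bE => [|m] b c bE; rewrite unfold_in //=.
apply/forallP => i; apply/eqP; apply: cc_detect_orbits => H k.
rewrite /bredon_comor cc_morD.
have [bo bi] := bE H (gmap_comp (gspmor Y (codegen i)) k).
have [ko|/bi //] := pselect (outside (gspmor Y (codegen i) (k (gbase H)))).
rewrite bo //; have [i' [z' E]] := h_degen ko.
by rewrite (@coval_degen _ _ _ _ i' z') ?mul0rz.
Qed.

(** Applying the cocycle condition to the simplex after insertion expresses the
    value of c through the other faces; those commuting with the insertion add up
    to the coboundary of the homotopy, and the remaining ones have smaller rank. *)
Lemma coinsert_step n (c : C n) r : cobd C n c = 0 -> F n c = 0 ->
  vanishes r c -> exists b, F n.-1 b = 0 /\ vanishes r.+1 (c - cobd_into C n b).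
Proof.
move=> dc fc cr.
have cE H (k : gmap (gorbit H) (Y n)) (ko : outside (k (gbase H))) :
    coval k c = - (\sum_(j < n.+1)
      coval (gmap_comp (gspmor Y (coface n (bump (pos (k (gbase H))) j)))
        (gmap_comp (h n) k)) c *~
      (-1) ^+ (pos (k (gbase H)) + bump (pos (k (gbase H))) j)).
  set p := pos _; have pn : (p < n.+2)%N by apply: pos_le.
  have := coval_cobd (gmap_comp (h n) k) c; rewrite dc /coval !raddf0 -/(coval _ _).
  rewrite (bigD1_ord (Ordinal pn)) //= => /esym/eqP.
  rewrite addr_eq0 => /eqP /(congr1 (fun x => x *~ (-1) ^+ p)).
  rewrite -mulrzA -exprD sign_addnn mulr1z.
  rewrite -[cc_mor _ _ _]/(coval _ c) (@coval_eq _ _ _ k) /=; last exact: face_pos.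
  move=> ->; rewrite mulNrz mulrz_suml; congr (- _); apply: eq_bigr => j _.
  by rewrite -mulrzA -exprD addnC.
case: n c dc fc cr cE => [|n] c dc fc cr cE.
  exists 0; split=> [|H k klow]; first by rewrite raddf0.
  rewrite [cobd_into C _ _](_ : _ = 0) // subr0.
  have [ko|ko] := pselect (outside (k (gbase H))); last exact: coval_inside.
  rewrite cE // big_ord1 cr ?mul0rz ?oppr0 // => yo.
  exact: leq_trans (face_vertex ko yo) (klow ko).
have [b bE] := coinsert_ex c; exists b; split.
  by apply: restrict_detect => H k ko; have [_ ->] := bE H k.
move=> H k klow; rewrite covalB /= coval_cobd.
have [ko|ko] := pselect (outside (k (gbase H))); last first.
  rewrite coval_inside // sub0r big1 ?oppr0 // => i _.
  have [_ ->] := bE H (gmap_comp (gspmor Y (coface n i)) k); rewrite ?mul0rz //.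
  move=> o; apply: o; have [x xk] := contrapT ko.
  by exists (gspmor X (coface n i) x); rewrite /= -xk gspmapP.
rewrite cE // -opprD -big_split big1 ?oppr0 //= => j _.
set p := pos _; have jn := ltn_ord j; have kr := klow ko.
have [[yo E pE]|[low1 low2]] := face_other jn ko.
  have [-> // _] := bE H (gmap_comp (gspmor Y (coface n j)) k).
  rewrite [pos _]pE -/p.
  rewrite (@coval_eq _ _ (gmap_comp (h n) (gmap_comp (gspmor Y (coface n j)) k))
    (gmap_comp (gspmor Y (coface n.+1 (bump p j))) (gmap_comp (h n.+1) k)) c (esym E)).
  rewrite -mulrzA -exprD -mulrzDr (_ : _ + _ = 0) ?mulr0z //.
  rewrite /bump -/p; have [jp|pj] := ltnP j p.
    have -> : (p + (false + j) = (p - true + j).+1)%N by lia.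
    by rewrite exprS mulN1r addNr.
  have -> : (p + (true + j) = (p - false + j).+1)%N by lia.
  by rewrite exprS mulN1r addNr.
have c1 : coval (gmap_comp (gspmor Y (coface n.+1 (bump p j))) (gmap_comp (h n.+1) k)) c = 0.
  by apply: cr => o; exact: leq_trans (low1 o) kr.
have [bo bi] := bE H (gmap_comp (gspmor Y (coface n j)) k).
rewrite c1 mul0rz add0r.
have [o|o] := pselect (outside (gmap_comp (gspmor Y (coface n j)) k (gbase H))).
  rewrite (bo o) cr ?mul0rz // => o'; exact: leq_trans (low2 o') kr.
by rewrite (bi o) mul0rz.
Qed.

Lemma coinsert_iter n (c : C n) r : cobd C n c = 0 -> F n c = 0 ->
  exists b, F n.-1 b = 0 /\ vanishes r (c - cobd_into C n b).
Proof.
move=> dc fc; elim: r => [|r [b [fb br]]].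
  exists 0; split=> [|H k klow]; rewrite raddf0 // subr0.
  by apply: coval_inside => // o; have := klow o.
have [||b' [fb' br']] := coinsert_step _ _ br.
- by rewrite raddfB dc cobd_cobd_into subrr.
- by rewrite raddfB fc cobd_intoP fb raddf0 subrr.
exists (b + b'); split; first by rewrite raddfD fb fb' addr0.
by rewrite raddfD opprD addrA.
Qed.
End Cochains.

(** The rank of an n-simplex is at most n+1, so finitely many steps suffice. *)
Lemma insertion_contractible : contractible f.
Proof.
move=> mu n c dc fc; have [b [fb bn]] := coinsert_iter n.+2 dc fc.
exists b; split=> //; apply/eqP; rewrite -subr_eq0; apply/eqP.
apply: coval_detect => H k; apply: bn => _.
by rewrite ltnS; apply: rk_bound.
Qed.
End Insertion.

(** * Spaces induced from the Weyl group *)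

Section Isomorphisms.

Lemma additive_inv (U V : zmodType) (f : {additive U -> V}) : bijective f ->
  exists g : {additive V -> U}, cancel f g /\ cancel g f.
Proof.
case=> g fK gK.
have gB : zmod_morphism g.
  by move=> x y; apply: (can_inj fK); rewrite raddfB !gK.
pose gA := GRing.isZmodMorphism.Build V U g gB.
pose g' : {additive V -> U} := HB.pack g gA.
by exists g'.
Qed.

Lemma chain_iso (C C' : chain_complex) (f : chain_map C C') :
  (forall n, bijective (f n)) -> forall n, bijective (homology_map f n).
Proof.
move=> f_bij n; have fI m := (bij_inj_surj (f_bij m)).1.
have fS m := (bij_inj_surj (f_bij m)).2.
apply/hgroup_map_bij; split=> [v u' gv|v' gv'].
  have [u <-] := fS _ u'; rewrite -chain_funP => /fI ->; by exists u.
have [v fv] := fS _ v'; exists v, 0; rewrite raddf0 addr0 fv; split=> //.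
by apply: (fI n.-1); rewrite bd_fromP fv gv' raddf0.
Qed.

Lemma cochain_iso (C C' : cochain_complex) (f : cochain_map C C') :
  (forall n, bijective (f n)) -> forall n, bijective (cohomology_map f n).
Proof.
move=> f_bij n; have fI m := (bij_inj_surj (f_bij m)).1.
have fS m := (bij_inj_surj (f_bij m)).2.
apply/hgroup_map_bij; split=> [v u' gv|v' gv'].
  have [u <-] := fS _ u'; rewrite -cobd_intoP => /fI ->; by exists u.
have [v fv] := fS _ v'; exists v, 0; rewrite raddf0 addr0 fv; split=> //.
by apply: (fI n.+1); rewrite cochain_funP fv gv' raddf0.
Qed.

Lemma szmap_iso (M N : szmod) (f : szmap M N) : (forall n, bijective (f n)) ->
  forall n, bijective (homology_map (normalized_chain_map f) n).
Proof.
move=> f_bij; apply: chain_iso => n; apply: bij_of_inj_surj => [|y].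
  apply: raddf_inj => x; elim/quotW: x => x; rewrite /= quot_map_pi => /quot_eq0 fx.
  apply/quot_eq0; have [g [fK gK]] := additive_inv (f_bij n).
  rewrite -[x]fK; apply: zspan_map fx.
  case: n x g fK gK => [|n] x g fK gK y //= [j [z ->]].
  have [g' g'K gK'] := f_bij n; rewrite -[z]gK' -szmapP fK.
  by apply: mem_zspan; exists j, (g' z).
elim/quotW: y => y; have [g fK gK] := f_bij n.
by exists (\pi_(normalized M n) (g y))%qT; rewrite /= quot_map_pi gK.
Qed.

Lemma czmap_iso (M N : czmod) (f : czmap M N) : (forall n, bijective (f n)) ->
  forall n, bijective (cohomology_map (normalized_cochain_map f) n).
Proof.
move=> f_bij; apply: cochain_iso => n; apply: bij_of_inj_surj => [x y|y].
  move=> /(congr1 val) /= /(bij_inj (f_bij n)) xy; exact: val_inj.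
have [x xy] := (bij_inj_surj (f_bij n)).2 (val y).
suff xN : x \in @codegen_kernel M n by exists (SubZ xN); apply: val_inj.
case: n x y xy => [|n] x y xy; rewrite unfold_in //=.
apply/forallP => j; apply/eqP/(bij_inj (f_bij n)).
rewrite czmapP xy raddf0; apply/eqP.
by have := valP y; rewrite unfold_in => /forallP /(_ j).
Qed.
End Isomorphisms.

Section QuotLift.
Variables (V U : zmodType) (S : zmodClosed V).

(** The vanishing hypothesis is what makes the function well defined on classes,
    hence additive. *)
Definition quot_lift (f : {additive V -> U}) (fS : forall x, x \in S -> f x = 0)
  (x : {ideal_quot S}) : U := f (repr x).

Variables (f : {additive V -> U}) (fS : forall x, x \in S -> f x = 0).

Lemma quot_lift_pi x : quot_lift fS (\pi_({ideal_quot S}) x)%qT = f x.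
Proof.
apply/eqP; rewrite -subr_eq0 -raddfB; apply/eqP/fS.
by rewrite Quotient.idealrBE reprK.
Qed.
Lemma quot_lift_additive : zmod_morphism (quot_lift fS).
Proof.
move=> x y; rewrite -[x]reprK -[y]reprK -raddfB !quot_lift_pi.
by rewrite raddfB.
Qed.
HB.instance Definition _ :=
  GRing.isZmodMorphism.Build {ideal_quot S} U (quot_lift fS) quot_lift_additive.
End QuotLift.

Section Weyl.
Variables (gT : finGroupType) (D : {group gT}).
Let W : finGroupType := coset_of D.

(** T is the G-set induced from the W-set S: each s in S gives an embedding k s of
    G/D, whose base point has stabilizer D, and the orbits of these points cover
    T. *)
Section OneDimension.
Variables (S : gset W) (T : fingset gT).
Variable k : S -> gmap (gorbit D) T.
Hypothesis k_inj : forall s, injective (k s).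
Hypothesis base_inj : forall s s', k s (gbase D) = k s' (gbase D) -> s = s'.
Hypothesis k_cover : forall t, exists s g, t = gset_act T (k s (gbase D)) g.
Hypothesis k_weyl : forall s w, k (gset_act S s w) =1 gmap_comp (k s) (weyl_map w).

(** An element of G carrying a point with stabilizer D to another such point
    normalizes D. *)
Lemma same_orbit s s' g : gset_act T (k s (gbase D)) g = k s' (gbase D) ->
  exists w, s' = gset_act S s w.
Proof.
move=> sg.
have kfix s0 x : gset_act T (k s0 (gbase D)) x = k s0 (gbase D) -> x \in D.
  rewrite -gmapJ => /k_inj /(congr1 val) /= Dx.
  by have := rcoset_refl D x; rewrite Dx.
have Ng : g \in 'N(D)%g.
  rewrite inE; apply/fintype.subsetP => _ /imsetP[d Dd ->].
  apply: (kfix s'); rewrite -sg -!gset_actM conjgE !mulgA mulgV mul1g gset_actM.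
  by rewrite gorbit_map_fix.
exists (coset D g); apply: base_inj.
rewrite k_weyl -sg -gmapJ /=; congr (k s _); apply: val_inj => /=.
by rewrite val_coset // (norm_rlcoset Ng) -mulgA mulGid.
Qed.

Lemma finite_orbits : exists r : seq S, forall s, exists2 x, x \in r &
  exists w, s = gset_act S x w.
Proof.
have /finite_seqP[r rE] := fingset_fin T.
have [h hE] := choice k_cover.
exists (map h r) => s; exists (h (k s (gbase D))).
  by apply: map_f; have : [set` r]%classic (k s (gbase D)) by rewrite -rE.
by have [g E] := hE (k s (gbase D)); apply: (@same_orbit _ _ g).
Qed.

Lemma finite_enum : exists2 r : seq S, uniq r & forall s, s \in r.
Proof.
have [r rE] := finite_orbits.
exists (undup (flatten [seq [seq gset_act S x w | w <- enum [set: W]] | x <- r])).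
  exact: undup_uniq.
move=> s; rewrite mem_undup; have [x xr [w ->]] := rE s.
by apply/allpairsP; exists (x, w); rewrite mem_enum inE.
Qed.

Section Cohomological.
Variable mu : ccoef gT.
Let A := cweyl D mu.

Definition weyl_eval_fun (c : mu T) (s : S) : A :=
  @cc_mor gT mu (fin_orbit D) T (k s) c.
Lemma weyl_eval_subproof c : weyl_eval_fun c \in @equivariant W A S.
Proof.
apply/asboolP => s w; rewrite /weyl_eval_fun /= /cweyl_act invgK.
by rewrite -(@cc_comp gT mu (fin_orbit D) (fin_orbit D) T); apply: cc_mor_eq.
Qed.
Definition weyl_eval c : Defs.hom A S := SubZ (weyl_eval_subproof c).
Lemma weyl_eval_additive : zmod_morphism weyl_eval.
Proof.
move=> c c'; apply: val_inj; apply: funext => s /=.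
by rewrite /weyl_eval_fun raddfB.
Qed.
HB.instance Definition _ :=
  GRing.isZmodMorphism.Build (mu T) (Defs.hom A S) weyl_eval weyl_eval_additive.

Lemma weyl_eval_inj : injective weyl_eval.
Proof.
apply: raddf_inj => c /(congr1 val) /= c0; apply: cc_detect => t.
have [s [g tE]] := k_cover t.
exists (fin_orbit D), (k s), (gset_act (gorbit D) (gbase D) g).
split; first by rewrite gmapJ tE.
  by move=> x; rewrite tE -!gmapJ => /k_inj.
exact: (congr1 (@^~ s) c0).
Qed.

(** Orbits of S are treated one at a time, by extension by zero from G/D. *)
Lemma weyl_eval_surj (u : Defs.hom A S) : exists c, weyl_eval c = u.
Proof.
pose orb (x s : S) := [exists w, s == gset_act S x w].
have /asboolP uJ := valP u.
suff main r : exists c : mu T, forall s,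
    weyl_eval_fun c s = if has (orb^~ s) r then val u s else 0.
  have [r rE] := finite_orbits; have [c cE] := main r; exists c.
  apply: val_inj; apply: funext => s; rewrite /= cE ifT //.
  have [x xr [w ->]] := rE s; apply/hasP; exists x => //.
  by apply/existsP; exists w.
elim: r => [|x r [c cE]]; first by exists 0 => s; rewrite /weyl_eval_fun raddf0.
have [xr|xr] := boolP (has (orb^~ x) r).
  exists c => s; rewrite cE /=; case: (boolP (orb x s)) => //= /existsP[w /eqP ->].
  rewrite ifT //; case/hasP: xr => y yr /existsP[v /eqP ->]; apply/hasP.
  by exists y => //; apply/existsP; exists (v * w)%g; rewrite gset_actM.
have [c' [c'E c'0]] := @cc_extend gT mu (fin_orbit D) T (k x) (val u x) (@k_inj x).
exists (c' + c) => s; rewrite [LHS](raddfD (@cc_mor gT mu (fin_orbit D) T (k s))) /=.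
rewrite -/(weyl_eval_fun c s) cE.
have [/existsP[w /eqP sE]|xs] := boolP (orb x s) => /=.
  rewrite ifN ?addr0; last first.
    apply: contraNN xr => /hasP[y yr /existsP[v /eqP yE]]; apply/hasP.
    exists y => //; apply/existsP; exists (v * w^-1)%g.
    by rewrite gset_actM -yE sE gset_actK.
  rewrite sE uJ -c'E /= /cweyl_act invgK.
  by rewrite -(@cc_comp gT mu (fin_orbit D) (fin_orbit D) T); apply: cc_mor_eq.
rewrite c'0 ?add0r // => t t' E; case/negP: xs; apply/existsP.
have [g tE] := gbaseP t; have [g' tE'] := gbaseP t'.
(* Outside the orbit of x, the extension by zero vanishes. *)
have [|w ->] := @same_orbit x s (g' * g^-1)%g; last by exists w.
by rewrite gset_actM -gmapJ -tE' -E tE gmapJ gset_actK.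
Qed.

Lemma weyl_eval_bij : bijective weyl_eval.
Proof. exact: bij_of_inj_surj weyl_eval_inj weyl_eval_surj. Qed.
End Cohomological.

Section Homological.
Variable mu : hcoef gT.
Let A := hweyl D mu.

(** Surjectivity follows from the injectivity of [weyl_eval] for Hom(mu, B), with
    B the cokernel.  Injectivity follows from its surjectivity for B the tensor
    product: the tautological equivariant function s |-> (a |-> a (x) s) is the
    evaluation of some element of Hom(mu(T), B), which is a left inverse. *)
Lemma tensor_weyl : exists Psi : {additive tensor A S -> mu T},
  (forall a s, Psi (\pi_(tensor A S) (formal1 a s))%qT =
     @hc_mor gT mu (fin_orbit D) T (k s) a) /\ bijective Psi.
Proof.
have [r r_uniq rE] := finite_enum.
pose F (u : formal_sum A S) : mu T :=
  \sum_(s <- r) @hc_mor gT mu (fin_orbit D) T (k s) (val u s).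
have FB : zmod_morphism F.
  by move=> u v; rewrite /F -sumrB; apply: eq_bigr => s _; rewrite -raddfB.
pose FA := GRing.isZmodMorphism.Build (formal_sum A S) (mu T) F FB.
pose F' : {additive formal_sum A S -> mu T} := HB.pack F FA.
have F1 a s : F' (formal1 a s) = @hc_mor gT mu (fin_orbit D) T (k s) a.
  rewrite /= /F (bigD1_seq s) //= eqxx big1 ?addr0 // => s' /negPf ->.
  by rewrite raddf0.
have FS u : u \in zspan (@balanced W A S) -> F' u = 0.
  move=> uS; apply/eqP; rewrite -[_ == 0]/(u \in kerp F').
  apply: zspan_min uS => v [a [s [w ->]]]; rewrite inE raddfB !F1 subr_eq0.
  rewrite -(@hc_comp gT mu (fin_orbit D) (fin_orbit D) T); apply/eqP.
  by apply: hc_mor_eq; apply: k_weyl.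
pose Psi : {additive tensor A S -> mu T} := quot_lift FS.
have PsiE a s : Psi (\pi_(tensor A S) (formal1 a s))%qT =
    @hc_mor gT mu (fin_orbit D) T (k s) a by rewrite -F1; apply: quot_lift_pi.
exists Psi; split=> //; apply: bij_of_inj_surj; last first.
  pose I := imsum Psi Psi.
  pose q := (\pi_({ideal_quot I}))%qT : {additive mu T -> {ideal_quot I}}.
  have q0 : dual_of q = 0.
    apply: (@weyl_eval_inj (dual_coef mu {ideal_quot I})).
    apply: val_inj; apply: funext => s; apply: dual_eq => a.
    rewrite -[LHS]/(q (@hc_mor gT mu (fin_orbit D) T (k s) a)) -PsiE.
    exact/quot_eq0/imsum_l.
  move=> t; have /asboolP[x [y ->]] : t \in I.
    by apply/quot_eq0; rewrite -[LHS]/(dual_fun (dual_of q) t) q0.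
  by exists (x + y); rewrite raddfD.
apply: raddf_inj => x.
pose B := tensor A S.
have u_add s : zmod_morphism (fun a : A => (\pi_B (formal1 a s))%qT).
  move=> a b; rewrite -raddfB; congr (\pi _)%qT; apply: val_inj.
  apply: funext => s' /=.
  rewrite -[RHS]/((if s' == s then a else 0) - (if s' == s then b else 0)).
  by case: eqP; rewrite ?subr0.
pose u s : dual A B := dual_mk (u_add s).
have uJ : u \in @equivariant W (cweyl D (dual_coef mu B)) S.
  apply/asboolP => s w; apply: dual_eq => a /=.
  rewrite -[LHS]/(\pi_B (formal1 a (gset_act S s w)))%qT.
  rewrite -[RHS]/(\pi_B (formal1 (wact A w^-1^-1%g a) s))%qT invgK.
  apply/quot_eqP; apply: mem_zspan; exists a, s, w.
  by [].
(* c is the left inverse of Psi. *)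
have [c cE] := @weyl_eval_surj (dual_coef mu B) (SubZ uJ).
have cS s a : dual_fun c (@hc_mor gT mu (fin_orbit D) T (k s) a) =
    (\pi_B (formal1 a s))%qT.
  have /(congr1 (fun f => dual_fun (f s) a)) := congr1 val cE.
  exact.
elim/quotW: x => x Px.
have xE : x = \sum_(s <- r) formal1 (val x s) s :> formal_sum A S.
  apply: val_inj; rewrite raddf_sum; apply: funext => s; rewrite fct_sumE.
  by rewrite (bigD1_seq s) //= eqxx big1 ?addr0 // => s' /negPf; rewrite eq_sym => ->.
rewrite xE raddf_sum (eq_bigr (fun s => dual_fun c
  (@hc_mor gT mu (fin_orbit D) T (k s) (val x s)))); last first.
  by move=> s _; rewrite cS.
rewrite -raddf_sum (_ : \sum_(s <- r) _ = 0) ?raddf0 //.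
exact: etrans (esym (quot_lift_pi FS x)) Px.
Qed.

End Homological.

End OneDimension.

Lemma tensor_gen (W0 : finGroupType) (A : wmod W0) (S : gset W0) (U : zmodType)
    (f g : {additive tensor A S -> U}) :
  (forall a s, f (\pi_(tensor A S) (formal1 a s))%qT =
     g (\pi_(tensor A S) (formal1 a s))%qT) -> f =1 g.
Proof.
move=> fg x; elim/quotW: x => x; have [r r_uniq xr] := formal_supp x.
have xE : x = \sum_(s <- r) formal1 (val x s) s :> formal_sum A S.
  apply: val_inj; rewrite raddf_sum; apply: funext => s; rewrite fct_sumE.
  have [sr|sr] := boolP (s \in r).
    by rewrite (bigD1_seq s) //= eqxx big1 ?addr0 // => s' /negPf; rewrite eq_sym => ->.
  rewrite big_seq big1 => [|s' s'r]; first by apply/eqP; apply: contraNT sr => /xr.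
  by rewrite /=; case: eqP => // ss'; rewrite ss' s'r in sr.
by rewrite xE !raddf_sum; apply: eq_bigr => s _; apply: fg.
Qed.

(** The G-space Z is induced from the W-space E; simplices of E are recorded as
    embeddings of G/D, as in the one-dimensional case. *)
Record induced (E : gspace W) (Z : fingspace gT) := Induced {
  ind_map :> forall n, E n -> gmap (gorbit D) (Z n);
  ind_inj : forall n s, injective (@ind_map n s);
  ind_base : forall n s s', @ind_map n s (gbase D) = @ind_map n s' (gbase D) ->
    s = s';
  ind_cover : forall n t, exists s g,
    t = gset_act (Z n) (@ind_map n s (gbase D)) g;
  ind_weyl : forall n s w,
    @ind_map n (gset_act (E n) s w) =1 gmap_comp (@ind_map n s) (weyl_map w);
  ind_nat : forall m n (f : mono m n) s,
    gmap_comp (gspmor Z f) (@ind_map n s) =1 @ind_map m (gspmor E f s) }.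

Section Comparison.
Variables (E E' : gspace W) (Z Z' : fingspace gT).
Variables (k : induced E Z) (k' : induced E' Z').
Variables (g : gspmap E E') (f : gspmap Z Z').
Hypothesis fg : forall n s, gmap_comp (f n) (k n s) =1 k' n (g n s).

Lemma twisted_cohomology_compare (mu : ccoef gT) :
  (forall n, bijective (bredon_cohomology_map mu f n)) <->
  (forall n, bijective (twisted_cohomology_map (cweyl D mu) g n)).
Proof.
have mk (E0 : gspace W) (Z0 : fingspace gT) (k0 : induced E0 Z0) :
    exists P : czmap (bredon_czmod mu Z0) (twisted_czmod (cweyl D mu) E0),
    (forall n c s, val (P n c) s =
       @cc_mor gT mu (fin_orbit D) (fin_simp Z0 n) (k0 n s) c) /\
    forall n, bijective (P n).
  pose P n : {additive bredon_czmod mu Z0 n -> twisted_czmod (cweyl D mu) E0 n} :=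
    @weyl_eval (E0 n) (fin_simp Z0 n) (k0 n) (@ind_weyl _ _ k0 n) mu.
  have PP m n (h : mono m n) x : P n (czmor (bredon_czmod mu Z0) h x) =
      czmor (twisted_czmod (cweyl D mu) E0) h (P m x).
    apply: val_inj; apply: funext => s.
    rewrite /= /weyl_eval_fun /= /bredon_comor cc_morD.
    by apply: cc_mor_eq; apply: ind_nat.
  exists (CZMap PP); split=> // n.
  apply: weyl_eval_bij; [exact: ind_inj | exact: ind_base | exact: ind_cover].
have [P [PE P_bij]] := mk E Z k; have [P' [P'E P'_bij]] := mk E' Z' k'.
have cmp n c : P n (@bredon_cofun gT mu Z Z' f n c) =
    twisted_czmap (cweyl D mu) g n (P' n c).
  apply: val_inj; apply: funext => s; rewrite PE /= /pull /= P'E.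
  by rewrite /bredon_cofun cc_morD; apply: cc_mor_eq; apply: fg.
have E1 n : cohomology_map (normalized_cochain_map P) n
   \o bredon_cohomology_map mu f n =1
   twisted_cohomology_map (cweyl D mu) g n \o
   cohomology_map (normalized_cochain_map P') n.
  move=> x; have [v [gv ->]] := hclassP x.
  rewrite /= /bredon_cohomology_map /twisted_cohomology_map /cohomology_map !hclass_map.
  apply/hclass_eq; exists 0; rewrite raddf0; apply/eqP; rewrite subr_eq0.
  by apply/eqP; apply: val_inj => /=; rewrite cmp.
have Pi n := czmap_iso P_bij n; have P'i n := czmap_iso P'_bij n.
have A1 n := bij_comp_r (fun x => erefl _) (Pi n) (f := bredon_cohomology_map mu f n).
have A2 n := bij_comp_l (fun x => erefl _) (P'i n) (g := twisted_cohomology_map (cweyl D mu) g n).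
split=> H n.
  by apply/A2; apply: eq_bij (E1 n); apply/A1.
by apply/A1; apply: eq_bij (fsym (E1 n)); apply/A2.
Qed.

Lemma twisted_homology_compare (mu : hcoef gT) :
  (forall n, bijective (bredon_homology_map mu f n)) <->
  (forall n, bijective (twisted_homology_map (hweyl D mu) g n)).
Proof.
have mk (E0 : gspace W) (Z0 : fingspace gT) (k0 : induced E0 Z0) :
    exists P : szmap (twisted_szmod (hweyl D mu) E0) (bredon_szmod mu Z0),
    (forall n a s, P n (\pi_(tensor (hweyl D mu) (E0 n)) (formal1 a s))%qT =
       @hc_mor gT mu (fin_orbit D) (fin_simp Z0 n) (k0 n s) a) /\
    forall n, bijective (P n).
  have ex n := cid (@tensor_weyl (E0 n) (fin_simp Z0 n) (k0 n)
    (@ind_inj _ _ k0 n) (@ind_base _ _ k0 n) (@ind_cover _ _ k0 n)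
    (@ind_weyl _ _ k0 n) mu).
  pose P n : {additive twisted_szmod (hweyl D mu) E0 n -> bredon_szmod mu Z0 n} :=
    projT1 (ex n).
  have PE n a s : P n (\pi_(tensor (hweyl D mu) (E0 n)) (formal1 a s))%qT =
       @hc_mor gT mu (fin_orbit D) (fin_simp Z0 n) (k0 n s) a.
    exact: (projT2 (ex n)).1.
  have PP m n (h : mono m n) x : P m (szmor (twisted_szmod (hweyl D mu) E0) h x) =
      szmor (bredon_szmod mu Z0) h (P n x).
    pose l := szmor (twisted_szmod (hweyl D mu) E0) h.
    pose r := szmor (bredon_szmod mu Z0) h.
    apply: (@tensor_gen W _ _ _ (P m \o l) (r \o P n)) => a s.
    rewrite /= PE quot_map_pi /= push_formal1 PE /bredon_mor -hc_comp.
    by apply: hc_mor_eq => t; rewrite -ind_nat.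
  exists (SZMap PP); split=> // n; exact: (projT2 (ex n)).2.
have [P [PE P_bij]] := mk E Z k; have [P' [P'E P'_bij]] := mk E' Z' k'.
have cmp n c : bredon_fun mu f n (P n c) =
    P' n (twisted_szmap (hweyl D mu) g n c).
  apply: (@tensor_gen W _ _ _ (bredon_fun mu f n \o P n)
    (P' n \o twisted_szmap (hweyl D mu) g n)) => a s.
  rewrite /= PE quot_map_pi /= push_formal1 P'E /bredon_fun -hc_comp.
  by apply: hc_mor_eq => t; rewrite -fg.
have E1 n : bredon_homology_map mu f n \o
     homology_map (normalized_chain_map P) n =1
   homology_map (normalized_chain_map P') n \o
   twisted_homology_map (hweyl D mu) g n.
  move=> x; have [v [gv ->]] := hclassP x.
  rewrite /= /bredon_homology_map /twisted_homology_map /homology_map !hclass_map.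
  apply/hclass_eq; exists 0; rewrite raddf0; apply/eqP; rewrite subr_eq0.
  apply/eqP; elim/quotW: v {gv} => v.
  rewrite /= !quot_map_pi; congr (\pi _)%qT; exact: cmp.
have Pi n := szmap_iso P_bij n; have P'i n := szmap_iso P'_bij n.
have A1 n := bij_comp_l (fun x => erefl _) (Pi n) (g := bredon_homology_map mu f n).
have A2 n := bij_comp_r (fun x => erefl _) (P'i n) (f := twisted_homology_map (hweyl D mu) g n).
split=> H n.
  by apply/A2; apply: eq_bij (E1 n); apply/A1.
by apply/A1; apply: eq_bij (fsym (E1 n)); apply/A2.
Qed.
End Comparison.
End Weyl.

(** * Spaces of sequences in a finite G-set *)

Section SequenceSpaces.
Variables (gT : finGroupType) (Q : finType) (to : Q -> gT -> Q).
Hypotheses (to1 : forall q, to q 1%g = q).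
Hypothesis (toM : forall q g h, to q (g * h)%g = to (to q g) h).

Section Simplices.
Variable n : nat.
Definition sq_act (x : {ffun 'I_n.+1 -> Q}) g := [ffun i => to (x i) g].
Lemma sq_act1 : sq_act^~ 1%g =1 id.
Proof. by move=> x; apply/ffunP => i; rewrite ffunE to1. Qed.
Lemma sq_actM x : act_morph sq_act x.
Proof. by move=> g h; apply/ffunP => i; rewrite !ffunE toM. Qed.
Definition sq_gset : gset gT := GSet (TotalAction sq_act1 sq_actM).
End Simplices.

Definition sq_pull m n (f : mono m n) (x : {ffun 'I_n.+1 -> Q}) :
  {ffun 'I_m.+1 -> Q} := [ffun i => x (f i)].

Lemma sq_pull_act m n (f : mono m n) x g :
  sq_pull f (sq_act x g) = sq_act (sq_pull f x) g.
Proof. by apply/ffunP => i; rewrite !ffunE. Qed.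

(** A family of sequences stable under G and under all simplicial operators.  This
    is more general than the nerve of a relation, as unions of nerves are
    needed. *)
Record sqpred := SqPred {
  sq_mem :> forall n, pred {ffun 'I_n.+1 -> Q};
  sq_memJ : forall n x g, @sq_mem n x -> @sq_mem n (sq_act x g);
  sq_mem_pull : forall m n (f : mono m n) x, @sq_mem n x -> @sq_mem m (sq_pull f x) }.

Section Space.
Variable K : sqpred.
Definition sq_simp n : gset gT := @gsub gT (sq_gset n) (K n) (@sq_memJ K n).
Definition sq_mor_fun m n (f : mono m n) (x : sq_simp n) : sq_simp m :=
  exist _ (sq_pull f (val x)) (sq_mem_pull f (valP x)).
Lemma sq_morJ m n (f : mono m n) x g :
  sq_mor_fun f (gset_act _ x g) = gset_act _ (sq_mor_fun f x) g.
Proof. by apply: val_inj; apply: sq_pull_act. Qed.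
Lemma sq_mor_id n x : GMap (sq_morJ (mono_id n)) x = x.
Proof. by apply: val_inj; apply/ffunP => i; rewrite ffunE. Qed.
Lemma sq_mor_comp l m n (f : mono m n) (h : mono l m) x :
  GMap (sq_morJ (mono_comp f h)) x = GMap (sq_morJ h) (GMap (sq_morJ f) x).
Proof. by apply: val_inj; apply/ffunP => i; rewrite !ffunE. Qed.
Definition sq_space : gspace gT := GSpace sq_mor_id sq_mor_comp.
Lemma sq_space_fin n : finite_set [set: sq_space n]%classic.
Proof. by apply: (inj_finite val_inj); apply: finite_finset. Qed.
Definition sq : fingspace gT := FinGSpace sq_space_fin.
End Space.

Section Map.
Variables (K K' : sqpred) (phi : Q -> Q).
Hypothesis phiJ : forall q g, phi (to q g) = to (phi q) g.
Hypothesis phiK : forall n x, K n x -> K' n [ffun i => phi (x i)].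
Definition sq_map_fun n (x : sq K n) : sq K' n :=
  exist _ [ffun i => phi (val x i)] (phiK (valP x)).
Lemma sq_map_funJ n x g :
  @sq_map_fun n (gset_act _ x g) = gset_act _ (sq_map_fun x) g.
Proof. by apply: val_inj; apply/ffunP => i; rewrite !ffunE. Qed.
Lemma sq_mapP m n (f : mono m n) x :
  GMap (@sq_map_funJ m) (gspmor (sq K) f x) =
  gspmor (sq K') f (GMap (@sq_map_funJ n) x).
Proof. by apply: val_inj; apply/ffunP => i; rewrite !ffunE. Qed.
Definition sq_map : gspmap (sq K) (sq K') := GSpMap sq_mapP.
End Map.

Section Incl.
Variables (K K' : sqpred) (KK' : forall n x, K n x -> K' n x).
Definition sq_incl_fun n (x : sq K n) : sq K' n := exist _ (val x) (KK' (valP x)).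
Lemma sq_incl_funJ n x g :
  @sq_incl_fun n (gset_act _ x g) = gset_act _ (sq_incl_fun x) g.
Proof. exact: val_inj. Qed.
Lemma sq_inclP m n (f : mono m n) x :
  GMap (@sq_incl_funJ m) (gspmor (sq K) f x) =
  gspmor (sq K') f (GMap (@sq_incl_funJ n) x).
Proof. exact: val_inj. Qed.
Definition sq_incl : gspmap (sq K) (sq K') := GSpMap sq_inclP.
Lemma sq_incl_inj n : injective (sq_incl n).
Proof. by move=> x y /(congr1 val) xy; apply: val_inj. Qed.
Lemma sq_incl_outside n (y : sq K' n) : outside sq_incl y <-> ~~ K n (val y).
Proof.
split=> [yo|yK [x xy]].
  by apply: contra_notN yo => yK; exists (exist _ (val y) yK); apply: val_inj.
by case/negP: yK; rewrite -xy; apply: (valP x).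
Qed.
End Incl.

Section FirstPosition.
Variable a : pred Q.
(** The default value n+1 makes an insertion at this position go to the end when no
    vertex satisfies a. *)
Definition fpos n (x : {ffun 'I_n.+1 -> Q}) : nat :=
  find (fun i => a (x i)) (enum 'I_n.+1).

Lemma fpos_le n (x : {ffun 'I_n.+1 -> Q}) : (fpos x <= n.+1)%N.
Proof. by rewrite /fpos -[X in (_ <= X)%N](size_enum_ord n.+1) find_size. Qed.
Lemma fpos_before n (x : {ffun 'I_n.+1 -> Q}) (i : 'I_n.+1) :
  (i < fpos x)%N -> ~~ a (x i).
Proof. by move/(before_find ord0); rewrite nth_ord_enum => ->. Qed.
Lemma fpos_at n (x : {ffun 'I_n.+1 -> Q}) (i : 'I_n.+1) :
  i = fpos x :> nat -> a (x i).
Proof.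
move=> iE; have := @nth_find _ ord0 (fun i => a (x i)) (enum 'I_n.+1).
rewrite has_find size_enum_ord -[find _ _]/(fpos x) -iE ltn_ord nth_ord_enum.
exact.
Qed.
Lemma fposE n (x : {ffun 'I_n.+1 -> Q}) p : (p <= n.+1)%N ->
  (forall i : 'I_n.+1, (i < p)%N -> ~~ a (x i)) ->
  (forall i : 'I_n.+1, i = p :> nat -> a (x i)) -> fpos x = p.
Proof.
move=> pn pb pa; have := fpos_le x => fn.
have [lt|lt|//] := ltngtP (fpos x) p.
  have fn' : (fpos x < n.+1)%N by lia.
  by have := pb (Ordinal fn') lt; rewrite (@fpos_at _ x).
have pn' : (p < n.+1)%N by lia.
by have := @fpos_before _ x (Ordinal pn') lt; rewrite pa.
Qed.
End FirstPosition.

(** The unlift of i at p is the index of the vertex of x placed at i, except at p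
    itself, which receives q. *)
Definition ins n p q (x : {ffun 'I_n.+1 -> Q}) : {ffun 'I_n.+2 -> Q} :=
  [ffun i => oapp x q (unlift (inord p) i)].

Lemma ins_at n p q (x : {ffun 'I_n.+1 -> Q}) (i : 'I_n.+2) :
  i = p :> nat -> ins p q x i = q.
Proof.
move=> ip; rewrite ffunE (_ : i = inord p) ?unlift_none //.
by apply: val_inj; rewrite /= inordK -?ip.
Qed.
Lemma ins_other n p q (x : {ffun 'I_n.+1 -> Q}) (i : 'I_n.+2) (j : 'I_n.+1) :
  (p < n.+2)%N -> i = bump p j :> nat -> ins p q x i = x j.
Proof.
move=> pn ip; rewrite ffunE (_ : i = lift (inord p) j) ?liftK //.
by apply: val_inj; rewrite /= inordK.
Qed.

Lemma sq_pullE m n (f : mono m n) x i : sq_pull f x i = x (f i).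
Proof. by rewrite ffunE. Qed.

Definition count_in (T : pred Q) n (x : {ffun 'I_n.+1 -> Q}) : nat :=
  (\sum_(i < n.+1) T (x i))%N.

Lemma count_in_le (T : pred Q) n (x : {ffun 'I_n.+1 -> Q}) : (count_in T x <= n.+1)%N.
Proof.
rewrite /count_in -[X in (_ <= X)%N]card_ord -sum1_card.
by apply: leq_sum => i _; apply: leq_b1.
Qed.

Lemma count_in_face (T : pred Q) n (x : {ffun 'I_n.+2 -> Q}) (j : 'I_n.+2) :
  (T (x j) + count_in T (sq_pull (coface n j) x) = count_in T x)%N.
Proof.
rewrite /count_in [RHS](bigD1_ord j) //=; congr (_ + _)%N.
apply: eq_bigr => i _; rewrite ffunE; congr (nat_of_bool (T (x _))).
exact: val_inj.
Qed.

Lemma count_in_ins (T : pred Q) n p q (x : {ffun 'I_n.+1 -> Q}) : (p < n.+2)%N ->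
  (count_in T (ins p q x) = T q + count_in T x)%N.
Proof.
move=> pn; rewrite /count_in (bigD1_ord (Ordinal pn)) //= ins_at //.
congr (_ + _)%N; apply: eq_bigr => i _; congr (nat_of_bool (T _)).
exact: ins_other.
Qed.

(** The elements of T are the pivots, and the rank of a sequence is its number of
    pivots.  The inserted vertex e x is no pivot, and the deletion of a vertex which is
    no pivot does not affect it; it goes in front of the first vertex satisfying
    a. *)
Section Insert.
Variables (K K' : sqpred) (K'K : forall n x, K' n x -> K n x).
Variables (T a : pred Q) (e : forall n, {ffun 'I_n.+1 -> Q} -> Q).
Let new n (x : {ffun 'I_n.+1 -> Q}) := K n x && ~~ K' n x.

Hypothesis aJ : forall q g, a (to q g) = a q.
Hypothesis eJ : forall n x g, new x -> @e n (sq_act x g) = to (e x) g.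
Hypothesis ins_mem : forall n x, new x -> K n.+1 (ins (fpos a x) (@e n x) x).
Hypothesis e_old : forall n x, new x -> ~~ T (@e n x).
Hypothesis face_new : forall n (x : {ffun 'I_n.+2 -> Q}) (j : 'I_n.+2),
  new x -> ~~ T (x j) ->
  ~~ K' n (sq_pull (coface n j) x) /\ e (sq_pull (coface n j) x) = e x.
Hypothesis a_up : forall n (x : {ffun 'I_n.+1 -> Q}) (i j : 'I_n.+1),
  new x -> (i < j)%N -> a (x i) -> ~~ T (x i) -> a (x j).
Hypothesis pivot : forall n x, K n x -> (forall i, ~~ T (x i)) -> K' n x.

Let K'J n x g : K' n (sq_act x g) = K' n x.
Proof.
apply/idP/idP; last exact: sq_memJ.
by move/(sq_memJ g^-1%g); rewrite -sq_actM mulgV sq_act1.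
Qed.

Let fposJ n x g : fpos a (@sq_act n x g) = fpos a x.
Proof. by apply: eq_find => i; rewrite ffunE aJ. Qed.

Let insJ n p q x g : ins p (to q g) (@sq_act n x g) = sq_act (ins p q x) g.
Proof.
apply/ffunP => i; rewrite !ffunE.
by case: (unlift _ i) => [j|] //=; rewrite ffunE.
Qed.

(** On the subspace, where nothing has to be inserted, any natural simplex of the
    right dimension does. *)
Definition insert_raw n (x : {ffun 'I_n.+1 -> Q}) : {ffun 'I_n.+2 -> Q} :=
  if K' n x then sq_pull (codegen ord0) x else ins (fpos a x) (e x) x.

Lemma insert_subproof n (x : sq K n) : K n.+1 (insert_raw (val x)).
Proof.
rewrite /insert_raw; case: ifPn => xK'; first exact/sq_mem_pull/(valP x).
by apply: ins_mem; rewrite /new xK' (valP x : K n _).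
Qed.
Definition insert_fun n (x : sq K n) : sq K n.+1 := 
  exist _ (insert_raw (val x)) (insert_subproof x).
Lemma insert_funJ n x g :
  @insert_fun n (gset_act _ x g) = gset_act _ (insert_fun x) g.
Proof.
apply: val_inj; rewrite /= /insert_raw K'J; case: ifPn => xK'.
  exact: sq_pull_act.
by rewrite fposJ eJ ?insJ // /new xK' (valP x : K n _).
Qed.
Definition insert n : gmap (sq K n) (sq K n.+1) := GMap (@insert_funJ n).

Let fpos_lt n (x : {ffun 'I_n.+1 -> Q}) : (fpos a x < n.+2)%N.
Proof. by rewrite ltnS fpos_le. Qed.

Lemma ins_contractible : contractible (sq_incl K'K).
Proof.
have newP n (y : sq K n) : outside (sq_incl K'K) y -> new (val y).
  by move/sq_incl_outside => yK'; rewrite /new yK' (valP y : K n _).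
have insE n (y : sq K n) : outside (sq_incl K'K) y ->
    val (insert n y) = ins (fpos a (val y)) (e (val y)) (val y).
  by move/sq_incl_outside/negPf => yK'; rewrite /= /insert_raw yK'.
have vpos n (y : sq K n) : (fpos a (val y) < n.+2)%N by exact: fpos_lt.
apply: (@insertion_contractible _ _ _ (sq_incl K'K) (@sq_incl_inj _ _ K'K)
  insert (fun n y => fpos a (val y)) (fun n y => count_in T (val y))).
- by move=> n y g; rewrite /= fposJ.
- by move=> n y _; exact: vpos.
- move=> n y yo; apply: val_inj; rewrite [LHS]/= -[insert_raw _]/(val (insert n y)) insE //.
  apply/ffunP => i; rewrite ffunE; exact: ins_other.
- move=> y yo _ /=; rewrite -[insert_raw _]/(val (insert 0 y)) insE //.
  set p := fpos a _; have pn : (p < 2)%N := vpos _ y.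
  have jn : (bump p 0 < 2)%N by rewrite /bump; lia.
  have := count_in_face T (ins p (e (val y)) (val y)) (Ordinal jn).
  rewrite count_in_ins // (negPf (e_old (newP _ _ yo))) add0n.
  rewrite (@ins_other _ _ _ _ (Ordinal jn) ord0) //= => <-.
  suff -> : T (val y ord0) by lia.
  apply: contraT => Ty; case/andP: (newP _ _ yo) => yK /negP[].
  by apply: pivot => // i; rewrite ord1.
- move=> n y j jn yo; have ynew := newP _ _ yo.
  pose j' := Ordinal jn.
  set p := fpos a (val y); have pn : (p < n.+3)%N := vpos _ y.
  have bn : (bump p j < n.+3)%N by rewrite /bump; lia.
  have cnt := count_in_face T (ins p (e (val y)) (val y)) (Ordinal bn).
  rewrite count_in_ins // (negPf (e_old ynew)) add0n in cnt.
  rewrite (@ins_other _ _ _ _ (Ordinal bn) j') // in cnt.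
  have cnt2 := count_in_face T (val y) j'.
  have [Tj|NTj] := boolP (T (val y j')); last first.
    have [fK' eE] := face_new ynew NTj.
    have fo : outside (sq_incl K'K) (gspmor (sq K) (coface n j) y).
      exact/sq_incl_outside.
    have pE : fpos a (val (gspmor (sq K) (coface n j) y)) = (p - (j < p))%N.
      apply: fposE => [|i ip|i ip] /=; rewrite ?ffunE.
      - by have := fpos_le a (val y); rewrite -/p; lia.
      - by apply: fpos_before; rewrite -/p /= /bump; lia.
      have [jp|pj|jp] := ltngtP j p.
      - by apply: fpos_at; rewrite -/p /= /bump; lia.
      - by apply: fpos_at; rewrite -/p /= /bump; lia.
      apply: (a_up (i := j')) ynew _ _ NTj; first by rewrite /= /bump; lia.
      exact: fpos_at.
    left; split=> //; apply: val_inj.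
    rewrite [LHS]/= -[insert_raw _]/(val (insert _ y)) insE // [RHS]insE // pE -/p.
    rewrite (eE : e (val (gspmor (sq K) (coface n j) y)) = _); apply/ffunP => i; rewrite sq_pullE.
    have pn' : (p - (j < p) < n.+2)%N by lia.
    have [ip|ip] := eqVneq (i : nat) (p - (j < p))%N.
      rewrite (ins_at _ _ ip) ins_at //=.
      by rewrite ip /bump; lia.
    have un : (unbump (p - (j < p)) i < n.+1)%N.
      by have := ltn_ord i; rewrite /unbump; lia.
    rewrite [RHS](@ins_other _ _ _ _ i (Ordinal un)) ?sq_pullE //=; last first.
      by rewrite /bump /unbump; lia.
    apply: ins_other => //=; rewrite /bump /unbump; lia.
  right; split=> [_|fo] /=.
    rewrite -[insert_raw _]/(val (insert _ y)) insE //.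
    suff E : (count_in T (sq_pull (coface n.+1 (bump p j))
        (ins p (e (val y)) (val y))) < count_in T (val y))%N by exact: E.
    by move: cnt; rewrite Tj /=; lia.
  have [fK'|fK'] := boolP (K' n (val (gspmor (sq K) (coface n j) y))).
    move/sq_incl_outside: fo => /negP[].
    by rewrite /= /insert_raw fK'; apply: sq_mem_pull.
  rewrite /insert_raw (negPf fK') count_in_ins //.
  rewrite (negPf (e_old _)).
    suff E : (count_in T (sq_pull (coface n j) (val y)) < count_in T (val y))%N.
      exact: E.
    by move: cnt2; rewrite Tj /=; lia.
  by rewrite /new fK' (valP (gspmor (sq K) (coface n j) y) : K n _).
- move=> n z i yo; have ynew := newP _ _ yo.
  set y := gspmor _ _ _ in yo ynew *.
  set p := fpos a (val y); have pn : (p < n.+3)%N := vpos _ y.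
  have yE (k k' : 'I_n.+2) : unbump i k = unbump i k' -> val y k = val y k'.
    by move=> kk'; rewrite /= !ffunE; congr (val z _); apply: val_inj.
  (* Insertion does not separate two equal vertices, because a holds at the
     position p but not just before it. *)
  have pi : p <> i.+1.
    move=> pi; have i1 : (i.+1 < n.+2)%N by have := ltn_ord i; lia.
    have i0 : (i < n.+2)%N by lia.
    have := @fpos_before a _ (val y) (Ordinal i0); rewrite -/p pi ltnSn => /(_ isT).
    rewrite (yE _ (Ordinal i1)); last by rewrite /unbump /=; lia.
    by rewrite (@fpos_at a _ (val y) (Ordinal i1)).
  have i'n : (bump p i < n.+2)%N by have := ltn_ord i; rewrite /bump; lia.
  exists (Ordinal i'n), (gspmor (sq K) (coface n.+1 (bump p i)) (insert _ y)).
  apply: val_inj; rewrite insE //.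
  rewrite [RHS]/= -[insert_raw _]/(val (insert _ y)) insE // -/p.
  apply/ffunP => k; rewrite !sq_pullE.
  have [kp|kp] := eqVneq (k : nat) (bump p i); last first.
    by congr (ins _ _ _ _); apply: val_inj; move: kp; rewrite /= /bump /unbump; lia.
  have i1 : (i.+1 < n.+2)%N by have := ltn_ord i; lia.
  have i0 : (i < n.+2)%N by lia.
  rewrite (@ins_other _ _ _ _ k (Ordinal i0)) //.
  rewrite (@ins_other _ _ _ _ _ (Ordinal i1)) //=; last first.
    by rewrite kp /bump /unbump; lia.
  by apply: yE; rewrite /unbump /=; lia.
- by move=> n y; apply: count_in_le.
Qed.
End Insert.
End SequenceSpaces.

(** * The preorder of cosets and subgroups *)

Section PointedSubgroups.
Variable gT : finGroupType.
Local Open Scope group_scope.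

(** Pairs (S, P) of a right coset and a subgroup.  The group of which S is a coset
    is not recorded, as it is S S^-1. *)
Definition pgp := ({set gT} * {group gT})%type.
Implicit Types q : pgp.

Definition pgp_act q g : pgp := (q.1 :* g, (q.2 :^ g)%G).
Lemma pgp_act1 q : pgp_act q 1 = q.
Proof.
case: q => S P; congr pair; first by rewrite /= mulg1.
by apply: val_inj; rewrite /= conjsg1.
Qed.
Lemma pgp_actM q g h : pgp_act q (g * h) = pgp_act (pgp_act q g) h.
Proof.
case: q => S P; congr pair; first by rewrite /= rcosetM.
by apply: val_inj; rewrite /= conjsgM.
Qed.

(** For S = Hg, this is H^g, the stabilizer of the coset. *)
Definition st q : {set gT} := q.1^-1 * q.1.
(** The same stabilizer as a group; for cosets the generation is redundant. *)
Definition stg q : {group gT} := <<st q>>%G.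

Lemma stJ q g : st (pgp_act q g) = st q :^ g.
Proof. by rewrite /st /= invMg invg_set1 conjsgE -!mulgA. Qed.

Lemma st_coset (H : {group gT}) q g : q.1 = H :* g -> st q = H :^ g.
Proof.
move=> qE; rewrite /st qE invMg invGid mulgA -(mulgA _ H H) mulGid invg_set1.
by rewrite conjsgE -mulgA.
Qed.

Lemma st_rcoset (H : {group gT}) q : q.1 \in rcosets H [set: gT] ->
  exists g, q.1 = H :* g /\ st q = H :^ g.
Proof. by case/rcosetsP => g _ qE; exists g; rewrite (st_coset qE). Qed.

Lemma rcosetsJ (H : {group gT}) (S : {set gT}) g :
  S \in rcosets H [set: gT] -> S :* g \in rcosets H [set: gT].
Proof.
case/rcosetsP => x _ ->; rewrite -rcosetM.
by apply/rcosetsP; exists (x * g); rewrite ?inE.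
Qed.

Definition pgp_std q := q.2 == st q :> {set gT}.

Lemma pgp_stdJ q g : pgp_std q -> pgp_std (pgp_act q g).
Proof. by rewrite /pgp_std stJ /= => /eqP ->. Qed.

Definition of_collection (C : {set {group gT}}) : pred pgp := fun q =>
  [exists H in C, q.1 \in rcosets H [set: gT]] && pgp_std q.

Lemma of_collectionJ C q g : of_collection C q -> of_collection C (pgp_act q g).
Proof.
case/andP=> /existsP[H /andP[HC qH]] qs; rewrite /of_collection pgp_stdJ // andbT.
by apply/existsP; exists H; rewrite HC rcosetsJ.
Qed.

End PointedSubgroups.

Section Model.
Variable gT : finGroupType.
Local Open Scope group_scope.
Variables (p : nat) (D : {group gT}) (C : {set {group gT}}).
Hypothesis C_collection : is_collection C.
Hypothesis C_pgroups : forall H : {group gT}, H \in C -> p.-group H.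
Hypothesis D_in_C : D \in C.
Hypothesis D_minimal : forall H : {group gT}, H \in C -> H \subset D -> H = D.
Hypothesis C_supergroups : forall P : {group gT},
  p.-group P -> D \subset P -> P \in C.
Implicit Types q : pgp gT.

Let C' := C :\: conj_subgroups D.

Definition over_D q := q.1 \in rcosets D [set: gT].
Definition isW q := over_D q && pgp_std q.
Definition isM q := [&& over_D q, st q \proper q.2, q.2 \subset 'N(st q) & p.-group q.2].
Definition isX' : pred (pgp gT) := of_collection C'.

Lemma over_DJ q g : over_D q -> over_D (pgp_act q g).
Proof. exact: rcosetsJ. Qed.
Lemma isWJ q g : isW q -> isW (pgp_act q g).
Proof. by case/andP => qD qs; rewrite /isW over_DJ // pgp_stdJ. Qed.
Lemma isMJ q g : isM q -> isM (pgp_act q g).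
Proof.
case/and4P=> qD qp qN qpg; rewrite /isM over_DJ // stJ /= properJ qp.
by rewrite normJ conjSg qN pgroupJ.
Qed.

Lemma predJ_eq (A : pred (pgp gT)) : (forall q g, A q -> A (pgp_act q g)) ->
  forall q g, A (pgp_act q g) = A q.
Proof.
move=> AJ q g; apply/idP/idP; last exact: AJ.
by move/(AJ _ g^-1); rewrite -pgp_actM mulgV pgp_act1.
Qed.

(** Inclusion of the subgroups; below a vertex (Dg, P) of M, the coset must in
    addition have the stabilizer D^g.  The relation is transitive on the parts of
    interest only, and chains are therefore required to be pairwise related. *)
Definition le q q' := (q.2 \subset q'.2) && (isM q' ==> (st q == st q')).

Lemma leJ q q' g : le q q' -> le (pgp_act q g) (pgp_act q' g).
Proof.
case/andP=> qq' /implyP qM; rewrite /le /= conjSg qq' /=.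
rewrite (predJ_eq isMJ) !stJ.
by apply/implyP => /qM /eqP ->.
Qed.

Lemma le_refl q : le q q.
Proof. by rewrite /le subxx eqxx implybT. Qed.

Lemma st_over q : over_D q -> exists g, st q = D :^ g.
Proof. by case/st_rcoset => g [_ E]; exists g. Qed.

Lemma stgE q : over_D q -> stg q = st q :> {set gT}.
Proof. by case/st_over => g qE; rewrite /= qE genGid. Qed.

(** By conjugation, every conjugate of D is minimal in C. *)
Lemma C_minimal (H : {group gT}) g : H \in C -> H \subset D :^ g -> H = D :^ g :> {set gT}.
Proof.
move=> HC HD; have E : (H :^ g^-1)%G = D.
  by apply: D_minimal; [exact: C_collection | rewrite sub_conjgV].
by move/(congr1 val): E => /= <-; rewrite -conjsgM mulVg conjsg1.
Qed.

Lemma X'P q : isX' q -> [/\ q.2 \in C, q.2 = st q :> {set gT}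
  & forall g, q.2 <> D :^ g :> {set gT}].
Proof.
case/andP=> /existsP[H /andP[]]; rewrite inE => /andP[HD HC] qH /eqP qs.
have [x [_ qx]] := st_rcoset qH.
have E : q.2 = (H :^ x)%G by apply: val_inj; rewrite /= qs.
split=> // [|g]; first by rewrite E; apply: C_collection.
rewrite E /= => Hxg; case/negP: HD; apply/imsetP; exists (g * x^-1); rewrite ?inE //.
by apply: val_inj; rewrite /= conjsgM -Hxg -conjsgM mulgV conjsg1.
Qed.

Lemma WP q : isW q -> exists g, q.2 = D :^ g :> {set gT} /\ st q = D :^ g.
Proof.
by case/andP => /st_over[g E] /eqP qs; exists g; rewrite qs E.
Qed.

Lemma MP q : isM q -> exists g, [/\ st q = D :^ g, D :^ g \proper q.2,
   q.2 \subset 'N(D :^ g) & p.-group q.2].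
Proof.
by case/and4P => /st_over[g E]; rewrite E => *; exists g.
Qed.

Lemma proper_conj_sub (P : {group gT}) g h :
  D :^ g \proper P -> P \subset D :^ h -> False.
Proof.
move=> /proper_card lt /subset_leq_card.
by rewrite cardJg leqNgt -(cardJg D g) lt.
Qed.

Lemma W_X'F q : isW q -> isX' q -> False.
Proof. by move=> /WP[g [E _]] /X'P[_ _ /(_ g)]. Qed.
Lemma W_MF q : isW q -> isM q -> False.
Proof.
move=> /WP[g [E _]] /MP[h [_ lt _ _]].
by apply: (@proper_conj_sub q.2 h g lt); rewrite E.
Qed.
Lemma M_X'F q : isM q -> isX' q -> False.
Proof. by move=> /MP[g [E _ _ _]] /X'P[_ E' /(_ g)]; rewrite E' E. Qed.

Lemma M_le_sub q q' g : isM q -> le q q' -> q'.2 \subset D :^ g -> False.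
Proof.
move=> /MP[h [_ lt _ _]] /andP[qq' _] q'D.
by apply: (@proper_conj_sub q.2 h g lt); apply: fintype.subset_trans qq' q'D.
Qed.
Lemma X'_le_sub q q' g : isX' q -> le q q' -> q'.2 \subset D :^ g -> False.
Proof.
move=> /X'P[qC _ /(_ g) qg] /andP[qq' _] q'D; apply: qg.
by apply: C_minimal => //; apply: fintype.subset_trans qq' q'D.
Qed.
Lemma M_le_WF q q' : isM q -> isW q' -> le q q' -> False.
Proof. by move=> qM /WP[g [E _]] qq'; apply: (M_le_sub qM qq' (g := g)); rewrite E. Qed.
Lemma X'_le_WF q q' : isX' q -> isW q' -> le q q' -> False.
Proof. by move=> qM /WP[g [E _]] qq'; apply: (X'_le_sub qM qq' (g := g)); rewrite E. Qed.
Lemma X'_le_MF q q' : isX' q -> isM q' -> le q q' -> False.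
Proof.
move=> /X'P[_ E qD] q'M /andP[_]; rewrite q'M /= => /eqP st_qq'.
by have [g [E' _ _ _]] := MP q'M; apply: (qD g); rewrite E st_qq'.
Qed.
Lemma W_le_st q q' : isW q -> (isW q' || isM q') -> le q q' -> q.2 = st q' :> {set gT}.
Proof.
move=> qW; have [g [E1 E2]] := WP qW => /orP[/WP[h [E3 E4]]|q'M] /andP[qq' H].
  by apply/eqP; rewrite E1 E4 eqEcard !cardJg leqnn andbT -E1 -E3.
by move: H; rewrite q'M /= => /eqP <-; rewrite E1 E2.
Qed.

Lemma std_notM q : pgp_std q -> ~~ isM q.
Proof. by move=> /eqP qs; apply/negP => /and4P[_]; rewrite qs fintype.properxx. Qed.

Definition isXW q := isX' q || isW q.
Definition isN q := isM q || isW q.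
Definition isX : pred (pgp gT) := of_collection C.

Lemma isXWJ q g : isXW q -> isXW (pgp_act q g).
Proof. by case/orP => [/of_collectionJ|/isWJ] qP; rewrite /isXW ?qP ?orbT // /isX' qP. Qed.

Section Chains.
Variables (A1 A2 : pred (pgp gT)).
Hypothesis A1J : forall q g, A1 q -> A1 (pgp_act q g).
Hypothesis A2J : forall q g, A2 q -> A2 (pgp_act q g).

(** Quantifying over all pairs of indices, equal ones included, makes chains stable
    under all simplicial operators. *)
Definition is_chain n (x : {ffun 'I_n.+1 -> pgp gT}) :=
  [forall i : 'I_n.+1, forall j : 'I_n.+1, (i <= j)%N ==> le (x i) (x j)].
Definition all_in (A : pred (pgp gT)) n (x : {ffun 'I_n.+1 -> pgp gT}) :=
  [forall i, A (x i)].
Definition chain_mem n (x : {ffun 'I_n.+1 -> pgp gT}) :=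
  is_chain x && (all_in A1 x || all_in A2 x).

Lemma is_chainP n (x : {ffun 'I_n.+1 -> pgp gT}) :
  reflect (forall i j : 'I_n.+1, (i <= j)%N -> le (x i) (x j)) (is_chain x).
Proof.
apply: (iffP forallP) => [xc i j ij|xc i].
  by have /forallP/(_ j)/implyP := xc i; apply.
by apply/forallP => j; apply/implyP; apply: xc.
Qed.

Lemma chain_memJ n x g : @chain_mem n x -> chain_mem (sq_act (@pgp_act gT) x g).
Proof.
case/andP=> /is_chainP xc xA; apply/andP; split.
  by apply/is_chainP => i j ij; rewrite !ffunE leJ // xc.
case/orP: xA => /forallP xA; apply/orP; [left|right]; apply/forallP => i;
  by rewrite ffunE ?A1J ?A2J.
Qed.
Lemma chain_mem_pull m n (f : mono m n) x : chain_mem x -> chain_mem (sq_pull f x).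
Proof.
case/andP=> /is_chainP xc xA; apply/andP; split.
  by apply/is_chainP => i j ij; rewrite !ffunE xc // mono_le.
case/orP: xA => /forallP xA; apply/orP; [left|right]; apply/forallP => i;
  by rewrite ffunE.
Qed.
Definition chains : sqpred (@pgp_act gT) := SqPred chain_memJ chain_mem_pull.
End Chains.

(** * Inclusions of nerves which are equivalences *)

Section Insertions.

Lemma insP n pp (q : pgp gT) (x : {ffun 'I_n.+1 -> pgp gT}) (i : 'I_n.+2) :
  (pp < n.+2)%N ->
  (i = pp :> nat /\ ins pp q x i = q) \/
  exists i' : 'I_n.+1, i = bump pp i' :> nat /\ ins pp q x i = x i'.
Proof.
move=> ppn; have [ip|ip] := eqVneq (i : nat) pp; first by left; rewrite ins_at.
have un : (unbump pp i < n.+1)%N by have := ltn_ord i; move: ip; rewrite /unbump; lia.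
right; exists (Ordinal un); rewrite -(@ins_other _ _ pp q x i) //=.
  by split=> //; move: ip; rewrite /bump /unbump; lia.
by move: ip; rewrite /bump /unbump; lia.
Qed.

Lemma is_chain_ins n pp (q : pgp gT) (x : {ffun 'I_n.+1 -> pgp gT}) :
  (pp < n.+2)%N -> is_chain x ->
  (forall i : 'I_n.+1, (i < pp)%N -> le (x i) q) ->
  (forall i : 'I_n.+1, (pp <= i)%N -> le q (x i)) ->
  is_chain (ins pp q x).
Proof.
move=> ppn /is_chainP xc xq qx; apply/is_chainP => i j ij.
have [[ip ->]|[i' [ip ->]]] := insP q x i ppn;
have [[jp ->]|[j' [jp ->]]] := insP q x j ppn.
- exact: le_refl.
- by apply: qx; move: ij; rewrite ip jp /bump; lia.
- by apply: xq; move: ij; rewrite ip jp /bump; lia.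
- by apply: xc; move: ij; rewrite ip jp /bump; lia.
Qed.

Lemma all_in_ins (A : pred (pgp gT)) n pp q (x : {ffun 'I_n.+1 -> pgp gT}) :
  (pp < n.+2)%N -> all_in A x -> A q -> all_in A (ins pp q x).
Proof.
move=> ppn /forallP xA qA; apply/forallP => i.
by have [[_ ->]|[i' [_ ->]]] := insP q x i ppn.
Qed.

Definition vertex_at n (x : {ffun 'I_n.+1 -> pgp gT}) k := x (inord k).

Lemma vertex_atE n (x : {ffun 'I_n.+1 -> pgp gT}) (i : 'I_n.+1) k :
  i = k :> nat -> vertex_at x k = x i.
Proof. by move=> <-; rewrite /vertex_at inord_val. Qed.

Lemma vertex_at_act n (x : {ffun 'I_n.+1 -> pgp gT}) g k :
  vertex_at (sq_act (@pgp_act gT) x g) k = pgp_act (vertex_at x k) g.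
Proof. by rewrite /vertex_at ffunE. Qed.

Lemma vertex_at_face n (x : {ffun 'I_n.+2 -> pgp gT}) j k : (k < n.+1)%N ->
  vertex_at (sq_pull (coface n j) x) k = vertex_at x (bump j k).
Proof.
move=> kn; rewrite /vertex_at ffunE; congr (x _); apply: val_inj => /=.
by rewrite !inordK //; rewrite /bump; lia.
Qed.

Section FposFace.
Variable a : pred (pgp gT).

Lemma fpos_lt_ex n (x : {ffun 'I_n.+1 -> pgp gT}) i : a (x i) -> (fpos a x < n.+1)%N.
Proof.
move=> ai; have := ltn_ord i; rewrite ltnNge; apply: contraTT => /= fn.
rewrite -ltnNge ltnS; apply: contraLR ai; rewrite -ltnNge => lt.
apply: fpos_before; lia.
Qed.

Lemma fpos_vertex_at n (x : {ffun 'I_n.+1 -> pgp gT}) :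
  (fpos a x < n.+1)%N -> a (vertex_at x (fpos a x)).
Proof. by move=> fn; rewrite /vertex_at; apply: fpos_at; rewrite inordK. Qed.

Lemma fpos_face n (x : {ffun 'I_n.+2 -> pgp gT}) (j : 'I_n.+2) :
    (fpos a x < n.+2)%N -> j <> fpos a x :> nat ->
  fpos a (sq_pull (coface n j) x) = (fpos a x - (j < fpos a x))%N /\
  vertex_at (sq_pull (coface n j) x) (fpos a (sq_pull (coface n j) x)) =
  vertex_at x (fpos a x).
Proof.
move=> fn jf.
have E : fpos a (sq_pull (coface n j) x) = (fpos a x - (j < fpos a x))%N.
  have jn := ltn_ord j.
  apply: fposE => [|i ip|i ip]; rewrite ?ffunE; first by lia.
    by apply: fpos_before; rewrite /= /bump; lia.
  by apply: fpos_at; rewrite /= /bump; lia.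
split=> //; rewrite vertex_at_face E; last by have := ltn_ord j; lia.
by congr (vertex_at x _); rewrite /bump; lia.
Qed.
End FposFace.

Lemma not_all_in (A : pred (pgp gT)) n (x : {ffun 'I_n.+1 -> pgp gT}) :
  ~~ all_in A x -> exists i, ~~ A (x i).
Proof. by rewrite negb_forall => /existsP. Qed.

Lemma all_inN (A : pred (pgp gT)) n (x : {ffun 'I_n.+1 -> pgp gT}) i :
  ~~ A (x i) -> ~~ all_in A x.
Proof. by apply: contraNN => /forallP. Qed.

Lemma face_keep n (x : {ffun 'I_n.+2 -> pgp gT}) (i j : 'I_n.+2) : i <> j ->
  exists k, sq_pull (coface n j) x k = x i.
Proof.
move=> ij; have ij' : i <> j :> nat by move/val_inj.
have un : (unbump j i < n.+1)%N.
  by have := ltn_ord i; have := ltn_ord j; rewrite /unbump; lia.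
exists (Ordinal un); rewrite ffunE; congr (x _); apply: val_inj => /=.
by rewrite /bump /unbump; lia.
Qed.

Lemma face_not_all (A : pred (pgp gT)) n (x : {ffun 'I_n.+2 -> pgp gT}) (j : 'I_n.+2) :
  ~~ all_in A x -> A (x j) -> ~~ all_in A (sq_pull (coface n j) x).
Proof.
move=> /not_all_in[i xi] xj; have [|k ki] := @face_keep _ x i j.
  by move=> ij; rewrite ij xj in xi.
by apply: (@all_inN _ _ _ k); rewrite ki.
Qed.

(** An equivariant choice, for a coset S of D^k, of a coset of D with the same
    stabilizer: since S S^-1 = D^k does not change under G, neither does the
    choice of k. *)
Definition rho q : pgp gT :=
  (D :* odflt 1 [pick k | q.1 * q.1^-1 == D :^ k] * q.1, q.2).

Lemma rhoJ q g : rho (pgp_act q g) = pgp_act (rho q) g.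
Proof.
rewrite /rho /pgp_act /=; congr pair.
have -> : q.1 :* g * (q.1 :* g)^-1 = q.1 * q.1^-1.
  by rewrite invMg invg_set1 mulgA -(mulgA q.1) mulg_set1 mulgV mulg1.
by rewrite mulgA.
Qed.

Lemma isXE q : isX q -> isX' q \/
  exists k g, q.1 = (D :^ k) :* g /\ q.2 = (D :^ k) :^ g :> {set gT}.
Proof.
case/andP=> /existsP[H /andP[HC qH]] qs.
have [HD|HD] := boolP (H \in conj_subgroups D).
  right; have [k _ HE] := imsetP HD; have [g [q1 q2]] := st_rcoset qH.
  by exists k, g; rewrite q1 (eqP qs) q2 HE.
left; apply/andP; split=> //; apply/existsP; exists H.
by rewrite inE HD HC.
Qed.

Lemma rho_W q : isX q -> ~~ isXW q -> isW (rho q).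
Proof.
case/isXE=> [qX'|[k [g [q1 q2]]]]; first by rewrite /isXW qX'.
move=> _; have E : q.1 * q.1^-1 = D :^ k.
  rewrite q1 invMg invg_set1 mulgA -(mulgA _ [set g]) mulg_set1 mulgV mulg1.
  by rewrite -[(D :^ k)%g]/(((D :^ k)%G : {set gT})) invGid mulGid.
rewrite /isW /over_D /pgp_std /st /=.
case: pickP => [k' /= /eqP E'|/(_ k)]; last by rewrite E eqxx.
rewrite E in E'; have -> : D :* k' * q.1 = D :* (k' * g).
  rewrite q1 E' conjsgE !mulgA -(mulgA D [set k']) mulg_set1 mulgV mulg1.
  by rewrite mulGid -!mulgA mulg_set1.
apply/andP; split; first by apply/rcosetsP; exists (k' * g); rewrite ?inE.
rewrite invMg invGid mulgA -(mulgA _ D D) mulGid invg_set1.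
by rewrite q2 E' -conjsgM conjsgE -mulgA.
Qed.

Lemma W_X q : isW q -> isX q.
Proof.
case/andP => qD qs; apply/andP; split=> //; apply/existsP.
by exists D; rewrite D_in_C.
Qed.
Lemma X'_X q : isX' q -> isX q.
Proof.
case/andP => /existsP[H /andP[]]; rewrite inE => /andP[_ HC] qH qs.
by apply/andP; split=> //; apply/existsP; exists H; rewrite HC.
Qed.
Lemma X_notM q : isX q -> ~~ isM q.
Proof. by case/andP => _; apply: std_notM. Qed.

Lemma isXJ q g : isX q -> isX (pgp_act q g). Proof. exact: of_collectionJ. Qed.
Lemma isX'J q g : isX' q -> isX' (pgp_act q g). Proof. exact: of_collectionJ. Qed.

Definition chain_space (A : pred (pgp gT)) (AJ : forall q g, A q -> A (pgp_act q g)) :=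
  sq (@pgp_act1 gT) (@pgp_actM gT) (chains AJ AJ).

Lemma sub_mem (A B : pred (pgp gT)) : subpred A B ->
  forall n (x : {ffun 'I_n.+1 -> pgp gT}), chain_mem A A x -> chain_mem B B x.
Proof.
move=> AB n x /andP[xc /orP xA]; rewrite /chain_mem xc /=.
by apply/orP; left; apply/forallP => i; case: xA => /forallP xA; apply: AB.
Qed.

Lemma XW_X : subpred isXW isX.
Proof. by move=> q /orP[/X'_X|/W_X]. Qed.

Definition incl (A B : pred (pgp gT)) (AJ : forall q g, A q -> A (pgp_act q g))
  (BJ : forall q g, B q -> B (pgp_act q g)) (AB : subpred A B) :
  gspmap (chain_space AJ) (chain_space BJ) :=
  sq_incl (@pgp_act1 gT) (@pgp_actM gT) (K := chains AJ AJ) (K' := chains BJ BJ) (sub_mem AB).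

Lemma mem1 (A : pred (pgp gT)) n (x : {ffun 'I_n.+1 -> pgp gT}) :
  chain_mem A A x = is_chain x && all_in A x.
Proof. by rewrite /chain_mem orbb. Qed.

(** In front of the first coset which is neither in W nor in X', insert a coset of D
    with the same stabilizer. *)
Lemma contract_XW_X : contractible (incl isXWJ isXJ XW_X).
Proof.
pose a : pred (pgp gT) := fun q => ~~ isXW q.
pose e n (x : {ffun 'I_n.+1 -> pgp gT}) := rho (vertex_at x (fpos a x)).
have aJ q g : a (pgp_act q g) = a q by rewrite /a (predJ_eq isXWJ).
have new n (x : {ffun 'I_n.+1 -> pgp gT}) :
    chain_mem isX isX x && ~~ chain_mem isXW isXW x ->
    [/\ is_chain x, forall i, isX (x i), ~~ all_in isXW x, (fpos a x < n.+1)%N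
      & isW (e n x)].
  rewrite !mem1 => /andP[/andP[xc /forallP xX]]; rewrite xc /= => xN.
  have [i xi] := not_all_in xN; have fn := @fpos_lt_ex a _ _ _ xi.
  by split=> //; apply: rho_W; [exact: xX | exact: fpos_vertex_at fn].
apply: (@ins_contractible _ _ _ _ _ _ _ _ a a e) => //.
- move=> n x g _; rewrite /e vertex_at_act rhoJ.
  by rewrite (_ : fpos a (sq_act _ _ _) = fpos a x) //; apply: eq_find => i; rewrite ffunE aJ.
- move=> n x /new[xc xX _ fn eW]; rewrite /= mem1; apply/andP; split; last first.
    by apply: all_in_ins; [lia|apply/forallP|exact: W_X].
  move/is_chainP: (xc) => xc'.
  apply: is_chain_ins => // [|i ip|i ip]; first by lia.
  - have -> : le (x i) (e n x) = le (x i) (vertex_at x (fpos a x)).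
      by rewrite /le (negPf (X_notM (W_X eW))) (negPf (X_notM (xX _))).
    by apply: xc'; rewrite inordK //; lia.
  have -> : le (e n x) (x i) = le (vertex_at x (fpos a x)) (x i).
    by rewrite /le (negPf (X_notM (xX _))).
  by apply: xc'; rewrite inordK.
- by move=> n x /new[_ _ _ _ eW]; rewrite /a /= negbK /isXW eW orbT.
- move=> n x j /new[xc xX xN fn _]; rewrite /a /= negbK => xj; split.
    by rewrite mem1 negb_and face_not_all // orbT.
  congr (rho _); apply: (fpos_face fn _).2 => jf.
  by have := fpos_vertex_at fn; rewrite -jf /a /= (@vertex_atE _ x j) // xj.
- by move=> n x i j _ _ xi; rewrite xi.
move=> n x; rewrite /= !mem1 => /andP[-> _] xA /=; apply/forallP => i.
by have := xA i; rewrite /a negbK.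
Qed.

(** For (S, P) = (Dg, P) in M, the coset gP has stabilizer P. *)
Definition theta q : pgp gT := (q.1 * q.2, q.2).

Lemma thetaJ q g : theta (pgp_act q g) = pgp_act (theta q) g.
Proof.
rewrite /theta /pgp_act /=; congr pair.
by rewrite conjsgE !mulgA -(mulgA q.1) mulg_set1 mulgV mulg1.
Qed.

Lemma theta_X' q : isM q -> isX' (theta q).
Proof.
move=> qM; have /and4P[qD qp _ qpg] := qM.
have [g [q1 stq]] := st_rcoset qD.
have Dq : D :^ g \subset q.2 by rewrite -stq proper_sub.
have qE : q.1 * q.2 = (q.2 :^ g^-1) :* g.
  rewrite q1 conjsgE invgK -!mulgA mulg_set1 mulVg mulg1.
  have -> : D * ([set g] * q.2) = g *: ((D :^ g)%G * q.2).
    by rewrite /= conjsgE !mulgA mulg_set1 mulgV mul1g.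
  by rewrite mulSGid.
have qst : st (theta q) = q.2.
  rewrite (@st_coset _ (q.2 :^ g^-1)%G (theta q) g) //=.
  by rewrite -conjsgM mulVg conjsg1.
apply/andP; split; last by rewrite /pgp_std qst.
apply/existsP; exists (q.2 :^ g^-1)%G; rewrite inE; apply/andP; split; last first.
  by rewrite /= qE; apply/rcosetsP; exists g; rewrite ?inE.
apply/andP; split.
  apply/negP => /imsetP[h _ /(congr1 val) /= E].
  have /proper_card := qp; rewrite stq -(cardJg q.2 g^-1) E !cardJg.
  by rewrite ltnn.
by apply: C_supergroups; rewrite ?pgroupJ //= -sub_conjg.
Qed.

Definition addM (A : pred (pgp gT)) : pred (pgp gT) := fun q => isM q || A q.
Lemma addMJ (A : pred (pgp gT)) : (forall q g, A q -> A (pgp_act q g)) ->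
  forall q g, addM A q -> addM A (pgp_act q g).
Proof.
by move=> AJ q g /orP[/(isMJ g)|/(AJ _ g)] qP; rewrite /addM qP ?orbT.
Qed.
Lemma sub_addM (A : pred (pgp gT)) : subpred A (addM A).
Proof. by move=> q qA; rewrite /addM qA orbT. Qed.

Lemma addM_cases q : addM isXW q -> [\/ isM q, isX' q | isW q].
Proof. by case/orP => [->|/orP[->|->]]; [constructor 1|constructor 2|constructor 3]. Qed.

Lemma X'_le_X' q q' : isX' q -> addM isXW q' -> le q q' -> isX' q'.
Proof.
move=> qX' /addM_cases[q'M|//|q'W] qq'; first by case: (X'_le_MF qX' q'M qq').
by case: (X'_le_WF qX' q'W qq').
Qed.

Section AddM.
Variable A : pred (pgp gT).
Hypothesis AJ : forall q g, A q -> A (pgp_act q g).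
Hypothesis X'_A : subpred isX' A.
Hypothesis A_XW : subpred A isXW.

(** All vertices of M in a chain precede those of X'.  Behind the last one, (Dg, P),
    insert the coset gP, which lies below the same vertices of X'.  The
    position is the first vertex of X' if any, and the end otherwise. *)
Lemma contract_addM : contractible (incl AJ (addMJ AJ) (@sub_addM A)).
Proof.
pose e n (x : {ffun 'I_n.+1 -> pgp gT}) := theta (vertex_at x (fpos isX' x).-1).
have aJ q g : isX' (pgp_act q g) = isX' q by rewrite (predJ_eq isX'J).
have AU : forall q, addM A q -> addM isXW q.
  by move=> q /orP[qM|/A_XW qA]; rewrite /addM ?qM ?qA ?orbT.
have new n (x : {ffun 'I_n.+1 -> pgp gT}) :
    chain_mem (addM A) (addM A) x && ~~ chain_mem A A x ->
    [/\ is_chain x, forall i, addM A (x i), ~~ all_in A x, (0 < fpos isX' x)%N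
      & isM (vertex_at x (fpos isX' x).-1)].
  rewrite !mem1 => /andP[/andP[xc /forallP xB]]; rewrite xc /= => xN.
  have xc' := is_chainP _ xc.
  have [i xi] := not_all_in xN; have {}xi : isM (x i).
    by have := xB i; rewrite /addM (negPf xi) orbF.
  have fle := fpos_le isX' x.
  have ifp : (i < fpos isX' x)%N.
    rewrite ltnNge; apply/negP => fi.
    have fn : (fpos isX' x < n.+1)%N by have := ltn_ord i; lia.
    apply: (X'_le_MF (fpos_vertex_at fn) xi); apply: xc'; rewrite inordK //.
  split=> //; first by lia.
  have fn : ((fpos isX' x).-1 < n.+1)%N by lia.
  have [//|F|F] := addM_cases (AU _ (xB (inord (fpos isX' x).-1))).
    suff /negP : ~~ isX' (x (inord (fpos isX' x).-1)) by [].
    by apply: fpos_before; rewrite inordK //; lia.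
  case: (M_le_WF xi F); apply: xc'; rewrite inordK //; lia.
apply: (@ins_contractible _ _ _ _ _ _ _ _ isM isX' e) => //.
- move=> n x g _; rewrite /e vertex_at_act thetaJ.
  by rewrite (_ : fpos isX' (sq_act _ _ _) = fpos isX' x) //; apply: eq_find => i; rewrite ffunE aJ.
- move=> n x /new[xc xB _ f0 xM]; rewrite /= mem1.
  have fle := fpos_le isX' x; have eX' := theta_X' xM.
  have xc' := is_chainP _ xc.
  apply/andP; split; last first.
    apply: all_in_ins; [lia|exact/forallP|].
    by rewrite /addM (X'_A eX') orbT.
  have fn : ((fpos isX' x).-1 < n.+1)%N by lia.
  apply: is_chain_ins => // [i ip|i ip].
    rewrite /le (negPf (X_notM (X'_X eX'))) andbT /=.
    suff /andP[] : le (x i) (vertex_at x (fpos isX' x).-1) by [].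
    by apply: xc'; rewrite inordK //; lia.
  have xi : isX' (x i).
    have fn' : (fpos isX' x < n.+1)%N by have := ltn_ord i; lia.
    apply: (X'_le_X' (fpos_vertex_at fn') (AU _ (xB i))); apply: xc'; by rewrite inordK.
  rewrite /le (negPf (X_notM (X'_X xi))) andbT /=.
  suff /andP[] : le (vertex_at x (fpos isX' x).-1) (x i) by [].
  by apply: xc'; rewrite inordK //; lia.
- by move=> n x /new[_ _ _ _ /theta_X'/X'_X/X_notM].
- move=> n x j xnew xj; have [xc xB xN f0 xM] := new _ _ xnew.
  have xc' := is_chainP _ xc; have fle := fpos_le isX' x; have jn := ltn_ord j.
  have xjO : A (x j) by have := xB j; rewrite /addM (negPf xj).
  split; first by rewrite /= mem1 negb_and face_not_all // orbT.
  have jf : j <> (fpos isX' x).-1 :> nat.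
    by move=> jf; move: xj; rewrite -(vertex_atE x jf) xM.
  have fE : fpos isX' (sq_pull (coface n j) x) = (fpos isX' x - (j < fpos isX' x))%N.
    apply: fposE => [|i ip|i ip]; rewrite ?ffunE; first by lia.
      by apply: fpos_before; rewrite /= /bump; lia.
    have in' := ltn_ord i.
    have fn : (fpos isX' x < n.+2)%N by lia.
    apply: (X'_le_X' (fpos_vertex_at fn) (AU _ (xB _))); apply: xc'.
    by rewrite inordK //= /bump; lia.
  rewrite /e fE vertex_at_face; last by lia.
  by congr (theta (vertex_at x _)); rewrite /bump; lia.
- move=> n x i j /new[xc xB _ _ _] ij xi _.
  by apply: (X'_le_X' xi (AU _ (xB j))); apply: (is_chainP _ xc); apply: ltnW.
move=> n x; rewrite /= !mem1 => /andP[-> /forallP xB] xA /=; apply/forallP => i.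
by have := xB i; rewrite /addM (negPf (xA i)).
Qed.
End AddM.

(** The projection from M to W, (Dg, P) |-> (Dg, D^g). *)
Definition sigma q : pgp gT := (q.1, stg q).

Lemma sigmaJ q g : sigma (pgp_act q g) = pgp_act (sigma q) g.
Proof.
congr pair; apply: val_inj => /=; rewrite stJ.
by rewrite genJ.
Qed.

Lemma sigma_W q : over_D q -> isW (sigma q).
Proof. by move=> qD; rewrite /isW /pgp_std /= -/(stg q) stgE // eqxx andbT. Qed.

Lemma isNJ q g : isN q -> isN (pgp_act q g).
Proof. by case/orP => [/(isMJ g)|/(isWJ g)] qP; rewrite /isN ?qP ?orbT. Qed.
Lemma W_N : subpred isW isN.
Proof. by move=> q qP; rewrite /isN qP orbT. Qed.
Lemma M_N : subpred isM isN.
Proof. by move=> q qP; rewrite /isN qP. Qed.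
Lemma N_over q : isN q -> over_D q.
Proof. by case/orP => [/and4P[]|/andP[]]. Qed.

Lemma N_le_st q q' : isN q -> isN q' -> le q q' -> st q = st q'.
Proof.
case/orP=> [qM|qW] /orP[q'M|q'W] qq'.
- by have /andP[_] := qq'; rewrite q'M => /eqP.
- by case: (M_le_WF qM q'W qq').
- by have /andP[_] := qq'; rewrite q'M => /eqP.
rewrite -(W_le_st qW _ qq') ?q'W //.
by have [g [-> ->]] := WP qW.
Qed.

(** In front of the first vertex of M, insert its projection to W. *)
Lemma contract_W_N : contractible (incl isWJ isNJ W_N).
Proof.
pose e n (x : {ffun 'I_n.+1 -> pgp gT}) := sigma (vertex_at x (fpos isM x)).
have aJ q g : isM (pgp_act q g) = isM q by rewrite (predJ_eq isMJ).
have new n (x : {ffun 'I_n.+1 -> pgp gT}) :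
    chain_mem isN isN x && ~~ chain_mem isW isW x ->
    [/\ is_chain x, forall i, isN (x i), ~~ all_in isW x
      & (fpos isM x < n.+1)%N].
  rewrite !mem1 => /andP[/andP[xc /forallP xB]]; rewrite xc /= => xN.
  split=> //; have [i xi] := not_all_in xN; apply: (@fpos_lt_ex _ _ x i).
  by have := xB i; rewrite /isN (negPf xi) orbF.
apply: (@ins_contractible _ _ _ _ _ _ _ _ isM isM e) => //.
- move=> n x g _; rewrite /e vertex_at_act sigmaJ.
  by rewrite (_ : fpos isM (sq_act _ _ _) = fpos isM x) //; apply: eq_find => i; rewrite ffunE aJ.
- move=> n x /new[xc xB _ fn]; rewrite /= mem1.
  have xc' := is_chainP _ xc; have xM := fpos_vertex_at fn.
  have qD : over_D (vertex_at x (fpos isM x)) by exact/N_over/xB.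
  have eW := sigma_W qD.
  have st_e : st (e n x) = st (vertex_at x (fpos isM x)) by [].
  apply/andP; split; last first.
    by apply: all_in_ins; [lia|exact/forallP|exact: W_N].
  apply: is_chain_ins => // [|i ip|i ip]; first by lia.
    have xi : isW (x i) by have := xB i; rewrite /isN (negPf (fpos_before ip)).
    have lexi : le (x i) (vertex_at x (fpos isM x)) by apply: xc'; rewrite inordK //; lia.
    rewrite /le (negPf (X_notM (W_X eW))) andbT.
    rewrite (W_le_st xi _ lexi) ?xM ?orbT //.
    by rewrite /= -/(stg _) stgE.
  have lexi : le (vertex_at x (fpos isM x)) (x i) by apply: xc'; rewrite inordK.
  have st_i := N_le_st (xB (inord (fpos isM x))) (xB i) lexi.
  rewrite /le st_e st_i eqxx implybT andbT /= -/(stg _) stgE // st_i.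
  have /orP[/and4P[_ xp _ _]|/WP[g [-> ->]]] := xB i; last exact: subxx.
  exact: proper_sub xp.
- by move=> n x /new[_ xB _ _]; apply/X_notM/W_X/sigma_W/N_over/xB.
- move=> n x j /new[xc xB xN fn] xj.
  have xjW : isW (x j) by have := xB j; rewrite /isN (negPf xj).
  split; first by rewrite /= mem1 negb_and face_not_all // orbT.
  congr (sigma _); apply: (fpos_face fn _).2 => jf.
  by move: xj; rewrite -(vertex_atE x jf) (fpos_vertex_at fn).
- by move=> n x i j _ _ xi; rewrite xi.
move=> n x; rewrite /= !mem1 => /andP[-> /forallP xB] xA /=; apply/forallP => i.
by have := xB i; rewrite /isN (negPf (xA i)).
Qed.

(** For q = (Dg, D^g) and q' with subgroup P, this is (Dg, N_P(D^g)). *)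
Definition norm_in q q' : pgp gT := (q.1, 'N_(q'.2)(st q)%G).

Let isBJ := addMJ isX'J.
Let isAJ := addMJ isXWJ.
Definition union_chains := chains isBJ isNJ.

Lemma union_mem n (x : {ffun 'I_n.+1 -> pgp gT}) :
  union_chains n x -> chain_mem (addM isXW) (addM isXW) x.
Proof.
rewrite mem1 => /andP[-> /orP[] /forallP xA] /=; apply/forallP => i;
  by have := xA i; rewrite /addM /isXW /isN => /orP[] ->; rewrite ?orbT.
Qed.

Lemma norm_inJ q q' g :
  norm_in (pgp_act q g) (pgp_act q' g) = pgp_act (norm_in q q') g.
Proof.
by congr pair; apply: val_inj; rewrite /= stJ conjIg normJ.
Qed.

(** Here p-groups enter: a proper subgroup of a p-group is properly contained in its
    normalizer, so that N_P(D^g) is a legitimate vertex of M. *)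
Lemma norm_in_M q q' : isW q -> isX' q' -> le q q' -> isM (norm_in q q').
Proof.
move=> qW q'X /andP[qq' _]; have [g [q2 stq]] := WP qW.
have [q'C _ /(_ g) q'D] := X'P q'X.
have /andP[qD _] := qW.
have pq' : p.-group q'.2 by exact: C_pgroups.
apply/and4P; split=> //=; last first.
- by apply: pgroupS pq'; apply: finset.subsetIl.
- by apply: finset.subsetIr.
rewrite -[st (norm_in _ _)]/(st q) stq.
apply: (@nilpotent_proper_norm _ _ (D :^ g)%G); first exact: pgroup_nil pq'.
rewrite finset.properEneq /= -q2 qq' andbT; apply/eqP => E; apply: q'D.
by rewrite -E q2.
Qed.

Lemma N_sub_norm q : isN q -> q.2 \subset 'N(st q).
Proof.
by case/orP => [/and4P[]//|/WP[g [-> ->]]]; rewrite (normG (D :^ g)%G).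
Qed.

(** A chain outside the union contains a vertex of W and one of X'.  Its first
    vertex (Dg, _) lies in W; with P the stabilizer of the first vertex in X',
    insert (Dg, N_P(D^g)) in front of the latter.  All vertices of M in between
    lie below it, as they consist of subgroups of P normalizing D^g.  The pivots
    are the vertices of W and X'. *)
Lemma contract_union : contractible (sq_incl (@pgp_act1 gT) (@pgp_actM gT)
  (K := union_chains) (K' := chains isAJ isAJ) union_mem).
Proof.
pose e n (x : {ffun 'I_n.+1 -> pgp gT}) :=
  norm_in (vertex_at x 0) (vertex_at x (fpos isX' x)).
have aJ q g : isX' (pgp_act q g) = isX' q by rewrite (predJ_eq isX'J).
have new n (x : {ffun 'I_n.+1 -> pgp gT}) :
    chain_mem (addM isXW) (addM isXW) x && ~~ chain_mem (addM isX') isN x ->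
    [/\ is_chain x, forall i, addM isXW (x i),
        ~~ all_in (addM isX') x /\ ~~ all_in isN x, isW (vertex_at x 0)
      & (fpos isX' x < n.+1)%N].
  rewrite mem1 /chain_mem => /andP[/andP[xc /forallP xB]]; rewrite xc /= negb_or => /andP[xN1 xN2].
  have xc' := is_chainP _ xc.
  have [i xi] := not_all_in xN1; have [j xj] := not_all_in xN2.
  have {}xi : isW (x i).
    by move: xi (xB i); rewrite /addM /isXW negb_or => /andP[/negPf-> /negPf->].
  have {}xj : isX' (x j).
    move: xj (xB j); rewrite /addM /isXW /isN /= negb_or.
    by move=> /andP[/negPf-> /negPf->]; rewrite orbF.
  split=> //; last exact: fpos_lt_ex xj.
  have xi0 : le (vertex_at x 0) (x i) by apply: xc'; rewrite inordK.
  have [F|F|//] := addM_cases (xB (inord 0)).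
    by case: (M_le_WF F xi xi0).
  by case: (X'_le_WF F xi xi0).
apply: (@ins_contractible _ _ _ _ _ _ _ _ (predC isM) isX' e) => //.
- move=> n x g _; rewrite /e !vertex_at_act.
  rewrite (_ : fpos isX' (sq_act _ _ _) = fpos isX' x) ?norm_inJ //.
  by apply: eq_find => i; rewrite ffunE aJ.
- move=> n x /new[xc xB _ x0W fn]; rewrite /= mem1.
  have xc' := is_chainP _ xc; have xX := fpos_vertex_at fn.
  have le0 : le (vertex_at x 0) (vertex_at x (fpos isX' x)).
    by apply: xc'; rewrite !inordK.
  have eM := norm_in_M x0W xX le0.
  apply/andP; split; last first.
    by apply: all_in_ins; [lia|exact/forallP|rewrite /addM eM].
  apply: is_chain_ins => // [|i ip|i ip]; first by lia.
    have xiN : isN (x i).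
      have := xB i; rewrite /addM /isXW /isN (negPf (fpos_before ip)).
      by [].
    have x0i : le (vertex_at x 0) (x i) by apply: xc'; rewrite inordK.
    have st_i : st (vertex_at x 0) = st (x i).
      by apply: N_le_st x0i => //; rewrite /isN x0W orbT.
    have /andP[xiX _] : le (x i) (vertex_at x (fpos isX' x)).
      by apply: xc'; rewrite inordK //; lia.
    rewrite /le -[st (e n x)]/(st (vertex_at x 0)) st_i eqxx implybT andbT.
    by rewrite /= finset.subsetI xiX /= st_i N_sub_norm.
  have /andP[fi _] : le (vertex_at x (fpos isX' x)) (x i) by apply: xc'; rewrite inordK.
  have xi : isX' (x i).
    by apply: (X'_le_X' xX (xB i)); apply: xc'; rewrite inordK.
  rewrite /le (negPf (X_notM (X'_X xi))) andbT /=.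
  by apply: fintype.subset_trans fi; apply: finset.subsetIl.
- move=> n x /new[xc xB _ x0W fn]; rewrite /= negbK; apply: norm_in_M => //.
    exact: fpos_vertex_at.
  by apply: (is_chainP _ xc); rewrite !inordK.
- move=> n x j /new[xc xB [xN1 xN2] x0W fn]; rewrite /= negbK => xj; split.
    rewrite /chain_mem negb_and negb_or !face_not_all ?orbT //.
      by rewrite /isN xj.
    by rewrite /addM xj.
  have j0 : j <> 0%N :> nat.
    by move=> j0; apply: (W_MF x0W); rewrite (vertex_atE x j0).
  rewrite /e (fpos_face fn _).2.
    by rewrite vertex_at_face // (_ : bump j 0 = 0%N) //; rewrite /bump; lia.
  by move=> jf; apply: (M_X'F xj); rewrite -(vertex_atE x jf) fpos_vertex_at.
- move=> n x i j /new[xc xB _ _ _] ij xi _.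
  by apply: (X'_le_X' xi (xB j)); apply: (is_chainP _ xc); apply: ltnW.
move=> n x; rewrite /= mem1 /chain_mem => /andP[-> _] xA /=; apply/orP; left.
by apply/forallP => i; have := xA i; rewrite negbK /addM => ->.
Qed.

Lemma sigma_chain n (x : {ffun 'I_n.+1 -> pgp gT}) :
  chain_mem isN isN x -> chain_mem isW isW [ffun i => sigma (x i)].
Proof.
rewrite !mem1 => /andP[/is_chainP xc /forallP xN]; apply/andP; split.
  apply/is_chainP => i j ij; rewrite !ffunE.
  have E := N_le_st (xN i) (xN j) (xc i j ij).
  by rewrite /le /= -[st (sigma _)]/(st (x i)) E eqxx implybT andbT.
by apply/forallP => i; rewrite ffunE; apply/sigma_W/N_over.
Qed.
Lemma sigma_chainM n (x : {ffun 'I_n.+1 -> pgp gT}) :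
  chain_mem isM isM x -> chain_mem isW isW [ffun i => sigma (x i)].
Proof. by move/(sub_mem M_N)/sigma_chain. Qed.

Definition forget_N : gspmap (chain_space isNJ) (chain_space isWJ) :=
  sq_map (@pgp_act1 gT) (@pgp_actM gT) (K := chains isNJ isNJ)
    (K' := chains isWJ isWJ) sigmaJ sigma_chain.
Definition forget_M : gspmap (chain_space isMJ) (chain_space isWJ) :=
  sq_map (@pgp_act1 gT) (@pgp_actM gT) (K := chains isMJ isMJ)
    (K' := chains isWJ isWJ) sigmaJ sigma_chainM.

Lemma X'_X_sub : subpred isX' isX. Proof. exact: X'_X. Qed.

Lemma sigma_id q : isW q -> sigma q = q.
Proof.
case/andP => qD /eqP qs; case: q qD qs => S P qD qs; congr pair.
by apply: val_inj => /=; rewrite -/(stg (S, P)) stgE.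
Qed.

Lemma M_B : subpred isM (addM isX'). Proof. by move=> q qM; rewrite /addM qM. Qed.
Lemma X'_XW : subpred isX' isXW. Proof. by move=> q qX; rewrite /isXW qX. Qed.

Lemma all_mem (A : pred (pgp gT)) n (x : {ffun 'I_n.+1 -> pgp gT}) :
  chain_mem A A x -> is_chain x /\ forall i, A (x i).
Proof. by rewrite mem1 => /andP[xc /forallP xA]. Qed.

(** Only the closure properties of E are used, so that homology and cohomology are
    served together. *)
Lemma model_equiv (E : forall X Y : fingspace gT, gspmap X Y -> Prop) :
  equivalence_class E ->
  (E _ _ (incl isX'J isXJ X'_X_sub) <-> E _ _ forget_M).
Proof.
case=> comp_l comp_r contr exc.
have Einc A B AJ BJ (AB : subpred A B) :
    contractible (@incl A B AJ BJ AB) -> E _ _ (incl AJ BJ AB).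
  by apply: contr; apply: sq_incl_inj.
have e1 : E _ _ (incl isX'J isXWJ X'_XW) <-> E _ _ (incl isX'J isXJ X'_X_sub).
  apply: (comp_r _ _ _ _ (incl isXWJ isXJ XW_X)); last exact/Einc/contract_XW_X.
  by move=> n x; apply: val_inj.
have X'_A : subpred isX' (addM isXW).
  by move=> q qX; apply/sub_addM/X'_XW.
have e2 : E _ _ (incl isX'J isXWJ X'_XW) <-> E _ _ (incl isX'J isAJ X'_A).
  apply: (comp_r _ _ _ _ (incl isXWJ isAJ (@sub_addM isXW))).
    by move=> n x; apply: val_inj.
  by apply: Einc; apply: contract_addM => //; exact: X'_XW.
have B_A : subpred (addM isX') (addM isXW).
  by move=> q /orP[qM|/X'_XW qX]; rewrite /addM ?qM ?qX ?orbT.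
have e3 : E _ _ (incl isBJ isAJ B_A) <-> E _ _ (incl isX'J isAJ X'_A).
  apply: (comp_l _ _ _ (incl isX'J isBJ (@sub_addM isX'))).
    by move=> n x; apply: val_inj.
  by apply: Einc; apply: contract_addM => //; exact: X'_XW.
pose Z := sq (@pgp_act1 gT) (@pgp_actM gT) union_chains.
have B_Z n (x : {ffun 'I_n.+1 -> pgp gT}) :
    chain_mem (addM isX') (addM isX') x -> union_chains n x.
  by rewrite mem1 => /andP[xc xA]; rewrite /= /chain_mem xc xA.
have N_Z n (x : {ffun 'I_n.+1 -> pgp gT}) :
    chain_mem isN isN x -> union_chains n x.
  by rewrite mem1 => /andP[xc xA]; rewrite /= /chain_mem xc xA orbT.
pose j : gspmap (chain_space isBJ) Z := sq_incl (@pgp_act1 gT) (@pgp_actM gT)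
  (K := chains isBJ isBJ) (K' := union_chains) B_Z.
pose aN : gspmap (chain_space isNJ) Z := sq_incl (@pgp_act1 gT) (@pgp_actM gT)
  (K := chains isNJ isNJ) (K' := union_chains) N_Z.
pose u : gspmap Z (chain_space isAJ) := sq_incl (@pgp_act1 gT) (@pgp_actM gT)
  (K := union_chains) (K' := chains isAJ isAJ) union_mem.
(* Up to the contractible inclusion u, B -> Z is B -> M + W + X'. *)
have e4 : E _ _ j <-> E _ _ (incl isBJ isAJ B_A).
  apply: (comp_r _ _ _ _ u); first by move=> n x; apply: val_inj.
  apply: contr contract_union; exact: sq_incl_inj.
have e5 : E _ _ (incl isMJ isNJ M_N) <-> E _ _ j.
  apply: (exc _ _ _ _ _ _ aN (incl isMJ isBJ M_B)).
  - exact: sq_incl_inj.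
  - exact: sq_incl_inj.
  - exact: sq_incl_inj.
  - by move=> n x; apply: val_inj.
  - move=> n y; have /andP[yc /orP[yA|yA]] : union_chains n (val y) := valP y.
      right; have yB : chain_mem (addM isX') (addM isX') (val y) by rewrite mem1 yc.
      by exists (exist _ (val y) yB); apply: val_inj.
    left; have yN : chain_mem isN isN (val y) by rewrite mem1 yc.
    by exists (exist _ (val y) yN); apply: val_inj.
  move=> n x y /(congr1 val) xy; have {}xy : val x = val y := xy.
  have [xc xN] := all_mem (valP x); have [_ yB] := all_mem (valP y).
  have xM : chain_mem isM isM (val x).
    rewrite mem1 xc /=; apply/forallP => i.
    case/orP: (xN i) => // xW; case/orP: (yB i); rewrite -xy // => xX.
    by case: (W_X'F xW xX).
  by exists (exist _ (val x) xM); apply: val_inj.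
(* The projection is a left inverse of the equivalence W -> M + W. *)
have e6 : E _ _ forget_N.
  apply: (comp_l _ _ _ (incl isWJ isNJ W_N) forget_N (incl isWJ isWJ (fun _ => id)) _ _).2.
  - move=> n x; apply: val_inj; apply/ffunP => i; rewrite /= ffunE sigma_id //.
    by have [_] := all_mem (valP x).
  - exact/Einc/contract_W_N.
  apply/Einc/bij_contractible => n.
  by apply: bij_of_inj_surj => [|x]; [exact: sq_incl_inj | exists x; apply: val_inj].
have e7 : E _ _ (incl isMJ isNJ M_N) <-> E _ _ forget_M.
  apply: (comp_r _ _ _ _ forget_N) => // n x; apply: val_inj.
  by apply/ffunP => i; rewrite !ffunE.
by rewrite -e1 e2 -e3 -e4 -e5.
Qed.

End Insertions.
End Model.

(** * Approximations of the point as nerves *)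

Section Approximation.
Variable gT : finGroupType.
Local Open Scope group_scope.
Variables (p : nat) (D : {group gT}) (C : {set {group gT}}).
Hypothesis AJ : forall q g, of_collection C q -> of_collection C (pgp_act q g).

Lemma rcoset_quotient (H : {group gT}) (S : {set gT}) :
  S \in rcosets H [set: gT] -> S * S^-1 = H.
Proof.
case/rcosetsP=> x _ ->; rewrite invMg invg_set1 mulgA -(mulgA _ [set x]).
by rewrite mulg_set1 mulgV mulg1 invGid mulGid.
Qed.

(** A simplex S_0 -> ... -> S_n of the approximation, with a point of S_0, is
    determined by the images of the point in the S_i, which are cosets. *)
Definition vertex (S : {set gT}) : pgp gT := (S, <<S^-1 * S>>%G).

Lemma vertexJ S g : vertex (S :* g) = pgp_act (vertex S) g.
Proof.
congr pair; apply: val_inj; rewrite /= -[_ * _]/(st (pgp_act (S, 1%G) g)).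
by rewrite stJ genJ.
Qed.

Lemma vertex_of (H : {group gT}) (S : {set gT}) : H \in C ->
  S \in rcosets H [set: gT] -> of_collection C (vertex S).
Proof.
move=> HC SH; apply/andP; split; first by apply/existsP; exists H; rewrite HC.
have [g [_ E]] := @st_rcoset _ H (vertex S) SH.
rewrite /pgp_std E; apply/eqP; rewrite /= -[S^-1 * S]/(st (vertex S)) E.
exact: (genGid (H :^ g)%G).
Qed.

Lemma vertex_std q : of_collection C q -> vertex q.1 = q.
Proof.
case: q => S P /andP[_ /eqP qs]; congr pair; apply: val_inj.
by rewrite /= -[S^-1 * S]/(st (S, P)) -qs genGid.
Qed.

Lemma gmap_st (H K : {group gT}) (k : gmap (gorbit H) (gorbit K)) (s : gorbit H) P Q :
  st (val s, P) \subset st (val (k s), Q).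
Proof.
have [x [sx ->]] := @st_rcoset _ H (val s, P) (valP s).
have [y [kx ->]] := @st_rcoset _ K (val (k s), Q) (valP (k s)).
have {}sx : val s = H :* x := sx; have {}kx : val (k s) = K :* y := kx.
apply/fintype.subsetP => h hH.
have E : gset_act _ s h = s.
  apply: val_inj; rewrite /= sx -rcosetM; apply/rcoset_eqP.
  by rewrite mem_rcoset; move: hH; rewrite mem_conjg conjgE invgK mulgA.
have := gmapJ k s h; rewrite E => /(congr1 val) /=.
rewrite kx -rcosetM => /esym/rcoset_eqP.
by rewrite mem_rcoset mem_conjg conjgE invgK mulgA.
Qed.

Lemma le_std (q q' : pgp gT) : of_collection C q' -> le p D q q' = (q.2 \subset q'.2).
Proof. by move=> /andP[_ q's]; rewrite /le (negPf (std_notM p D q's)) andbT. Qed.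

Section Kappa.
Variable n : nat.
Implicit Type u : approx_point C n.

Definition coset_at u (i : 'I_n.+1) : {set gT} :=
  val (oc_mor (he_chain u) (leq0n i : (@ord0 n <= i)%N) (he_pt u)).

Lemma coset_at_mem u i : coset_at u i \in rcosets (oc_ob (he_chain u) i) [set: gT].
Proof. exact: valP. Qed.

Lemma coset_at_mor u (i j : 'I_n.+1) (ij : (i <= j)%N) :
  coset_at u j = val (oc_mor (he_chain u) ij
    (oc_mor (he_chain u) (leq0n i : (@ord0 n <= i)%N) (he_pt u))).
Proof. by rewrite /coset_at; congr val; apply: oc_mor_comp. Qed.

Definition kappa_raw u : {ffun 'I_n.+1 -> pgp gT} := [ffun i => vertex (coset_at u i)].

Lemma kappa_mem u : chains p D AJ AJ n (kappa_raw u).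
Proof.
have uC i : of_collection C (vertex (coset_at u i)).
  exact: vertex_of (oc_in (he_chain u) i) (coset_at_mem u i).
rewrite /= mem1; apply/andP; split; last by apply/forallP => i; rewrite ffunE.
apply/is_chainP => i j ij; rewrite !ffunE le_std //.
have /andP[_ /eqP ->] := uC i; have /andP[_ /eqP ->] := uC j.
by rewrite (coset_at_mor u ij); apply: gmap_st.
Qed.
End Kappa.

Definition kappa_fun n (u : approx_point C n) : chain_space p D AJ n :=
  exist _ (kappa_raw u) (kappa_mem u).
Lemma kappaJ n u g : @kappa_fun n (gset_act _ u g) = gset_act _ (kappa_fun u) g.
Proof.
apply: val_inj; apply/ffunP => i; rewrite !ffunE /= -vertexJ; congr vertex.
rewrite /coset_at; case: u => c s h /=.
by have /(congr1 val) := gmapJ (oc_mor c (leq0n i : (@ord0 n <= i)%N)) s g.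
Qed.
Lemma kappaP m n (f : mono m n) u :
  GMap (@kappaJ m) (gspmor (approx_point C) f u) =
  gspmor (chain_space p D AJ) f (GMap (@kappaJ n) u).
Proof.
apply: val_inj; apply/ffunP => i; rewrite !ffunE; congr vertex.
by rewrite /coset_at /=; congr val; apply/esym/oc_mor_comp.
Qed.
Definition kappa : gspmap (approx_point C) (chain_space p D AJ) := GSpMap kappaP.

Lemma kappa_inj n : injective (kappa n).
Proof.
move=> u u' /(congr1 val) /ffunP E.
have {}E i : coset_at u i = coset_at u' i.
  by have := congr1 fst (E i); rewrite !ffunE.
have obE : oc_ob (he_chain u) = oc_ob (he_chain u').
  apply: funext => i; apply: val_inj.
  rewrite -[LHS](rcoset_quotient (coset_at_mem u i)) E.
  exact: rcoset_quotient (coset_at_mem u' i).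
case: u u' E obE => [[ob1 in1 mor1 id1 comp1] s1 h1] [[ob2 in2 mor2 id2 comp2] s2 h2].
move=> /= E obE; subst ob2.
have morE (i j : 'I_n.+1) (ij : (i <= j)%N) s : mor1 i j ij s = mor2 i j ij s.
  have E0 : mor1 ord0 i (leq0n i) s1 = mor2 ord0 i (leq0n i) s2.
    exact/val_inj/(E i).
  have E1 : mor1 i j ij (mor1 ord0 i (leq0n i) s1) = mor2 i j ij (mor1 ord0 i (leq0n i) s1).
    rewrite [in RHS]E0 -(comp1 ord0 i j (leq0n i) ij (leq0n j)).
    by rewrite -(comp2 ord0 i j (leq0n i) ij (leq0n j)); apply/val_inj/(E j).
  have [g ->] : exists g, s = gset_act _ (mor1 ord0 i (leq0n i) s1) g.
    have [a ->] := gbaseP s; have [b ->] := gbaseP (mor1 ord0 i (leq0n i) s1).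
    by exists (b^-1 * a); rewrite gset_actM gset_actK.
  by rewrite !gmapJ E1.
apply: hcoend_eq => //; last by move=> t; case: (h1 t); case: (h2 t).
have := E ord0; rewrite /coset_at /= => /val_inj.
by rewrite id1 id2.
Qed.

Section Surjective.
Variables (n : nat) (x : chain_space p D AJ n).
Let S i : {set gT} := (val x i).1.
Let ob i : {group gT} := <<S i * (S i)^-1>>%G.

Let xC i : of_collection C (val x i).
Proof. by have [_] := all_mem (valP x). Qed.

Lemma S_coset i : ob i \in C /\ S i \in rcosets (ob i) [set: gT].
Proof.
have /andP[/existsP[H /andP[HC SH]] _] := xC i.
suff -> : ob i = H by [].
by apply: val_inj; rewrite /= (rcoset_quotient SH) genGid.
Qed.

(** The inclusion of stabilizers makes S_i |-> S_j extend to a G-map between orbits;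
    this computes its value S_j S_i^-1 s at an arbitrary coset s. *)
Lemma S_mul (i j : 'I_n.+1) a b y : (i <= j)%N -> S i = ob i :* a -> S j = ob j :* b ->
  S j * ((S i)^-1 * (ob i :* y)) = ob j :* (b * a^-1 * y).
Proof.
move=> ij Sa Sb.
have st_i : st (val x i) = ob i :^ a by apply: st_coset.
have st_j : st (val x j) = ob j :^ b by apply: st_coset.
have sub : ob i :^ a \subset ob j :^ b.
  have [xc _] := all_mem (valP x); have := is_chainP _ _ _ xc i j ij.
  rewrite le_std //; have /andP[_ /eqP ->] := xC i; have /andP[_ /eqP ->] := xC j.
  by rewrite st_i st_j.
have -> : (S i)^-1 * (ob i :* y) = (ob i :^ a) * [set a^-1 * y].
  rewrite Sa invMg invGid invg_set1 mulgA -(mulgA _ (ob i : {set gT}) (ob i)) mulGid.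
  by rewrite conjsgE -!mulgA !mulg_set1 mulKVg.
have -> : S j = [set b] * (ob j :^ b)%G.
  by rewrite Sb /= conjsgE mulgA mulg_set1 mulgV mul1g.
rewrite mulgA -(mulgA _ _ (ob i :^ a)) (mulGSid sub).
by rewrite /= conjsgE mulgA mulg_set1 mulgV mul1g -mulgA mulg_set1 !mulgA.
Qed.

Definition chain_mor_fun (i j : 'I_n.+1) (ij : (i <= j)%N) (s : gorbit (ob i)) : {set gT} :=
  S j * ((S i)^-1 * val s).

Lemma chain_mor_mem i j ij s : @chain_mor_fun i j ij s \in rcosets (ob j) [set: gT].
Proof.
have [_ /rcosetsP[a _ Sa]] := S_coset i; have [_ /rcosetsP[b _ Sb]] := S_coset j.
have /rcosetsP[y _ sy] := valP s; rewrite /chain_mor_fun sy (S_mul _ ij Sa Sb).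
by apply/rcosetsP; exists (b * a^-1 * y); rewrite ?inE.
Qed.
Definition chain_mor_map i j ij s : gorbit (ob j) :=
  exist _ (@chain_mor_fun i j ij s) (chain_mor_mem ij s) : orbit_car (ob j).
Lemma chain_morJ i j ij s g :
  @chain_mor_map i j ij (gset_act _ s g) = gset_act _ (chain_mor_map ij s) g.
Proof. by apply: val_inj; rewrite /= /chain_mor_fun /= !mulgA. Qed.
Definition chain_mor i j ij : gmap (gorbit (ob i)) (gorbit (ob j)) :=
  GMap (@chain_morJ i j ij).
Lemma chain_mor_id i ii s : @chain_mor i i ii s = s.
Proof.
apply: val_inj; rewrite /= /chain_mor_fun.
have [_ /rcosetsP[a _ Sa]] := S_coset i; have /rcosetsP[y _ sy] := valP s.
by rewrite sy (S_mul _ ii Sa Sa) mulgV mul1g.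
Qed.
Lemma chain_mor_comp i j k ij jk ik s :
  @chain_mor i k ik s = @chain_mor j k jk (@chain_mor i j ij s).
Proof.
apply: val_inj; rewrite /= /chain_mor_fun /= /chain_mor_fun.
have [_ /rcosetsP[a _ Sa]] := S_coset i; have [_ /rcosetsP[b _ Sb]] := S_coset j.
have [_ /rcosetsP[c _ Sc]] := S_coset k; have /rcosetsP[y _ sy] := valP s.
rewrite sy (sy : sval s = _) (S_mul _ ij Sa Sb) (S_mul _ jk Sb Sc) (S_mul _ ik Sa Sc).
by rewrite !mulgA mulgKV.
Qed.

Definition chain_of : orb_chain C n :=
  OrbChain (fun i => (S_coset i).1) chain_mor_id chain_mor_comp.
Lemma kappa_surj : exists u, kappa n u = x.
Proof.
pose s0 : gorbit (ob ord0) := exist _ (S ord0) (S_coset ord0).2 : orbit_car (ob ord0).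
pose h : gmap (gorbit (ob ord_max)) (gpoint gT n) :=
  @GMap gT (gorbit (ob ord_max)) (gpoint gT n) (fun=> tt) (fun _ _ => erefl).
exists (@HCoend gT C (gpoint gT) n chain_of s0 h).
apply: val_inj; apply/ffunP => i; rewrite ffunE -[RHS]vertex_std //.
congr vertex; rewrite /coset_at /= /chain_mor_fun /=.
have [_ /rcosetsP[a _ Sa]] := S_coset ord0; have [_ /rcosetsP[b _ Sb]] := S_coset i.
by rewrite [X in _ * (_ * X)]Sa (@S_mul ord0 i a b _ (leq0n i) Sa Sb) mulgKV -Sb.
Qed.
End Surjective.

Lemma kappa_bij n : bijective (kappa n).
Proof. exact: bij_of_inj_surj (@kappa_inj n) (@kappa_surj n). Qed.
End Approximation.

(** * The Borel construction as a nerve *)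

Section Induce.
Variables (gT : finGroupType) (D : {group gT}) (E : gspace (coset_of D)).
Variables (Z : fingspace gT) (iota : forall n, E n -> Z n).
Hypothesis iota_nat : forall m n (f : mono m n) s,
  gspmor Z f (iota s) = iota (gspmor E f s).
Hypothesis iota_inj : forall n, injective (@iota n).
Hypothesis iota_fix : forall n (s : E n) g, g \in D -> gset_act _ (iota s) g = iota s.
Hypothesis iota_free : forall n (s : E n) g, gset_act _ (iota s) g = iota s -> g \in D.
Hypothesis iota_weyl : forall n (s : E n) g, g \in 'N(D)%g ->
  iota (gset_act _ s (coset D g)) = gset_act _ (iota s) g.
Hypothesis iota_cover : forall n (t : Z n), exists s g, t = gset_act _ (iota s) g.

Definition ind_k n (s : E n) : gmap (gorbit D) (Z n) :=
  projT1 (cid (gorbit_map_ex (@iota_fix n s))).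
Lemma ind_kE n (s : E n) : ind_k s (gbase D) = iota s.
Proof. exact: projT2 (cid (gorbit_map_ex (@iota_fix n s))). Qed.

Lemma ind_k_inj n (s : E n) : injective (ind_k s).
Proof.
move=> t t'; have [g ->] := gbaseP t; have [g' ->] := gbaseP t'.
rewrite !gmapJ ind_kE => /(congr1 (gset_act (Z n) ^~ g'^-1%g)).
rewrite gset_actK -gset_actM => /iota_free gD; apply: val_inj => /=.
by apply/rcoset_eqP; rewrite mem_rcoset.
Qed.
Lemma ind_k_base n (s s' : E n) : ind_k s (gbase D) = ind_k s' (gbase D) -> s = s'.
Proof. by rewrite !ind_kE => /iota_inj. Qed.
Lemma ind_k_cover n (t : Z n) : exists s g, t = gset_act _ (ind_k s (gbase D)) g.
Proof. by have [s [g ->]] := iota_cover t; exists s, g; rewrite ind_kE. Qed.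
Lemma ind_k_weyl n (s : E n) w :
  ind_k (gset_act _ s w) =1 gmap_comp (ind_k s) (weyl_map w).
Proof.
apply: gorbit_map_eq; have [g Ng ->] := cosetP w.
rewrite ind_kE iota_weyl //= -ind_kE -gmapJ; congr (ind_k s _); apply: val_inj.
by rewrite /= val_coset // (norm_rlcoset Ng) -mulgA mulGid.
Qed.
Lemma ind_k_nat m n (f : mono m n) s :
  gmap_comp (gspmor Z f) (ind_k s) =1 ind_k (gspmor E f s).
Proof. by apply: gorbit_map_eq; rewrite /= !ind_kE iota_nat. Qed.

Lemma induced_of : exists k : induced E Z, forall n s, k n s (gbase D) = iota s.
Proof.
by exists (Induced ind_k_inj ind_k_base ind_k_cover ind_k_weyl ind_k_nat) => n s;
  apply: ind_kE.
Qed.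
End Induce.

Section WeylModel.
Variables (gT : finGroupType) (p : nat) (D : {group gT}).
Local Open Scope group_scope.
Hypothesis pD : p.-group D.
Let W : finGroupType := coset_of D.

Lemma coset_over (w : W) P : exists2 x, x \in 'N(D) & (w : {set gT}) = D :* x /\
  st ((w : {set gT}), P) = D.
Proof.
have [x Nx wx] := cosetP w; exists x => //; have wE : (w : {set gT}) = D :* x.
  by rewrite wx val_coset.
by rewrite (st_coset (H := D) (g := x)) // (normP Nx).
Qed.

Lemma over_D_coset (w : W) P : over_D D ((w : {set gT}), P).
Proof.
have [x _ [wE _]] := coset_over w P; apply/rcosetsP.
by exists x; rewrite ?inE.
Qed.

Lemma coset_fix (w : W) g : g \in D -> (w : {set gT}) :* g = w.
Proof.
move=> Dg; have [x Nx [-> _]] := coset_over w 1%G.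
by rewrite (norm_rlcoset Nx) -mulgA rcoset_id.
Qed.

Lemma coset_free (w : W) g : (w : {set gT}) :* g = w -> g \in D.
Proof.
have [x Nx [-> _]] := coset_over w 1%G; rewrite (norm_rlcoset Nx) -mulgA.
move/(congr1 (fun S => x^-1 *: S)); rewrite !mulgA !mulg_set1 mulVg !mul1g => E.
by have := rcoset_refl D g; rewrite E.
Qed.

Lemma coset_mulr (w : W) g : g \in 'N(D) ->
  ((w * coset D g : W) : {set gT}) = (w : {set gT}) :* g.
Proof.
move=> Ng; have [x Nx ->] := cosetP w.
by rewrite -morphM // !val_coset ?groupM // rcosetM.
Qed.

Section OverW.
Let E := spprod (EG W) (gpoint W).
Definition iotaW_raw n (u : E n) : {ffun 'I_n.+1 -> pgp gT} :=
  [ffun i => ((u.1 i : W) : {set gT}, D)].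
Lemma iotaW_mem n (u : E n) : chains p D (isWJ (D := D)) (isWJ (D := D)) n (iotaW_raw u).
Proof.
rewrite /= mem1; apply/andP; split.
  apply/is_chainP => i j _; rewrite !ffunE /le subxx /=.
  have [_ _ [_ ->]] := coset_over (u.1 i) D.
  by have [_ _ [_ ->]] := coset_over (u.1 j) D; rewrite eqxx implybT.
apply/forallP => i; rewrite ffunE /isW over_D_coset /pgp_std.
by have [_ _ [_ ->]] := coset_over (u.1 i) D; rewrite eqxx.
Qed.
Definition iotaW n (u : E n) : chain_space p D (isWJ (D := D)) n :=
  exist _ (iotaW_raw u) (iotaW_mem u).

(** A simplex of the nerve of W whose stabilizer is D consists of cosets Dx with x in
    N(D), that is, of elements of the Weyl group. *)
Lemma induced_W : exists k : induced E (chain_space p D (isWJ (D := D))),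
  forall n s, k n s (gbase D) = iotaW s.
Proof.
apply: (@induced_of _ _ _ _ (@iotaW)) => [m n f s|n [e []] [e' []]|n s g Dg|n s g|n s g Ng|n t].
- by apply: val_inj; apply/ffunP => i; rewrite !ffunE.
- move=> /(congr1 val) /ffunP ee'; congr pair; apply: funext => i.
  by apply: val_inj; have := congr1 fst (ee' i); rewrite !ffunE.
- apply: val_inj; apply/ffunP => i; rewrite !ffunE; congr pair.
    exact: coset_fix.
  by apply: val_inj; rewrite /= conjGid.
- move=> /(congr1 val) /ffunP /(_ ord0) /(congr1 fst); rewrite !ffunE /=.
  exact: coset_free.
- apply: val_inj; apply/ffunP => i; rewrite !ffunE; congr pair.
    exact: coset_mulr.
  by apply: val_inj; rewrite /= (normP Ng).
have [tc tW] := all_mem (valP t); have tc' := is_chainP _ _ _ tc.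
have [g0 [E1 _]] := WP (tW ord0).
have t2 i : (val t i).2 = D :^ g0 :> {set gT}.
  have [g [E3 _]] := WP (tW i).
  have /andP[le0i _] := tc' ord0 i (leq0n i).
  by apply/eqP; rewrite eq_sym -E1 eqEcard le0i E1 E3 !cardJg leqnn.
have tx i : exists x, x \in 'N(D) /\ (val t i).1 = D :* (x * g0).
  have /andP[/rcosetsP[y _ yE] /eqP ts] := tW i.
  exists (y * g0^-1); rewrite mulgKV; split=> //.
  apply/normP; rewrite conjsgM.
  have <- : (val t i).2 = D :^ y :> {set gT} by rewrite ts (st_coset yE).
  by rewrite t2 -conjsgM mulgV conjsg1.
have [x xE] := choice tx.
exists ((fun i => coset D (x i)), tt), g0.
apply: val_inj; apply/ffunP => i; rewrite !ffunE.
have [Nx tE] := xE i.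
rewrite [LHS]surjective_pairing; congr pair.
  by rewrite tE /= val_coset // rcosetM.
exact/val_inj/t2.
Qed.
End OverW.

Section OverM.
Let E := spprod (EG W) (psub_nerve p W).
Definition iotaM_raw n (u : E n) : {ffun 'I_n.+1 -> pgp gT} :=
  [ffun i => ((u.1 i : W) : {set gT}, (coset D @*^-1 (val (pc_fun u.2 i)))%G)].

Lemma cosetpre_p (Q : {group W}) : p.-group Q -> p.-group (coset D @*^-1 Q).
Proof.
move=> pQ; rewrite -(pquotient_pgroup pD) ?cosetpreK //.
by apply: subsetIl.
Qed.

Lemma iotaM_isM (w : W) (Q : Defs.psubgroup p W) :
  isM p D ((w : {set gT}), (coset D @*^-1 (val Q))%G).
Proof.
have /andP[pQ Q1] := valP Q.
have [_ _ [_ stE]] := coset_over w (coset D @*^-1 (val Q))%G.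
apply/and4P; split; rewrite ?stE /=.
- exact: over_D_coset.
- rewrite finset.properEneq sub_cosetpre andbT; apply: contraNneq Q1 => DQ.
  by apply/eqP/val_inj; rewrite /= -(cosetpreK (val Q)) -DQ trivg_quotient.
- exact: subsetIl.
exact: cosetpre_p.
Qed.

Lemma iotaM_mem n (u : E n) : chains p D (@isMJ _ p D) (@isMJ _ p D) n (iotaM_raw u).
Proof.
rewrite /= mem1; apply/andP; split; last by apply/forallP => i; rewrite ffunE iotaM_isM.
apply/is_chainP => i j ij; rewrite !ffunE /le /= morphpreS ?pc_le //=.
have [_ _ [_ ->]] := coset_over (u.1 i) (coset D @*^-1 (val (pc_fun u.2 i)))%G.
have [_ _ [_ ->]] := coset_over (u.1 j) (coset D @*^-1 (val (pc_fun u.2 j)))%G.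
by rewrite eqxx implybT.
Qed.
Definition iotaM n (u : E n) : chain_space p D (@isMJ _ p D) n :=
  exist _ (iotaM_raw u) (iotaM_mem u).

(** A simplex of the nerve of M whose stabilizer is D consists of cosets Dx with x in
    N(D) and of p-groups P with D < P <= N(D), which correspond to the
    non-identity p-subgroups P/D of the Weyl group. *)
Lemma induced_M : exists k : induced E (chain_space p D (@isMJ _ p D)),
  forall n s, k n s (gbase D) = iotaM s.
Proof.
apply: (@induced_of _ _ _ _ (@iotaM)) => [m n f s|n [e c] [e' c']|n s g Dg|n s g|n s g Ng|n t].
- by apply: val_inj; apply/ffunP => i; rewrite !ffunE.
- move=> /(congr1 val) /ffunP ee'; congr pair.
    apply: funext => i.
    by apply: val_inj; have := congr1 fst (ee' i); rewrite !ffunE.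
  apply: psub_chain_eq => i; apply: val_inj; apply: val_inj.
  have /(congr1 val) /= E0 := congr1 snd (ee' i); move: E0; rewrite !ffunE /= => E0.
  by rewrite -[LHS]cosetpreK E0 cosetpreK.
- apply: val_inj; apply/ffunP => i; rewrite !ffunE; congr pair.
    exact: coset_fix.
  apply: val_inj; rewrite /= conjGid //.
  exact: (fintype.subsetP (sub_cosetpre (val (pc_fun s.2 i)))).
- move=> /(congr1 val) /ffunP /(_ ord0) /(congr1 fst); rewrite !ffunE /=.
  exact: coset_free.
- apply: val_inj; apply/ffunP => i; rewrite !ffunE; congr pair.
    exact: coset_mulr.
  by apply: val_inj; rewrite /= morphpreJ.
have [tc tM] := all_mem (valP t); have tc' := is_chainP _ _ _ tc.
have [g0 [st0 _ _ _]] := MP (tM ord0).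
have st_t i : st (val t i) = D :^ g0.
  by have /andP[_] := tc' ord0 i (leq0n i); rewrite tM st0 /= => /eqP.
have tx i : exists x, x \in 'N(D) /\ (val t i).1 = D :* (x * g0).
  have /and4P[/rcosetsP[y _ yE] _ _ _] := tM i.
  exists (y * g0^-1); rewrite mulgKV; split=> //.
  by apply/normP; rewrite conjsgM -(st_coset yE) st_t -conjsgM mulgV conjsg1.
have [x xE] := choice tx.
pose P i : {group gT} := ((val t i).2 :^ g0^-1)%G.
have Pprop i : [/\ D \proper P i, P i \subset 'N(D) & p.-group (P i)].
  have /and4P[_] := tM i; rewrite st_t => lt sN pP.
  rewrite /= pgroupJ; split=> //.
    by rewrite -(conjsgK g0 D) properJ.
  by rewrite -(conjsgK g0 D) normJ conjSg.
have DP i : D <| P i.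
  by have [lt sN _] := Pprop i; rewrite /normal sN andbT proper_sub.
have Qprop i : p.-group (P i / D)%G && ((P i / D)%G != 1%G).
  have [lt sN pP] := Pprop i; rewrite quotient_pgroup //=; apply/eqP => /(congr1 val) /= E0.
  have := quotientGK (DP i); rewrite /= E0 => E1.
  have := lt; rewrite /= -E1 /= -[coset D @*^-1 1]/('ker (coset D)) ker_coset.
  by rewrite fintype.properxx.
pose Q i : Defs.psubgroup p W := exist _ (P i / D)%G (Qprop i).
have Qle (i j : 'I_n.+1) : (i <= j)%N -> val (Q i) \subset val (Q j).
  by move=> /tc' /andP[ij _]; rewrite /= quotientS //= conjSg.
exists ((fun i => coset D (x i)), PsubChain Qle), g0.
apply: val_inj; apply/ffunP => i; rewrite !ffunE.
have [Nx tE] := xE i.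
rewrite [LHS]surjective_pairing; congr pair.
  by rewrite tE /= val_coset // rcosetM.
apply: val_inj; rewrite /= -[coset D @*^-1 _]/(coset D @*^-1 (P i / D)).
by rewrite quotientGK // /P /= conjsgKV.
Qed.
End OverM.

Lemma forget_borel n (u : spprod (EG W) (psub_nerve p W) n) :
  forget_M p D n (iotaM u) = iotaW (borel_map p W n u).
Proof.
apply: val_inj; apply/ffunP => i.
rewrite !ffunE; congr pair; apply: val_inj => /=.
have [_ _ [_ stE]] := coset_over (u.1 i) (coset D @*^-1 (val (pc_fun u.2 i)))%G.
by rewrite stE genGid.
Qed.
End WeylModel.

Local Open Scope group_scope.

Theorem lemma5p1 (p : nat) (p_prime : prime p) (gT : finGroupType)
    (D : {group gT}) (C : {set {group gT}})
    (C_collection : is_collection C)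
    (C_pgroups : forall H : {group gT}, H \in C -> p.-group H)
    (D_in_C : D \in C)
    (D_minimal : forall H : {group gT}, H \in C -> H \subset D -> H = D)
    (C_supergroups : forall P : {group gT},
      p.-group P -> D \subset P -> P \in C) :
  (forall mu : hcoef gT,
     (forall n, bijective (bredon_homology_map mu
        (approx_point_incl (subsetDl C (conj_subgroups D))) n)) <->
     homologically_ample p (hweyl D mu)) /\
  (forall mu : ccoef gT,
     (forall n, bijective (bredon_cohomology_map mu
        (approx_point_incl (subsetDl C (conj_subgroups D))) n)) <->
     cohomologically_ample p (cweyl D mu)).
Proof.
have pD := C_pgroups _ D_in_C.
have main (E : forall X Y : fingspace gT, gspmap X Y -> Prop) :
    equivalence_class E ->
    E _ _ (approx_point_incl (subsetDl C (conj_subgroups D))) <-> E _ _ (forget_M p D).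
  move=> EE; have [comp_l comp_r contr _] := EE.
  rewrite -(model_equiv C_collection C_pgroups D_in_C D_minimal C_supergroups EE).
  pose k' := kappa p D (isX'J (D := D) (C := C)).
  pose k := kappa p D (isXJ (C := C)).
  pose f := approx_point_incl (subsetDl C (conj_subgroups D)).
  have kE : E _ _ k.
    apply: contr => [n|]; first exact: kappa_inj.
    by apply: bij_contractible => n; apply: kappa_bij.
  have k'E : E _ _ k'.
    apply: contr => [n|]; first exact: kappa_inj.
    by apply: bij_contractible => n; apply: kappa_bij.
  have e1 : E _ _ f <-> E _ _ (gspmap_comp k f) by apply: (comp_r _ _ _ _ k).
  rewrite e1; symmetry; apply: (comp_l _ _ _ k') => // n u.
  exact: val_inj.
have [kM kME] := induced_M pD; have [kW kWE] := induced_W p D.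
have kMW n s : gmap_comp (forget_M p D n) (kM n s) =1 kW n (borel_map p _ n s).
  apply: gorbit_map_eq; rewrite kWE -[LHS]/(forget_M p D n (kM n s (gbase D))).
  by rewrite kME; apply: forget_borel.
split=> mu.
  apply: iff_trans (main _ (homology_class mu)) _.
  exact: twisted_homology_compare kMW mu.
apply: iff_trans (main _ (cohomology_class mu)) _.
exact: twisted_cohomology_compare kMW mu.
Qed.
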